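(* Let $X=\mathbb{V}(x_1x_2\cdots x_ky_1^{a_1}\cdots y_m^{a_m}+z_1^{b_1}\cdots z_p^{b_p}+s_1^{c_1}\cdots s_q^{c_q})$ with all $a_i,b_j,c_l>1$, $m\ge1$, $p\ge1$, $q\ge0$, $k>1$, and assume $X$ is not flexible, i.e. not of type $H_4$. Assume that $\mathbb{K}[y_1,\ldots,y_m]$ is an $\mathrm{Aut}(\mathbb{K}[X])$-invariant subring of $\mathbb{K}[X]$. Then the $\mathrm{Aut}_{alg}(X)$-orbits on $X$ are the following sets. (1) The set $\mathcal{O}$ of all regular points of $X$ at which all $y_1,\ldots,y_m$ are nonzero is one $\mathrm{Aut}_{alg}(X)$-orbit. (2) Let $\varnothing\ne M\subseteq\{1,\ldots,m\}$, $d=\gcd(b_1,\ldots,b_p,c_1,\ldots,c_q)$, and let $\varepsilon\in\mathbb{K}$ satisfy $\varepsilon^d=-1$. Then $$\mathcal{O}(M,\varepsilon)=\{\text{points of }X\mid y_j=0\Leftrightarrow j\in M,\ z_1^{b_1/d}\cdots z_p^{b_p/d}=\varepsilon s_1^{c_1/d}\cdots s_q^{c_q/d}\ne0\}$$ is an $\mathrm{Aut}_{alg}(X)$-orbit. (3) Let $K\subseteq\{1,\ldots,k\}$ and $M\subseteq\{1,\ldots,m\}$ with $2|M|+|K|\ge2$, $\varnothing\neq P\subseteq\{1,\ldots,p\}$ and $\varnothing\ne Q\subseteq\{1,\ldots,q\}$. Then $$\mathcal{O}(K,M,P,Q)=\{\text{points of }X\mid x_i=0\Leftrightarrow i\in K,\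 y_j=0\Leftrightarrow j\in M,\ z_l=0\Leftrightarrow l\in P,\ s_r=0\Leftrightarrow r\in Q\}$$ is an $\mathrm{Aut}_{alg}(X)$-orbit.
   Context: $\mathbb{K}$ is an algebraically closed field of characteristic zero. $X$ is the hypersurface in the affine space with coordinates $x_1,\ldots,x_k,y_1,\ldots,y_m,z_1,\ldots,z_p,s_1,\ldots,s_q$ defined by the displayed polynomial; if $q=0$ the monomial in the $s_l$ means $1$ (and no sets $Q$ as in (3) exist). For these $X$, ''type $H_4$'' means: $q\ge1$, all $b_j$ and all $c_l$ are even, at least one $b_j$ equals $2$ and at least one $c_l$ equals $2$. $X$ is flexible if at every regular point the tangent space is spanned by tangent vectors to orbits of subgroups of $\mathrm{Aut}(X)$ isomorphic to $(\mathbb{K},+)$ and acting algebraically on $X$. $\mathrm{Aut}_{alg}(X)$ is the subgroup of the group $\mathrm{Aut}(X)$ of regular automorphisms generated by all connected algebraic subgroups of $\mathrm{Aut}(X)$. *)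

(* Defs.v *)
From HB Require Import structures.
From mathcomp Require Import all_boot all_order all_algebra.
From mathcomp.multinomials Require Import mpoly.

Set Implicit Arguments.
Unset Strict Implicit.
Unset Printing Implicit Defensive.

Import GRing.Theory.
Local Open Scope ring_scope.

Definition points (F : closedFieldType) (n : nat) (E : seq {mpoly F[n]}) : Type :=
  {v : 'rV[F]_n | all (fun f => f.@[v ord0] == 0) E}.

Definition regular_function (F : closedFieldType) (n : nat)
    (E : seq {mpoly F[n]}) (f : points E -> F) : Prop :=
  exists h : {mpoly F[n]}, forall x, f x = h.@[val x ord0].

Definition regular_map (F : closedFieldType) (n1 n2 : nat)
    (E1 : seq {mpoly F[n1]}) (E2 : seq {mpoly F[n2]})
    (f : points E1 -> points E2) : Prop :=
  exists h : 'I_n2 -> {mpoly F[n1]},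
    forall x i, val (f x) ord0 i = (h i).@[val x ord0].

(* Regular maps on a product of two varieties: [row_mx u v] is the point (u, v)
   of the product of the ambient affine spaces. *)
Definition regular_map2 (F : closedFieldType) (n1 n2 n3 : nat)
    (E1 : seq {mpoly F[n1]}) (E2 : seq {mpoly F[n2]}) (E3 : seq {mpoly F[n3]})
    (f : points E1 -> points E2 -> points E3) : Prop :=
  exists h : 'I_n3 -> {mpoly F[n1 + n2]},
    forall x y i, val (f x y) ord0 i = (h i).@[row_mx (val x) (val y) ord0].

Definition zariski_closed (F : closedFieldType) (n : nat)
    (E : seq {mpoly F[n]}) (A : points E -> Prop) : Prop :=
  exists S : {mpoly F[n]} -> Prop,
    forall x, A x <-> (forall f, S f -> f.@[val x ord0] = 0).

Definition zariski_connected (F : closedFieldType) (n : nat)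
    (E : seq {mpoly F[n]}) : Prop :=
  forall A B : points E -> Prop,
    zariski_closed A -> zariski_closed B ->
    (forall x, A x \/ B x) -> (forall x, ~ (A x /\ B x)) ->
    (forall x, A x) \/ (forall x, B x).

(* Affine algebraic groups.  Affineness is no restriction below: a connected
   algebraic group acting faithfully on an affine variety is affine. *)
Record algebraic_group (F : closedFieldType) := AlgebraicGroup {
  ag_dim : nat;
  ag_eqs : seq {mpoly F[ag_dim]};
  ag_one : points ag_eqs;
  ag_mul : points ag_eqs -> points ag_eqs -> points ag_eqs;
  ag_inv : points ag_eqs -> points ag_eqs;
  ag_mulA : associative ag_mul;
  ag_mul1 : left_id ag_one ag_mul;
  ag_mulV : left_inverse ag_one ag_inv ag_mul;
  ag_mul_regular : regular_map2 ag_mul;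
  ag_inv_regular : regular_map ag_inv
}.

Definition group_points (F : closedFieldType) (G : algebraic_group F) : Type :=
  points (ag_eqs G).

Record algebraic_action (F : closedFieldType) (G : algebraic_group F)
    (n : nat) (E : seq {mpoly F[n]})
    (act : group_points G -> points E -> points E) : Prop := AlgebraicAction {
  act_one : forall x, act (ag_one G) x = x;
  act_mul : forall g h x, act (ag_mul g h) x = act g (act h x);
  act_regular : regular_map2 act;
  act_faithful : forall g, (forall x, act g x = x) -> g = ag_one G
}.

Definition automorphism (F : closedFieldType) (n : nat)
    (E : seq {mpoly F[n]}) (f : points E -> points E) : Prop :=
  regular_map f /\
  exists g, [/\ regular_map g, cancel f g & cancel g f].

(* A set of automorphisms is a connected algebraic subgroup of Aut(X) when it
   is a connected algebraic group whose tautological action on X is regular. *)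
Definition connected_algebraic_subgroup (F : closedFieldType) (n : nat)
    (E : seq {mpoly F[n]}) (H : (points E -> points E) -> Prop) : Prop :=
  exists G : algebraic_group F, zariski_connected (ag_eqs G) /\
  exists2 act : group_points G -> points E -> points E,
    algebraic_action act &
    forall f, H f <-> automorphism f /\ exists g, f =1 act g.

Inductive Aut_alg (F : closedFieldType) (n : nat) (E : seq {mpoly F[n]}) :
    (points E -> points E) -> Prop :=
| Aut_alg_gen H f : connected_algebraic_subgroup H -> H f -> Aut_alg f
| Aut_alg_one : Aut_alg (fun x => x)
| Aut_alg_mul f g : Aut_alg f -> Aut_alg g -> Aut_alg (fun x => f (g x))
| Aut_alg_inv f g : Aut_alg f -> cancel f g -> cancel g f -> Aut_alg g.

Definition Aut_alg_orbit (F : closedFieldType) (n : nat)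
    (E : seq {mpoly F[n]}) (A : points E -> Prop) : Prop :=
  exists x, forall y, A y <-> exists2 f, Aut_alg f & f x = y.

(* These are the usual notions when f generates the ideal of its zero locus.
   This holds for [trinomial] below when 1 < k and 0 < p: it is linear in x_1,
   with coefficients without a common factor, hence irreducible. *)
Definition regular_point (F : closedFieldType) (n : nat) (f : {mpoly F[n]})
    (x : points [:: f]) : Prop :=
  exists i, (f^`M(i)).@[val x ord0] != 0.

Definition tangent_space (F : closedFieldType) (n : nat) (f : {mpoly F[n]})
    (x : points [:: f]) (w : 'rV[F]_n) : Prop :=
  \sum_i (f^`M(i)).@[val x ord0] * w ord0 i = 0.

(* Algebraic subgroups of Aut(X) isomorphic to the additive group of F. *)
Record Ga_subgroup (F : closedFieldType) (n : nat) (E : seq {mpoly F[n]})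
    (act : F -> points E -> points E) : Prop := GaSubgroup {
  Ga_act0 : forall x, act 0 x = x;
  Ga_actD : forall s t x, act (s + t) x = act s (act t x);
  Ga_regular : exists h : 'I_n -> {mpoly F[1 + n]},
    forall t x i, val (act t x) ord0 i = (h i).@[row_mx (t%:M : 'rV_1) (val x) ord0];
  Ga_faithful : forall t, (forall x, act t x = x) -> t = 0
}.

(* w is tangent at x to an orbit of a Ga-subgroup: w is the velocity at t = 0
   of the orbit map t |-> act t x.  Rescaling t gives all the multiples of w. *)
Definition Ga_tangent (F : closedFieldType) (n : nat) (E : seq {mpoly F[n]})
    (x : points E) (w : 'rV[F]_n) : Prop :=
  exists2 act : F -> points E -> points E, Ga_subgroup act &
  exists c : 'I_n -> {poly F},
    (forall t i, val (act t x) ord0 i = (c i).[t]) /\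
    (forall i, w ord0 i = (c i)^`().[0]).

Definition flexible (F : closedFieldType) (n : nat) (f : {mpoly F[n]}) : Prop :=
  forall x : points [:: f], regular_point x ->
  forall w : 'rV[F]_n, tangent_space x w <->
    exists r (W : 'M[F]_(r, n)),
      (forall i, Ga_tangent x (row i W)) /\ (w <= W)%MS.

(* The coordinate ring is the F-algebra of regular functions on X; the values
   of Phi on functions that are not regular are irrelevant. *)
Record coordinate_ring_aut (F : closedFieldType) (n : nat)
    (E : seq {mpoly F[n]}) (Phi : (points E -> F) -> (points E -> F)) : Prop :=
  CoordinateRingAut {
  cra_regular : forall u, regular_function u -> regular_function (Phi u);
  cra_const : forall c : F, Phi (fun=> c) =1 (fun=> c);
  cra_add : forall u v, regular_function u -> regular_function v ->
    Phi (fun x => u x + v x) =1 (fun x => Phi u x + Phi v x);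
  cra_mul : forall u v, regular_function u -> regular_function v ->
    Phi (fun x => u x * v x) =1 (fun x => Phi u x * Phi v x);
  cra_inj : forall u v, regular_function u -> regular_function v ->
    Phi u =1 Phi v -> u =1 v;
  cra_surj : forall v, regular_function v ->
    exists2 u, regular_function u & Phi u =1 v
}.

Definition invariant_subring (F : closedFieldType) (n : nat)
    (E : seq {mpoly F[n]}) (A : (points E -> F) -> Prop) : Prop :=
  forall Phi, coordinate_ring_aut Phi -> forall u, A u -> A (Phi u).

Section Trinomial.
Variables (F : closedFieldType) (k m p q : nat).

(* The ambient coordinates are ordered as x_1..x_k, y_1..y_m, z_1..z_p, s_1..s_q. *)
Definition ix (i : 'I_k) : 'I_(k + m + p + q) := lshift q (lshift p (lshift m i)).
Definition iy (j : 'I_m) : 'I_(k + m + p + q) := lshift q (lshift p (rshift k j)).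
Definition iz (l : 'I_p) : 'I_(k + m + p + q) := lshift q (rshift (k + m) l).
Definition is_ (r : 'I_q) : 'I_(k + m + p + q) := rshift (k + m + p) r.

Variables (a : 'I_m -> nat) (b : 'I_p -> nat) (c : 'I_q -> nat).

Definition trinomial : {mpoly F[k + m + p + q]} :=
  (\prod_(i < k) 'X_(ix i)) * (\prod_(j < m) 'X_(iy j) ^+ a j)
  + \prod_(l < p) 'X_(iz l) ^+ b l
  + \prod_(r < q) 'X_(is_ r) ^+ c r.

Definition X : Type := points [:: trinomial].

Definition xc (v : X) (i : 'I_k) : F := val v ord0 (ix i).
Definition yc (v : X) (j : 'I_m) : F := val v ord0 (iy j).
Definition zc (v : X) (l : 'I_p) : F := val v ord0 (iz l).
Definition sc (v : X) (r : 'I_q) : F := val v ord0 (is_ r).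

Definition y_subring (u : X -> F) : Prop :=
  exists h : {mpoly F[m]}, forall v, u v = h.@[yc v].

Definition gcd_bc : nat :=
  gcdn (\big[gcdn/0%N]_(l < p) b l) (\big[gcdn/0%N]_(r < q) c r).

Definition O_generic (v : X) : Prop :=
  regular_point v /\ forall j, yc v j != 0.

Definition O_y (M : {set 'I_m}) (e : F) (v : X) : Prop :=
  [/\ forall j, (yc v j == 0) = (j \in M),
      \prod_(l < p) zc v l ^+ (b l %/ gcd_bc) =
        e * \prod_(r < q) sc v r ^+ (c r %/ gcd_bc)
    & e * \prod_(r < q) sc v r ^+ (c r %/ gcd_bc) != 0].

Definition O_sing (K : {set 'I_k}) (M : {set 'I_m})
    (P : {set 'I_p}) (Q : {set 'I_q}) (v : X) : Prop :=
  [/\ forall i, (xc v i == 0) = (i \in K),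
      forall j, (yc v j == 0) = (j \in M),
      forall l, (zc v l == 0) = (l \in P)
    & forall r, (sc v r == 0) = (r \in Q)].

End Trinomial.

(* Main.v *)
Require Import Defs.
From HB Require Import structures.
From mathcomp Require Import all_boot all_order all_algebra.
From mathcomp.multinomials Require Import mpoly.
From mathcomp Require Import ring.
From Stdlib Require Import Classical.

Set Implicit Arguments.
Unset Strict Implicit.
Unset Printing Implicit Defensive.

Import GRing.Theory.
Local Open Scope ring_scope.

(** Write f = x y^a + z^b + s^c for the equation, x being the product of the
    x_i.  The listed sets are transitive under explicit connected groups, and
    every connected group preserves them.

    Transitivity.  Since f is linear in each x_i, moving one of the z_l or s_r
    and letting x_i compensate is a flow of the additive group ([flow]); where
    the coefficient u of x_i vanishes it moves x_i alone.  The kernel of the two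
    characters x y^a / z^b and z^(b/d) / s^(c/d) acts diagonally, and it is
    connected because these characters extend to a basis of the lattice
    ([torus_move]).  On regular points with nonzero y the flows reach, within
    the fibre of y, a point with x = 0 and prescribed z and s ([linked_base]),
    and the torus moves y ([generic_same_orbit]).  On the other sets the torus
    does all but the change of x, which again the flows provide
    ([Oy_same_orbit], [Osing_same_orbit]).

    Invariance.  Let g be an automorphism.
    - The ideal of X is generated by f ([vanish_trinomial]), so that by the
      chain rule g does not change the order of vanishing of the gradient of f
      along an arc ([gradient_arc]).  In particular it preserves singular points.
    - By hypothesis g maps fibres of y to fibres of y.  Over a point without
      zero y_j all regular points of the fibre are joined by polynomial curves
      of regular points.  Over a point with some y_j = 0 the regular points
      have z nonzero, so that z is constant along such curves, but z is not
      constant on the fibre.  Hence g preserves the locus where some y_j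
      vanishes ([automorphism_y_neq0]).
    - A connected group which permutes finitely many closed sets without
      inclusions preserves each of them ([invariant_components]).  This applies
      to the hyperplanes y_j = 0 ([action_y0]), and to the components of the
      singular locus, the coordinate subspaces y_j = z_l = s_r = 0 and
      x_i = x_i' = z_l = s_r = 0.  The latter do not see whether a single x_i
      vanishes at a singular point where some y_j does; this is read off from
      arcs, comparing the order of the gradient with that of y^a ([special]),
      and gives the invariant subspaces x_i = y_j = z_l = s_r = 0.  Together
      they determine which coordinates of a singular point vanish
      ([zeros_act]).
    - Where some y_j = 0, the quotient of z^(b/d) by s^(c/d) at a regular point
      is one of the d-th roots of -1, and a connected group cannot change it
      ([Oy_action]). *)

(** * Polynomials as functions *)

Section Polynomials.
Variables (F : closedFieldType) (n : nat).
Hypothesis char0 : [pchar F] =i pred0.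

Lemma mpoly_ring_ind (R : comNzRingType) (P : {mpoly R[n]} -> Prop) :
  (forall c, P c%:MP) -> (forall i, P 'X_i) ->
  (forall u v, P u -> P v -> P (u + v)) ->
  (forall u v, P u -> P v -> P (u * v)) -> forall u, P u.
Proof.
move=> PC PX PD PM; elim/mpolyind; first by rewrite -mpolyC0; apply: PC.
move=> c m u _ _ Pu; apply: (PD) => //; rewrite -mul_mpolyC; apply: (PM) => //.
rewrite mpolyXE_id.
have P1 : P 1 by rewrite -mpolyC1.
apply: big_ind => // i _; elim: (m i) => [|d IH]; first by rewrite expr0.
by rewrite exprS; apply: PM.
Qed.

(** Curves are tuples of polynomials in the parameter, so that the order at 0 of
    a function along a curve makes sense as divisibility by a power of X. *)
Definition arc (g : 'I_n -> {poly F}) (p : {mpoly F[n]}) : {poly F} :=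
  mmap (@polyC F) g p.

HB.instance Definition _ g :=
  GRing.RMorphism.copy (arc g) (mmap (@polyC F) g).

Lemma arcC g c : arc g c%:MP = c%:P. Proof. exact: mmapC. Qed.
Lemma arcX g i : arc g 'X_i = g i.
Proof. by rewrite /arc mmapX mmap1U. Qed.

Lemma arcD g p q : arc g (p + q) = arc g p + arc g q.
Proof. exact: raddfD. Qed.
Lemma arcM g p q : arc g (p * q) = arc g p * arc g q.
Proof. exact: rmorphM. Qed.

Lemma horner_arc g p t : (arc g p).[t] = p.@[fun i => (g i).[t]].
Proof.
elim/mpoly_ring_ind: p => [c|i|u v IHu IHv|u v IHu IHv].
- by rewrite arcC mevalC hornerC.
- by rewrite arcX mevalXU.
- by rewrite arcD mevalD hornerD IHu IHv.
- by rewrite arcM mevalM hornerM IHu IHv.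
Qed.

Lemma mderivXU i j : ('X_i : {mpoly F[n]})^`M(j) = (i == j)%:R.
Proof.
rewrite mderivX mnm1E; case: eqP => [->|_]; last by rewrite scale0r.
suff -> : (U_(j) - U_(j) = 0)%MM by rewrite mpolyX0 scale1r.
by apply/mnmP => l; rewrite mnmBE subnn mnm0E.
Qed.

Lemma deriv_arc g p :
  (arc g p)^`() = \sum_i arc g p^`M(i) * (g i)^`().
Proof.
elim/mpoly_ring_ind: p => [c|i|u v IHu IHv|u v IHu IHv].
- by rewrite arcC derivC big1 // => i _; rewrite mderivC raddf0 mul0r.
- rewrite arcX (bigD1 i) //= mderivXU eqxx rmorph1 mul1r big1 ?addr0 // => j ji.
  by rewrite mderivXU eq_sym (negPf ji) raddf0 mul0r.
- rewrite arcD derivD IHu IHv -big_split; apply: eq_bigr => i _.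
  by rewrite mderivD arcD mulrDl.
- rewrite arcM derivM IHu IHv mulr_suml mulr_sumr -big_split.
  apply: eq_bigr => i _; rewrite mderivM arcD !arcM mulrDl /=.
  by rewrite mulrAC !mulrA.
Qed.

Lemma natF_neq0 d : (0 < d)%N -> d%:R != 0 :> F.
Proof. by move=> d0; rewrite ((pcharf0P F).1 char0) -lt0n. Qed.

Lemma natF_inj : injective (fun d : nat => d%:R : F).
Proof.
move=> d1 d2; wlog le12 : d1 d2 / (d1 <= d2)%N => [W|] /= E.
  by case/orP: (leq_total d1 d2) => [|/W] => [/W->|->].
move/eqP: E; rewrite eq_sym -subr_eq0 -natrB //.
rewrite ((pcharf0P F).1 char0) subn_eq0 => le21.
by apply/eqP; rewrite eqn_leq le12.
Qed.

Lemma poly_nonroot (p : {poly F}) : p != 0 -> exists t, p.[t] != 0.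
Proof.
move=> p0; pose rs := [seq d%:R : F | d <- iota 0 (size p)].
have [/(max_poly_roots p0) H|] := boolP (all (root p) rs).
  have /H : uniq rs by rewrite map_inj_uniq ?iota_uniq //; apply: natF_inj.
  by rewrite size_map size_iota ltnn.
by rewrite -has_predC => /hasP[t _ pt]; exists t; apply: pt.
Qed.

Lemma poly_eq0_dense (p : {poly F}) : (forall t, p.[t] = 0) -> p = 0.
Proof.
move=> p0; apply/eqP; apply: contraT => /poly_nonroot[t].
by rewrite p0 eqxx.
Qed.

Lemma poly_eq_dense (p q : {poly F}) : (forall t, p.[t] = q.[t]) -> p = q.
Proof.
move=> E; apply/eqP; rewrite -subr_eq0; apply/eqP/poly_eq0_dense => t.
by rewrite hornerD hornerN E subrr.
Qed.

(** Restricted to the line through v in direction e_i, a polynomial function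
    that vanishes has zero derivative; so all iterated partial derivatives
    vanish, and in characteristic zero they determine the coefficients. *)
Lemma mpoly_eq0_dense (p : {mpoly F[n]}) : (forall v, p.@[v] = 0) -> p = 0.
Proof.
move=> p0; apply/mpolyP => mm; rewrite mcoeff0.
elim: {mm}(mdeg mm) {-2}mm (erefl (mdeg mm)) p p0 => [|d IH] mm dm p p0.
  move/eqP: dm; rewrite mdeg_eq0 => /eqP ->.
  suff -> : p@_0 = p.@[fun=> 0] by apply: p0.
  elim/mpoly_ring_ind: p {p0} => [c|i|u v IHu IHv|u v IHu IHv].
  - by rewrite mevalC mcoeffC eqxx mulr1.
  - by rewrite mevalXU mcoeffX mnm1_eq0.
  - by rewrite mevalD mcoeffD IHu IHv.
  - by rewrite mevalM rmorphM /= IHu IHv.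
have [i mi] : exists i, (0 < mm i)%N.
  apply/existsP; apply: contraT; rewrite negb_exists => /forallP m0.
  suff: mdeg mm = 0%N by rewrite dm.
  by rewrite mdegE big1 // => i _; have := m0 i; rewrite lt0n negbK => /eqP.
have Ui : (U_(i) <= mm)%MM by rewrite lep1mP -lt0n.
have E : (p^`M(i))@_(mm - U_(i)) = 0.
  apply: IH; first by move: dm; rewrite -{1}(submK Ui) mdegD mdeg1 addn1 => -[].
  move=> v; pose g j : {poly F} := (v j)%:P + (j == i)%:R *: 'X.
  have gE : arc g p = 0.
    by apply: poly_eq0_dense => s; rewrite horner_arc.
  have /(congr1 (fun r => r.[0])) := deriv_arc g p.
  rewrite gE derivC horner0 horner_sum (bigD1 i) //= big1 => [|j /negPf ji].
    rewrite addr0 hornerM horner_arc derivD derivC derivZ derivX eqxx add0r.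
    rewrite scale1r hornerC mulr1 => E.
    apply: etrans (esym E); apply: meval_eq => j.
    by rewrite hornerD hornerZ hornerX hornerC mulr0 addr0.
  by rewrite hornerM derivD derivC derivZ ji scale0r addr0 horner0 mulr0.
move: E; rewrite mcoeff_mderiv submK // => /eqP.
rewrite -mulr_natr mulf_eq0 => /orP[/eqP//|].
by rewrite (negPf (natF_neq0 _)).
Qed.

(** Substitution, with the polynomials given by a function as in a regular map,
    while [comp_mpoly] takes a tuple. *)
Definition msubst n' (g : 'I_n -> {mpoly F[n']}) (p : {mpoly F[n]}) : {mpoly F[n']} :=
  mmap (@mpolyC n' F) g p.

HB.instance Definition _ n' g :=
  GRing.RMorphism.copy (@msubst n' g) (mmap (@mpolyC n' F) g).

Lemma msubstC n' (g : 'I_n -> {mpoly F[n']}) c : msubst g c%:MP = c%:MP.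
Proof. exact: mmapC. Qed.
Lemma msubstX n' (g : 'I_n -> {mpoly F[n']}) i : msubst g 'X_i = g i.
Proof. by rewrite /msubst mmapX mmap1U. Qed.
Lemma msubstD n' (g : 'I_n -> {mpoly F[n']}) p q :
  msubst g (p + q) = msubst g p + msubst g q.
Proof. exact: raddfD. Qed.
Lemma msubstM n' (g : 'I_n -> {mpoly F[n']}) p q :
  msubst g (p * q) = msubst g p * msubst g q.
Proof. exact: rmorphM. Qed.

Lemma meval_msubst n' (g : 'I_n -> {mpoly F[n']}) p v :
  (msubst g p).@[v] = p.@[fun i => (g i).@[v]].
Proof.
elim/mpoly_ring_ind: p => [c|i|u w IHu IHw|u w IHu IHw].
- by rewrite msubstC !mevalC.
- by rewrite msubstX mevalXU.
- by rewrite msubstD !mevalD IHu IHw.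
- by rewrite msubstM !mevalM IHu IHw.
Qed.

Lemma mderiv_msubst n' (g : 'I_n -> {mpoly F[n']}) p j :
  (msubst g p)^`M(j) = \sum_i msubst g p^`M(i) * (g i)^`M(j).
Proof.
elim/mpoly_ring_ind: p => [c|i|u v IHu IHv|u v IHu IHv].
- by rewrite msubstC mderivC big1 // => i _; rewrite mderivC raddf0 mul0r.
- rewrite msubstX (bigD1 i) //= mderivXU eqxx rmorph1 mul1r big1 ?addr0 // => l li.
  by rewrite mderivXU eq_sym (negPf li) raddf0 mul0r.
- rewrite msubstD mderivD IHu IHv -big_split; apply: eq_bigr => i _.
  by rewrite mderivD msubstD mulrDl.
- rewrite msubstM mderivM IHu IHv mulr_suml mulr_sumr -big_split.
  apply: eq_bigr => i _; rewrite mderivM msubstD !msubstM mulrDl /=.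
  by rewrite mulrAC !mulrA.
Qed.

Definition set0c (i : 'I_n) (v : 'I_n -> F) : 'I_n -> F :=
  fun j => if j == i then 0 else v j.

(** The monomials with and without X_i.  The second part is described by its
    values, which suffice to see when it is zero. *)
Lemma div_X (i : 'I_n) p : exists r p0 : {mpoly F[n]},
  p = 'X_i * r + p0 /\ forall v, p0.@[v] = p.@[set0c i v].
Proof.
elim/mpoly_ring_ind: p => [c|j|u v [r1 [p1 [E1 H1]]] [r2 [p2 [E2 H2]]]|
                               u v [r1 [p1 [E1 H1]]] [r2 [p2 [E2 H2]]]].
- by exists 0, c%:MP; rewrite mulr0 add0r; split=> // w; rewrite !mevalC.
- have [->|ji] := eqVneq j i.
    by exists 1, 0; rewrite mulr1 addr0; split=> // w;
      rewrite meval0 mevalXU /set0c eqxx.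
  exists 0, 'X_j; rewrite mulr0 add0r; split=> // w.
  by rewrite !mevalXU /set0c (negPf ji).
- exists (r1 + r2), (p1 + p2); split=> [|w]; last by rewrite !mevalD H1 H2.
  by rewrite E1 E2; ring.
- exists (r1 * v + p1 * r2), (p1 * p2); split=> [|w]; last by rewrite !mevalM H1 H2.
  by rewrite E1 E2; ring.
Qed.

Lemma dvd_X (i : 'I_n) (p : {mpoly F[n]}) : (forall v, v i = 0 -> p.@[v] = 0) ->
  exists r, p = 'X_i * r.
Proof.
move=> H; have [r [p0 [E H0]]] := div_X i p; exists r.
rewrite {1}E (_ : p0 = 0) ?addr0 //; apply: mpoly_eq0_dense => v.
by rewrite H0 H // /set0c eqxx.
Qed.

End Polynomials.

(** * The ideal of a hypersurface *)

Section Hypersurface.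
Variables (F : closedFieldType) (n : nat).
Hypothesis char0 : [pchar F] =i pred0.
Implicit Types (f g h p q u w : {mpoly F[n]}) (v : 'I_n -> F).

(** In other words u is not a zero divisor modulo f. *)
Definition prime_to f u := forall h q, u * h = f * q -> exists q', h = f * q'.

Lemma prime_to1 f : prime_to f 1.
Proof. by move=> h q; rewrite mul1r => ->; exists q. Qed.

Lemma prime_toM f u1 u2 : prime_to f u1 -> prime_to f u2 -> prime_to f (u1 * u2).
Proof.
by move=> P1 P2 h q; rewrite -mulrA => /P1[q1 /P2].
Qed.

Lemma prime_toX f u d : prime_to f u -> prime_to f (u ^+ d).
Proof.
move=> P; elim: d => [|d IH]; first by rewrite expr0; apply: prime_to1.
by rewrite exprS; apply: prime_toM.
Qed.

Lemma prime_to_prod f (I : finType) (P : pred I) (U : I -> {mpoly F[n]}) :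
  (forall i, P i -> prime_to f (U i)) -> prime_to f (\prod_(i | P i) U i).
Proof.
by move=> PU; apply: big_ind => //; [apply: prime_to1 | apply: prime_toM].
Qed.

(** The variable X_j is prime: if it divides f * q and f does not vanish
    identically on the hyperplane v_j = 0, then it divides q. *)
Lemma prime_to_var f j v : v j = 0 -> f.@[v] != 0 -> prime_to f 'X_j.
Proof.
move=> vj fv h q E; have [q' Eq] : exists q', q = 'X_j * q'.
  have [f1 [f0 [Ef Hf]]] := div_X j f; have [q1 [q0 [Eq Hq]]] := div_X j q.
  exists q1; rewrite Eq (_ : q0 = 0) ?addr0 //.
  have : f0 * q0 = 0.
    apply: (mpoly_eq0_dense char0) => z; rewrite mevalM Hf Hq -mevalM -E mevalM.
    by rewrite mevalXU /set0c eqxx mul0r.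
  move=> /eqP; rewrite mulf_eq0 => /orP[] /eqP // f00.
  case/eqP: fv; rewrite Ef f00 addr0 mevalM mevalXU vj mul0r //.
exists q'; apply: (@mulfI _ 'X_j); last by rewrite E Eq; ring.
apply: contraNneq (oner_neq0 F) => X0.
by rewrite -[1](mevalXU (fun=> 1) j) X0 meval0.
Qed.

Definition indep (i : 'I_n) p :=
  forall v v', (forall j, j != i -> v j = v' j) -> p.@[v] = p.@[v'].

(** A hypersurface which is the graph x_i = - w / u where u does not vanish:
    pseudo-division by f turns a polynomial vanishing on it into a remainder
    without x_i, which vanishes wherever u does not. *)
Lemma vanish_dvd f u w i :
  f = 'X_i * u + w -> indep i u -> indep i w -> u != 0 -> prime_to f u ->
  forall h, (forall v, f.@[v] = 0 -> h.@[v] = 0) -> exists q, h = f * q.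
Proof.
move=> Ef iu iw u0 fu h h0.
have [N [q [r [E ir]]]] :
    exists N q r, u ^+ N * h = f * q + r /\ indep i r.
  elim/mpoly_ring_ind: h {h0} => [c|j|h1 h2|h1 h2].
  - exists 0%N, 0, c%:MP; split; first by rewrite expr0 mul1r mulr0 add0r.
    by move=> v v' _; rewrite !mevalC.
  - have [->|ji] := eqVneq j i.
      exists 1%N, 1, (- w); split; first by rewrite Ef; ring.
      by move=> v v' /iw; rewrite !mevalN => ->.
    exists 0%N, 0, 'X_j; split; first by rewrite expr0 mul1r mulr0 add0r.
    by move=> v v' /(_ j ji); rewrite !mevalXU.
  - move=> [N1 [q1 [r1 [E1 i1]]]] [N2 [q2 [r2 [E2 i2]]]].
    exists (N1 + N2)%N, (u ^+ N2 * q1 + u ^+ N1 * q2),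
      (u ^+ N2 * r1 + u ^+ N1 * r2); split.
      rewrite exprD; apply: etrans (_ : u ^+ N2 * (u ^+ N1 * h1) +
        u ^+ N1 * (u ^+ N2 * h2) = _); first by ring.
      by rewrite E1 E2; ring.
    move=> v v' vv'; rewrite !mevalD !mevalM !rmorphXn /=.
    by rewrite (iu _ _ vv') (i1 _ _ vv') (i2 _ _ vv').
  - move=> [N1 [q1 [r1 [E1 i1]]]] [N2 [q2 [r2 [E2 i2]]]].
    exists (N1 + N2)%N, (q1 * (f * q2 + r2) + r1 * q2), (r1 * r2); split.
      rewrite exprD; apply: etrans (_ : (u ^+ N1 * h1) *
        (u ^+ N2 * h2) = _); first by ring.
      by rewrite E1 E2; ring.
    by move=> v v' vv'; rewrite !mevalM (i1 _ _ vv') (i2 _ _ vv').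
suff r0 : r = 0.
  by move: E; rewrite r0 addr0; apply: prime_toX.
have : u * r = 0.
  apply: (mpoly_eq0_dense char0) => v; rewrite mevalM.
  have [->|uv] := eqVneq u.@[v] 0; first by rewrite mul0r.
  pose v' j := if j == i then - w.@[v] / u.@[v] else v j.
  have vv' j : j != i -> v j = v' j by rewrite /v' => /negPf->.
  have fv' : f.@[v'] = 0.
    rewrite Ef mevalD mevalM mevalXU -(iu _ _ vv') -(iw _ _ vv') /v' eqxx.
    by rewrite divfK // addNr.
  have := congr1 (fun p => p.@[v']) E; rewrite mevalD !mevalM fv' h0 //.
  by rewrite mulr0 mul0r add0r -(ir _ _ vv') => <-; rewrite mulr0.
by move/eqP; rewrite mulf_eq0 (negPf u0) => /eqP.
Qed.

End Hypersurface.

(** * Automorphisms and the order of the gradient along an arc *)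

Section Gradient.
Variables (F : closedFieldType) (n : nat).
Hypothesis char0 : [pchar F] =i pred0.

Lemma dvdXn_unit N (p q : {poly F}) : p.[0] != 0 ->
  'X^N %| p * q -> 'X^N %| q.
Proof.
move=> p0; rewrite Gauss_dvdpr // coprimep_expl // coprimep_sym.
by rewrite -(subr0 'X) -polyC0 coprimep_XsubC rootE.
Qed.

Lemma arc_msubst n' (g : 'I_n -> {poly F}) (h : 'I_n' -> {mpoly F[n]}) p :
  arc g (msubst h p) = arc (fun i => arc g (h i)) p.
Proof.
elim/mpoly_ring_ind: p => [c|i|u v IHu IHv|u v IHu IHv].
- by rewrite msubstC !arcC.
- by rewrite msubstX !arcX.
- by rewrite msubstD !arcD IHu IHv.
- by rewrite msubstM !arcM IHu IHv.
Qed.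

(** The chain rule for f o h, a multiple of f, and for h' o h, the identity
    modulo f: modulo X^N, where the gradient of f is zero along g, the second
    makes the Jacobian matrix of h invertible along g, and the first says that
    it annihilates the gradient of f along h o g. *)
Lemma gradient_arc (f : {mpoly F[n]}) (h h' : 'I_n -> {mpoly F[n]})
    (g : 'I_n -> {poly F}) N :
  (forall p, (forall v, f.@[v] = 0 -> p.@[v] = 0) -> exists q, p = f * q) ->
  (forall v, f.@[v] = 0 -> f.@[fun i => (h i).@[v]] = 0) ->
  (forall v, f.@[v] = 0 -> forall i, (h' i).@[fun j => (h j).@[v]] = v i) ->
  arc g f = 0 -> (forall i, 'X^N %| arc g f^`M(i)) ->
  forall j, 'X^N %| arc (fun i => arc g (h i)) f^`M(j).
Proof.
case: N => [|N] NP hf hh' gf gN j; first by rewrite expr0 dvd1p.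
have dX i d (p e : {mpoly F[n]}) : p = d + f * e ->
    'X^(N.+1) %| arc g p^`M(i) - arc g d^`M(i).
  move=> ->; rewrite mderivD mderivM !arcD !arcM gf mul0r addr0 addrC addKr.
  exact: dvdp_mulr.
have [e Ee] : exists e, msubst h f = 0 + f * e.
  by setoid_rewrite add0r; apply: NP => v fv; rewrite meval_msubst hf.
have Ei i : exists e, msubst h (h' i) = 'X_i + f * e.
  have [v /hh' H|q Eq] := NP (msubst h (h' i) - 'X_i).
    by rewrite mevalB meval_msubst mevalXU H subrr.
  by exists q; rewrite -Eq addrC subrK.
pose A := \matrix_(l, k) arc g (h k)^`M(l).
pose B := \matrix_(k, i) arc (fun i => arc g (h i)) (h' i)^`M(k).
pose c := \col_k arc (fun i => arc g (h i)) f^`M(k).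
have Ac l : 'X^(N.+1) %| (A *m c) l 0.
  have := dX l _ _ _ Ee; rewrite mderiv_msubst mderiv0 raddf0 subr0 raddf_sum /=.
  rewrite mxE; congr (is_true (_ %| _)); apply: eq_bigr => k _.
  by rewrite !mxE arcM arc_msubst mulrC.
have AB l i : 'X^(N.+1) %| (A *m B) l i - (l == i)%:R.
  have [q /(dX l)] := Ei i; rewrite mderiv_msubst mderivXU raddf_sum /=.
  rewrite (_ : arc g _ = (l == i)%:R); last by rewrite rmorph_nat eq_sym.
  rewrite mxE; congr (is_true (_ %| _ - _)); apply: eq_bigr => k _.
  by rewrite !mxE arcM arc_msubst mulrC.
have detA : (\det A).[0] != 0.
  have : (\det (A *m B)).[0] = 1.
    rewrite -horner_evalE -det_map_mx (_ : map_mx _ _ = 1%:M) ?det1 //.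
    apply/matrixP => l i; rewrite [LHS]mxE [RHS]mxE.
    have /dvdpP[q /eqP] := AB l i; rewrite subr_eq => /eqP ->.
    by rewrite /= horner_evalE hornerD hornerM hornerXn expr0n mulr0 add0r; case: eqP => _;
      rewrite ?hornerC // horner0.
  by rewrite det_mulmx hornerM => H; apply: contra_eq_neq H => ->;
    rewrite mul0r eq_sym oner_neq0.
apply: (dvdXn_unit detA).
have : (\adj A *m (A *m c)) j 0 = \det A * arc (fun i => arc g (h i)) f^`M(j).
  by rewrite mulmxA mul_adj_mx mul_scalar_mx !mxE.
move=> <-; rewrite mxE; apply: (big_ind (fun p => 'X^(N.+1) %| p)).
- exact: dvdp0.
- by move=> p q; apply: dvdp_add.
- by move=> k _; apply: dvdp_mull.
Qed.

End Gradient.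

(** * Connected algebraic groups: the additive group and tori *)

Section Connected.
Variable F : closedFieldType.
Hypothesis char0 : [pchar F] =i pred0.

Lemma action_cancel (G : algebraic_group F) n (E : seq {mpoly F[n]})
    (act : group_points G -> points E -> points E) :
  algebraic_action act -> forall g, cancel (act g) (act (ag_inv g)).
Proof. by move=> aA g x; rewrite -(act_mul aA) ag_mulV (act_one aA). Qed.

Lemma action_cancelV (G : algebraic_group F) n (E : seq {mpoly F[n]})
    (act : group_points G -> points E -> points E) :
  algebraic_action act -> forall g, cancel (act (ag_inv g)) (act g).
Proof.
move=> aA g x; rewrite -[LHS](action_cancel aA (ag_inv g)).
by rewrite (action_cancel aA g) (action_cancel aA).
Qed.

(** Substitutions giving the polynomials of a regular map of two arguments when
    one of them is fixed. *)
Definition fix_left n1 n2 (u : 'rV[F]_n1) : 'I_(n1 + n2) -> {mpoly F[n2]} :=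
  fun k => match split k with inl a => (u ord0 a)%:MP | inr b => 'X_b end.
Definition fix_right n1 n2 (v : 'rV[F]_n2) : 'I_(n1 + n2) -> {mpoly F[n1]} :=
  fun k => match split k with inl a => 'X_a | inr b => (v ord0 b)%:MP end.

Lemma meval_fix_left n1 n2 (u : 'rV[F]_n1) (v : 'rV[F]_n2) (p : {mpoly F[n1 + n2]}) :
  (msubst (fix_left u) p).@[v ord0] = p.@[row_mx u v ord0].
Proof.
rewrite meval_msubst; apply: meval_eq => k; rewrite mxE /fix_left.
by case: (split k) => j; rewrite ?mevalC ?mevalXU.
Qed.

Lemma meval_fix_right n1 n2 (u : 'rV[F]_n1) (v : 'rV[F]_n2) (p : {mpoly F[n1 + n2]}) :
  (msubst (fix_right v) p).@[u ord0] = p.@[row_mx u v ord0].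
Proof.
rewrite meval_msubst; apply: meval_eq => k; rewrite mxE /fix_right.
by case: (split k) => j; rewrite ?mevalC ?mevalXU.
Qed.

Lemma action_automorphism (G : algebraic_group F) n (E : seq {mpoly F[n]})
    (act : group_points G -> points E -> points E) :
  algebraic_action act -> forall g, automorphism (act g).
Proof.
move=> aA; have reg g : regular_map (act g).
  have [h hE] := act_regular aA; exists (fun i => msubst (fix_left (val g)) (h i)).
  by move=> x i; rewrite hE meval_fix_left.
move=> g; split=> //; exists (act (ag_inv g)).
by split=> //; [apply: action_cancel | apply: action_cancelV].
Qed.

Lemma action_Aut_alg (G : algebraic_group F) n (E : seq {mpoly F[n]})
    (act : group_points G -> points E -> points E) :
  zariski_connected (ag_eqs G) -> algebraic_action act ->
  forall g, Aut_alg (act g).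
Proof.
move=> cG aA g.
apply: (@Aut_alg_gen _ _ _ (fun f => automorphism f /\ exists g, f =1 act g)).
  by exists G; split=> //; exists act.
by split; [apply: action_automorphism | exists g].
Qed.

Lemma Aut_alg_automorphism n (E : seq {mpoly F[n]}) (f : points E -> points E) :
  Aut_alg f -> automorphism f.
Proof.
elim=> {f} [H f [G [cG [act aA HE]]] /HE[]//||f g _ [[h hE] [f' [rf' K1 K2]]]
  _ [[h2 h2E] [g' [rg' K3 K4]]]|f g _ [rf [g' [rg' K1 K2]]] K3 K4].
- have r1 : regular_map (fun x : points E => x).
    by exists (fun i => 'X_i) => x i; rewrite mevalXU.
  by split=> //; exists (fun x => x); split=> // x.
- have comp (f1 f2 : points E -> points E) :
      regular_map f1 -> regular_map f2 -> regular_map (fun x => f1 (f2 x)).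
    move=> [h1 E1] [h3 E3]; exists (fun i => msubst h3 (h1 i)) => x i.
    by rewrite E1 meval_msubst; apply: meval_eq => j; rewrite E3.
  split; first by apply: comp; [exists h | exists h2].
  exists (fun x => g' (f' x)); split; first exact: comp.
    by move=> x; rewrite K1 K3.
  by move=> x; rewrite K4 K2.
- have E' : g =1 g' by move=> x; rewrite -{1}(K2 x) K3.
  have [h hE] := rg'; split; last by exists f.
  by exists h => x i; rewrite E' hE.
Qed.

(** Along a curve on which all polynomials become, up to powers of d, polynomials
    in the parameter, two closed sets that cover cannot separate two points:
    a product of two nonzero polynomials in one variable is nonzero. *)
Lemma curve_step n (E : seq {mpoly F[n]}) (A B : points E -> Prop)
    (d : {poly F}) (g : F -> points E) (s t : F) :
  zariski_closed A -> zariski_closed B ->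
  (forall x, A x \/ B x) -> (forall x, ~ (A x /\ B x)) ->
  (forall p, exists N (q : {poly F}),
     forall t, d.[t] != 0 -> d.[t] ^+ N * p.@[val (g t) ord0] = q.[t]) ->
  d.[s] != 0 -> d.[t] != 0 -> A (g s) -> A (g t).
Proof.
move=> [S1 HA] [S2 HB] cov dis gP ds dt As.
have [//|Bt] := cov (g t); apply/HA => p Sp; apply/eqP; apply: contraT => pt.
case: (dis (g s)); split=> //; apply/HB => p' Sp'.
have [N [q Hq]] := gP p; have [N' [q' Hq']] := gP p'.
have : d * (q * q') = 0.
  apply: (poly_eq0_dense char0) => x; rewrite !hornerM.
  have [->|dx] := eqVneq d.[x] 0; first by rewrite mul0r.
  rewrite -Hq // -Hq' //; have [Ax|Bx] := cov (g x).
    by rewrite ((HA _).1 Ax _ Sp) !(mulr0, mul0r).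
  by rewrite ((HB _).1 Bx _ Sp') !mulr0.
move=> /eqP; rewrite !mulf_eq0 => /or3P[] /eqP E0.
- by case/eqP: ds; rewrite E0 horner0.
- have := Hq _ dt; rewrite E0 horner0 => /eqP.
  by rewrite mulf_eq0 (negPf pt) orbF expf_eq0 (negPf dt) andbF.
- have := Hq' _ ds; rewrite E0 horner0 => /eqP.
  by rewrite mulf_eq0 expf_eq0 (negPf ds) andbF => /eqP.
Qed.

(** ** The additive group *)

Definition Ga_pt (u : 'rV[F]_1) : points ([::] : seq {mpoly F[1]}) := exist _ u isT.

Definition Ga : algebraic_group F.
Proof.
refine (@AlgebraicGroup F 1 [::] (Ga_pt 0)
  (fun u v => Ga_pt (val u + val v)) (fun u => Ga_pt (- val u)) _ _ _ _ _).
- by move=> u v w; apply: val_inj; rewrite /= addrA.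
- by move=> u; apply: val_inj; rewrite /= add0r.
- by move=> u; apply: val_inj; rewrite /= addNr.
- exists (fun i => 'X_(lshift 1 i) + 'X_(rshift 1 i)) => x y i.
  by rewrite mevalD !mevalXU row_mxEl row_mxEr mxE.
- by exists (fun i => - 'X_i) => x i; rewrite mevalN mevalXU mxE.
Defined.

Lemma Ga_connected : zariski_connected (ag_eqs Ga).
Proof.
move=> A B cA cB cov dis; wlog A0 : A B cA cB cov dis / A (Ga_pt 0) => [W|].
  have [A0|B0] := cov (Ga_pt 0); first exact: W A0.
  suff: (forall x, B x) \/ (forall x, A x) by case; [right | left].
  apply: W B0 => // [x|x [Bx Ax]]; last exact: (dis x).
  by case: (cov x); [right | left].
left=> x; pose g t := Ga_pt (const_mx t).
have -> : x = g (val x ord0 ord0).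
  by apply: val_inj; apply/rowP => i; rewrite mxE (ord1 i).
apply: (curve_step (d := 1) (s := 0) cA cB cov dis); rewrite ?hornerC ?oner_neq0 //.
move=> p; exists 0%N, (arc (fun=> 'X) p) => t _.
rewrite expr0 mul1r horner_arc; apply: meval_eq => i.
by rewrite mxE hornerX.
Qed.

End Connected.

Section Flow.
Variables (F : closedFieldType) (n : nat).
Hypothesis char0 : [pchar F] =i pred0.

Lemma pt_eq (f : {mpoly F[n]}) (v : points [:: f]) : f.@[val v ord0] = 0.
Proof. by have := valP v; rewrite /= andbT => /eqP. Qed.

Lemma mk_pt_proof (f : {mpoly F[n]}) (v : 'I_n -> F) : f.@[v] = 0 ->
  all (fun f => f.@[(\row_j v j) ord0] == 0) [:: f].
Proof.
move=> fv; rewrite /= andbT -[X in _ == X]fv; apply/eqP/meval_eq => j.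
by rewrite mxE.
Qed.

Definition mk_pt (f : {mpoly F[n]}) (v : 'I_n -> F) (fv : f.@[v] = 0) :
  points [:: f] := exist _ (\row_j v j) (mk_pt_proof fv).

Lemma mk_ptE f v (fv : f.@[v] = 0) j : val (mk_pt fv) ord0 j = v j.
Proof. by rewrite mxE. Qed.

Lemma pt_inj (f : {mpoly F[n]}) (v w : points [:: f]) :
  (forall j, val v ord0 j = val w ord0 j) -> v = w.
Proof. by move=> E; apply/val_inj/rowP => j; rewrite E. Qed.

(** The flow of the derivation mapping X_e to u, X_i to minus the derivative of f
    in X_e and the other variables to 0, when f has the shape
    X_i * u + X_e ^+ b * r + s.  The difference quotient of X_e ^+ b is a
    polynomial, so that the flow is defined also where u vanishes. *)
Section TwoVariables.
Variables (f u r s : {mpoly F[n]}) (i e : 'I_n) (b : nat).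
Hypothesis ie : i != e.
Hypothesis fE : forall v, f.@[v] = v i * u.@[v] + v e ^+ b * r.@[v] + s.@[v].
Hypothesis indep_ie : forall p, p \in [:: u; r; s] ->
  forall v v', (forall j, j != i -> j != e -> v j = v' j) -> p.@[v] = p.@[v'].

(** The quotient of (z + w) ^+ b - z ^+ b by w. *)
Definition difference_quotient (R : comNzRingType) (z w : R) : R :=
  \sum_(j < b) (z + w) ^+ (b.-1 - j) * z ^+ j.

Lemma difference_quotientE (R : comNzRingType) (z w : R) :
  w * difference_quotient z w = (z + w) ^+ b - z ^+ b.
Proof. by rewrite subrXX addrAC subrr add0r. Qed.

Definition flow_coord (t : F) (v : 'I_n -> F) (j : 'I_n) : F :=
  if j == e then v e + t * u.@[v]
  else if j == i then v i - t * (r.@[v] * difference_quotient (v e) (t * u.@[v]))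
  else v j.

Lemma flow_coord_indep t v p : p \in [:: u; r; s] ->
  p.@[flow_coord t v] = p.@[v].
Proof.
by move=> pl; apply: (indep_ie pl) => j /negPf ji /negPf je; rewrite /flow_coord je ji.
Qed.

Lemma flow_coord_eq0 t v : f.@[v] = 0 -> f.@[flow_coord t v] = 0.
Proof.
move=> fv; rewrite fE !flow_coord_indep ?inE ?eqxx ?orbT //.
rewrite /flow_coord (negPf ie) !eqxx -{}[RHS]fv fE.
have /eqP := difference_quotientE (v e) (t * u.@[v]).
rewrite eq_sym subr_eq => /eqP ->; ring.
Qed.

Definition flow t (v : points [:: f]) : points [:: f] :=
  mk_pt (flow_coord_eq0 t (pt_eq v)).

Lemma flowE t v j : val (flow t v) ord0 j = flow_coord t (val v ord0) j.
Proof. by rewrite mk_ptE. Qed.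

Lemma flow_val t v p : p \in [:: u; r; s] ->
  p.@[val (flow t v) ord0] = p.@[val v ord0].
Proof.
move=> pl; rewrite -[RHS](flow_coord_indep t _ pl).
by apply: meval_eq => j; rewrite flowE.
Qed.

(** Multiplied by u, the moves of X_i are differences of values of X_e ^+ b, which
    telescope; where u vanishes X_i moves linearly. *)
Lemma flowD t1 t2 v : flow (t1 + t2) v = flow t1 (flow t2 v).
Proof.
apply: pt_inj => j; rewrite !flowE /flow_coord !flowE /flow_coord.
rewrite !flow_val ?inE ?eqxx ?orbT // (negPf ie) ?eqxx.
set w := val v ord0; case: ifP => // _; first by ring.
case: ifP => // _; rewrite -addrA -opprD; congr (_ - _).
have [->|u0] := eqVneq u.@[w] 0; first by rewrite !mulr0 addr0; ring.
apply: (mulfI u0).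
have E x z : u.@[w] * (x * (r.@[w] * difference_quotient z (x * u.@[w]))) =
    r.@[w] * ((z + x * u.@[w]) ^+ b - z ^+ b).
  by rewrite -difference_quotientE; ring.
rewrite [RHS]mulrDr !E -mulrDr; congr (_ * _).
by rewrite [RHS]addrC -(addrA (w e)) -mulrDl [t2 + t1]addrC; ring.
Qed.

Lemma flow0 v : flow 0 v = v.
Proof.
apply: pt_inj => j; rewrite flowE /flow_coord !mul0r addr0 subr0.
by case: eqP => [->|_] //; case: eqP => [->|_].
Qed.

Lemma flow_difference_quotient0 (R : comNzRingType) (z : R) :
  difference_quotient z 0 = z ^+ b.-1 *+ b.
Proof.
rewrite /difference_quotient addr0 (eq_bigr (fun=> z ^+ b.-1)) => [|j _].
  by rewrite sumr_const card_ord.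
by rewrite -exprD subnK // -ltnS (ltn_predK (ltn_ord j)).
Qed.

Definition flow_poly (j : 'I_n) : {mpoly F[1 + n]} :=
  let T := 'X_(lshift n ord0) in
  let L := msubst (fun j => 'X_(rshift 1 j)) in
  if j == e then L 'X_e + T * L u
  else if j == i then L 'X_i - T * (L r * difference_quotient (L 'X_e) (T * L u))
  else L 'X_j.

Lemma meval_difference_quotient n' (p q : {mpoly F[n']}) v :
  (difference_quotient p q).@[v] = difference_quotient p.@[v] q.@[v].
Proof.
rewrite raddf_sum; apply: eq_bigr => j _.
by rewrite /= mevalM !rmorphXn /= mevalD.
Qed.

Lemma flow_polyE (t : 'rV[F]_1) (v : 'rV[F]_n) j :
  (flow_poly j).@[row_mx t v ord0] = flow_coord (t ord0 ord0) (v ord0) j.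
Proof.
have L p : (msubst (fun j => 'X_(rshift 1 j)) p).@[row_mx t v ord0] = p.@[v ord0].
  by rewrite meval_msubst; apply: meval_eq => l; rewrite mevalXU row_mxEr.
rewrite /flow_poly /flow_coord; case: ifP => _.
  by rewrite mevalD mevalM !L !mevalXU row_mxEl.
case: ifP => _; last by rewrite L mevalXU.
by rewrite mevalB !mevalM meval_difference_quotient mevalM !L !mevalXU row_mxEl.
Qed.

(** The point v0 makes the action of the additive group faithful. *)
Lemma flow_Aut_alg (v0 : points [:: f]) (u0 : u.@[val v0 ord0] != 0) t :
  Aut_alg (flow t).
Proof.
pose act (g : group_points (Ga F)) := flow (val g ord0 ord0).
have -> : flow t = act (Ga_pt (const_mx t)) by rewrite /act mxE.
apply: (action_Aut_alg (Ga_connected char0)); split.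
- by move=> x; rewrite /act /= mxE flow0.
- by move=> g h x; rewrite /act /= mxE flowD.
- exists flow_poly => x y j; rewrite flow_polyE flowE; congr flow_coord.
move=> g /(_ v0) gv; have := congr1 (fun x : points [:: f] => val x ord0 e) gv.
rewrite flowE /flow_coord eqxx => /eqP.
rewrite eq_sym addrC -subr_eq subrr eq_sym mulf_eq0 (negPf u0) orbF => /eqP g0.
by apply/val_inj/rowP => j; rewrite (ord1 j) g0 mxE.
Qed.

End TwoVariables.
End Flow.

(** ** Tori *)

Section IntPowers.
Variable F : closedFieldType.
Implicit Types (x y : F).

Lemma expfz_prod (I : finType) (P : pred I) (x : I -> F) (d : int) :
  (\prod_(i | P i) x i) ^ d = \prod_(i | P i) x i ^ d.
Proof.
apply: (big_morph (fun y => y ^ d)) => [y z|]; first exact: expfzMl.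
exact: exp1rz.
Qed.

Lemma expfz_sum (I : finType) (P : pred I) (x : F) (d : I -> int) : x != 0 ->
  x ^ (\sum_(i | P i) d i) = \prod_(i | P i) x ^ d i.
Proof.
move=> x0; apply: (big_morph (fun d => x ^ d)) => [c1 c2|]; last exact: expr0z.
exact: expfzDr.
Qed.

End IntPowers.

Section Torus.
Variables (F : closedFieldType) (n r : nat).
Hypothesis char0 : [pchar F] =i pred0.
Variable chi : 'I_r -> 'I_n -> int.

(** The inverses of the coordinates are coordinates too, the last n variables, so
    that integer exponents give polynomials. *)
Definition laurent_monomial (w : 'I_n -> int) : {mpoly F[n + n]} :=
  \prod_e match w e with
          | Posz d => 'X_(lshift n e) ^+ d
          | Negz d => 'X_(rshift n e) ^+ d.+1
          end.

Definition torus_eqs : seq {mpoly F[n + n]} :=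
  [seq 'X_(lshift n e) * 'X_(rshift n e) - 1 | e <- enum 'I_n] ++
  [seq laurent_monomial (chi i) - 1 | i <- enum 'I_r].

Definition in_torus (x : 'I_n -> F) :=
  (forall e, x e != 0) /\ (forall i, \prod_e x e ^ chi i e = 1).

Lemma laurent_monomialE w (v : 'I_(n + n) -> F) :
  (forall e, v (lshift n e) * v (rshift n e) = 1) ->
  (laurent_monomial w).@[v] = \prod_e v (lshift n e) ^ w e.
Proof.
move=> vV; rewrite rmorph_prod; apply: eq_bigr => e _ /=.
case: (w e) => d; rewrite rmorphXn /= mevalXU //.
have : v (lshift n e) * v (rshift n e) = 1 := vV e.
move=> /(canRL (mulKf _)) -> //; first by rewrite mulr1 NegzE exprVn.
by apply: contra_eq_neq (vV e) => ->; rewrite mul0r eq_sym oner_neq0.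
Qed.

Lemma torus_eqsP (v : 'rV[F]_(n + n)) :
  reflect ((forall e, v ord0 (lshift n e) * v ord0 (rshift n e) = 1) /\
           in_torus (fun e => v ord0 (lshift n e)))
    (all (fun p => p.@[v ord0] == 0) torus_eqs).
Proof.
rewrite all_cat; apply: (iffP andP) => [[/allP H1 /allP H2]|[H1 [H2 H3]]].
  have vV e : v ord0 (lshift n e) * v ord0 (rshift n e) = 1.
    have /eqP := H1 _ (map_f _ (mem_enum _ e)).
    by rewrite mevalB mevalM !mevalXU meval1 => /eqP; rewrite subr_eq0 => /eqP.
  split=> //; split=> [e|i].
    by apply: contra_eq_neq (vV e) => ->; rewrite mul0r eq_sym oner_neq0.
  have /eqP := H2 _ (map_f _ (mem_enum _ i)).
  rewrite mevalB meval1 laurent_monomialE // => /eqP.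
  by rewrite subr_eq0 => /eqP.
split; apply/allP => _ /mapP[e _ ->]; rewrite mevalB meval1.
  by rewrite mevalM !mevalXU H1 subrr.
by rewrite laurent_monomialE // H3 subrr.
Qed.

Definition mk_torus_row (x : 'I_n -> F) : 'rV[F]_(n + n) :=
  row_mx (\row_e x e) (\row_e (x e)^-1).

Lemma mk_torus_proof x : in_torus x ->
  all (fun p => p.@[mk_torus_row x ord0] == 0) torus_eqs.
Proof.
move=> [x0 xc]; apply/torus_eqsP; split.
  by move=> e; rewrite row_mxEl row_mxEr !mxE mulfV.
split=> [e|i]; first by rewrite row_mxEl mxE.
by rewrite -[RHS](xc i); apply: eq_bigr => e _; rewrite row_mxEl mxE.
Qed.

Definition mk_torus x (xT : in_torus x) : points torus_eqs :=
  exist _ (mk_torus_row x) (mk_torus_proof xT).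

Definition tcoord (g : points torus_eqs) (e : 'I_n) : F := val g ord0 (lshift n e).

Lemma tcoordE (g : points torus_eqs) e : val g ord0 (lshift n e) = tcoord g e.
Proof. by []. Qed.

Lemma tcoordP g : in_torus (tcoord g).
Proof. by have /torus_eqsP[] := valP g. Qed.

Lemma tcoord_mk x xT e : tcoord (@mk_torus x xT) e = x e.
Proof. by rewrite /tcoord row_mxEl mxE. Qed.

Lemma tcoordV (g : points torus_eqs) e : val g ord0 (rshift n e) = (tcoord g e)^-1.
Proof.
have /torus_eqsP[/(_ e) H _] := valP g.
by rewrite -[RHS]mulr1 -H mulKf // (tcoordP g).1.
Qed.

Lemma torus_inj (g h : points torus_eqs) : tcoord g =1 tcoord h -> g = h.
Proof.
move=> E; apply/val_inj/rowP => k; rewrite -[k]splitK.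
by case: (split k) => e /=; rewrite ?tcoordV ?tcoordE E.
Qed.

Lemma in_torus1 : in_torus (fun=> 1).
Proof.
by split=> [_|i]; [apply: oner_neq0 | rewrite big1 // => e _; rewrite exp1rz].
Qed.

Lemma in_torusM x y : in_torus x -> in_torus y -> in_torus (fun e => x e * y e).
Proof.
move=> [x0 xc] [y0 yc]; split=> [e|i]; first by rewrite mulf_neq0.
under eq_bigr do rewrite expfzMl.
by rewrite big_split /= xc yc mulr1.
Qed.

Lemma in_torusV x : in_torus x -> in_torus (fun e => (x e)^-1).
Proof.
move=> [x0 xc]; split=> [e|i]; first by rewrite invr_neq0.
under eq_bigr do rewrite exprz_inv -invr_expz.
by rewrite prodfV xc invr1.
Qed.

Definition torus : algebraic_group F.
Proof.
refine (@AlgebraicGroup F (n + n) torus_eqs (mk_torus in_torus1)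
  (fun g h => mk_torus (in_torusM (tcoordP g) (tcoordP h)))
  (fun g => mk_torus (in_torusV (tcoordP g))) _ _ _ _ _).
- by move=> g h k; apply: torus_inj => e; rewrite !tcoord_mk mulrA.
- by move=> g; apply: torus_inj => e; rewrite !tcoord_mk mul1r.
- move=> g; apply: torus_inj => e; rewrite !tcoord_mk mulVf //.
  exact: (tcoordP g).1.
- exists (fun k => 'X_(lshift (n + n) k) * 'X_(rshift (n + n) k)) => g h k.
  rewrite mevalM !mevalXU row_mxEl row_mxEr -[k]splitK.
  by case: (split k) => e /=; rewrite ?row_mxEl ?row_mxEr mxE ?tcoordV ?invfM.
- exists (fun k => match split k with
                   | inl e => 'X_(rshift n e) | inr e => 'X_(lshift n e) end).
  move=> g k; rewrite -{1}[k]splitK.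
  case: (split k) => e /=; rewrite ?row_mxEl ?row_mxEr mxE mevalXU ?tcoordV //.
  by rewrite invrK.
Defined.

(** The torus is connected when the characters can be completed to a dual pair:
    each element is then a product of points of the one-parameter groups whose
    weights are the standard vectors e minus sum_i chi_i(e) nu_i, which every
    chi_i kills. *)
Variable nu : 'I_r -> 'I_n -> int.
Hypothesis dual : forall i j, \sum_e chi i e * nu j e = (i == j)%:R.

Definition one_param (e e' : 'I_n) : int :=
  (e == e')%:R - \sum_i chi i e * nu i e'.

Lemma one_param_chi e i : \sum_e' chi i e' * one_param e e' = 0.
Proof.
under eq_bigr do rewrite mulrBr; rewrite sumrB.
rewrite (bigD1 e) //= eqxx mulr1 big1 => [|e' /negPf]; last first.
  by rewrite eq_sym => ->; rewrite mulr0.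
rewrite addr0; apply/eqP; rewrite subr_eq0; apply/eqP.
under eq_bigr do rewrite mulr_sumr; rewrite exchange_big /=.
rewrite (bigD1 i) //= [X in _ + X]big1 => [|j /negPf ji].
  under eq_bigr do rewrite mulrCA; rewrite -mulr_sumr dual eqxx mulr1.
  by rewrite addr0.
under eq_bigr do rewrite mulrCA; rewrite -mulr_sumr dual eq_sym ji.
by rewrite mulr0.
Qed.

Lemma in_torus_one_param e t : t != 0 -> in_torus (fun e' => t ^ one_param e e').
Proof.
move=> t0; split=> [e'|i]; first by rewrite expfz_neq0.
under eq_bigr do rewrite exprz_exp mulrC.
by rewrite -expfz_sum // one_param_chi expr0z.
Qed.

Lemma torus_decomposition x : in_torus x ->
  forall e', \prod_e x e ^ one_param e e' = x e'.
Proof.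
move=> [x0 xc] e'; under eq_bigr do rewrite expfzDr //.
rewrite big_split /= (bigD1 e') //= eqxx big1 => [|e /negPf ->]; last first.
  by rewrite expr0z.
rewrite mulr1 expr1z -[RHS]mulr1; congr (_ * _).
under eq_bigr do rewrite -invr_expz expfz_sum //.
rewrite prodfV exchange_big big1 ?invr1 //= => i _.
under eq_bigr do rewrite -exprz_exp.
by rewrite -expfz_prod xc exp1rz.
Qed.

Lemma torus_connected : zariski_connected (ag_eqs torus).
Proof.
move=> A B cA cB cov dis; pose one := mk_torus in_torus1.
wlog A1 : A B cA cB cov dis / A one => [W|].
  have [A1|B1] := cov one; first exact: W A1.
  suff: (forall x, B x) \/ (forall x, A x) by case; [right | left].
  apply: W B1 => // [x|x [Bx Ax]]; last exact: (dis x).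
  by case: (cov x); [right | left].
left=> h; have hT := tcoordP h.
have step (x : 'I_n -> F) (xT : in_torus x) e t (t0 : t != 0) :
    A (mk_torus xT) ->
    A (mk_torus (in_torusM xT (in_torus_one_param e t0))).
  (* the curve lives over s <> 0; at s = 0 it gets the default value 1 for s *)
  have nz (s : F) : (if s == 0 then 1 else s) != 0.
    by case: ifP => [_|->] //; apply: oner_neq0.
  pose g s := mk_torus (in_torusM xT (in_torus_one_param e (nz s))).
  have gE s e' : s != 0 -> tcoord (g s) e' = x e' * s ^ one_param e e'.
    by move=> /negPf s0; rewrite tcoord_mk s0.
  have g1 s (s0 : s != 0) : g s = mk_torus (in_torusM xT (in_torus_one_param e s0)).
    by apply: torus_inj => e'; rewrite gE // tcoord_mk.
  have gX k : exists N (q : {poly F}), forall s, s != 0 ->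
      s ^+ N * val (g s) ord0 k = q.[s].
    have mono (z : F) (d : int) : exists N (q : {poly F}),
        forall s, s != 0 -> s ^+ N * (z * s ^ d) = q.[s].
      case: d => d; [exists 0%N, (z *: 'X^d) | exists d.+1, z%:P] => s s0.
        by rewrite expr0 mul1r hornerZ hornerXn.
      by rewrite hornerC NegzE -invr_expz mulrCA mulfV ?mulr1 // expf_neq0.
    rewrite -[k]splitK; case: (split k) => e'.
      have [N [q H]] := mono (x e') (one_param e e').
      exists N, q => s s0; change (s ^+ N * tcoord (g s) e' = q.[s]).
      by rewrite gE // H.
    have [N [q H]] := mono (x e')^-1 (- one_param e e').
    exists N, q => s s0.
    change (s ^+ N * val (g s) ord0 (rshift n e') = q.[s]); rewrite tcoordV.
    by rewrite gE // invfM invr_expz H.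
  rewrite -(g1 t t0) => Ax.
  apply: (curve_step char0 (d := 'X) (s := 1) cA cB cov dis);
    rewrite ?hornerX ?oner_neq0 //; last first.
    suff -> : g 1 = mk_torus xT by [].
    apply: torus_inj => e'; rewrite gE ?oner_neq0 // tcoord_mk exp1rz mulr1 //.
  elim/mpoly_ring_ind => [z|k|p1 p2 [N1 [q1 H1]] [N2 [q2 H2]]|
                          p1 p2 [N1 [q1 H1]] [N2 [q2 H2]]].
  - by exists 0%N, z%:P => s _; rewrite expr0 mul1r mevalC hornerC.
  - have [N [q H]] := gX k.
    by exists N, q => s; rewrite hornerX mevalXU => /H.
  - exists (N1 + N2)%N, ('X^N2 * q1 + 'X^N1 * q2) => s s0.
    rewrite hornerD !hornerM -(H1 s s0) -(H2 s s0) !hornerXn mevalD !hornerX.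
    by rewrite exprD; ring.
  - exists (N1 + N2)%N, (q1 * q2) => s s0.
    by rewrite hornerM -(H1 s s0) -(H2 s s0) mevalM exprD; ring.
have [y [yT [Ay yE]]] : exists y (yT : in_torus y), A (mk_torus yT) /\
   forall e', y e' = \prod_e tcoord h e ^ one_param e e'.
  pose y (es : seq 'I_n) e' := \prod_(e <- es) tcoord h e ^ one_param e e'.
  suff [yT Ay] : exists yT : in_torus (y (enum 'I_n)), A (mk_torus yT).
    exists _, yT; split=> // e'; rewrite /y big_enum //.
  elim: (enum 'I_n) => [|e es [yT Ay]].
    have yT : in_torus (y [::]).
      by split=> [e|i]; rewrite /y ?big_nil ?oner_neq0 // big1 // => e _;
        rewrite big_nil exp1rz.
    exists yT; suff -> : mk_torus yT = one by [].
    by apply: torus_inj => e; rewrite !tcoord_mk /y big_nil.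
  have yE e' : y (e :: es) e' = y es e' * tcoord h e ^ one_param e e'.
    by rewrite /y big_cons mulrC.
  have yT' := in_torusM yT (in_torus_one_param e (hT.1 e)).
  have yT'' : in_torus (y (e :: es)).
    split=> [e'|i]; first by rewrite yE (yT'.1 e').
    by rewrite -[RHS](yT'.2 i); apply: eq_bigr => e' _; rewrite yE.
  exists yT''; rewrite (_ : mk_torus yT'' =
    mk_torus (in_torusM yT (in_torus_one_param e (hT.1 e)))); first exact: step.
  by apply: torus_inj => e'; rewrite !tcoord_mk yE.
suff -> : h = mk_torus yT by [].
by apply: torus_inj => e'; rewrite tcoord_mk yE torus_decomposition.
Qed.

(** A point v0 of the hypersurface with no zero coordinate makes the action of the
    torus faithful. *)
Lemma torus_Aut_alg (f : {mpoly F[n]}) (v0 : points [:: f]) :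
  (forall e, val v0 ord0 e != 0) ->
  (forall x, in_torus x -> forall v, f.@[v] = 0 -> f.@[fun e => x e * v e] = 0) ->
  forall x, in_torus x -> exists2 phi : points [:: f] -> points [:: f], Aut_alg phi &
    forall v e, val (phi v) ord0 e = x e * val v ord0 e.
Proof.
move=> v00 Tf x xT.
pose act (g : group_points torus) (v : points [:: f]) : points [:: f] :=
  mk_pt (Tf _ (tcoordP g) _ (pt_eq v)).
have actE g v e : val (act g v) ord0 e = tcoord g e * val v ord0 e.
  by rewrite mk_ptE.
exists (act (mk_torus xT)); last by move=> v e; rewrite actE tcoord_mk.
apply: (action_Aut_alg torus_connected); split.
- by move=> v; apply: pt_inj => e; rewrite actE tcoord_mk mul1r.
- by move=> g h v; apply: pt_inj => e; rewrite !actE tcoord_mk mulrA.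
- exists (fun e => 'X_(lshift n (lshift n e)) * 'X_(rshift (n + n) e)) => g v e.
  by rewrite mevalM !mevalXU row_mxEl row_mxEr actE.
move=> g /(_ v0) gv; apply: torus_inj => e; rewrite tcoord_mk.
have := congr1 (fun v : points [:: f] => val v ord0 e) gv; rewrite actE.
by move=> E; apply: (mulIf (v00 e)); rewrite E mul1r.
Qed.

End Torus.

(** * Connected groups permuting closed sets *)

Section Components.
Variable F : closedFieldType.
Hypothesis char0 : [pchar F] =i pred0.

(** Two polynomials which do not vanish identically on a line have a common point
    there at which neither is zero; hence a set containing the line through any
    two of its points is irreducible. *)
Lemma linear_irreducible n (C : ('I_n -> F) -> Prop) (ps : seq {mpoly F[n]}) :
  (forall v w s, C v -> C w -> C (fun i => v i + s * (w i - v i))) ->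
  (exists v, C v) -> (forall p, p \in ps -> exists2 v, C v & p.@[v] != 0) ->
  exists2 v, C v & forall p, p \in ps -> p.@[v] != 0.
Proof.
move=> Cl [v0 Cv0]; elim: ps => [|p ps IH] ps0; first by exists v0.
have [v Cv pv] := ps0 p (mem_head _ _).
have [|w Cw psw] := IH => [q qps|]; first by apply: ps0; rewrite inE qps orbT.
pose g i : {poly F} := (v i)%:P + (w i - v i) *: 'X.
have gE q t : (arc g q).[t] = q.@[fun i => v i + t * (w i - v i)].
  rewrite horner_arc; apply: meval_eq => i.
  by rewrite hornerD hornerC hornerZ hornerX mulrC.
have [|t] := poly_nonroot char0 (p := arc g p * \prod_(q <- ps) arc g q).
  rewrite mulf_neq0 //.
    apply: contraNneq pv => g0; have := gE p 0; rewrite g0 horner0 => ->.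
    by apply/eqP/meval_eq => i; rewrite mul0r addr0.
  rewrite prodf_seq_neq0; apply/allP => q qps /=.
  apply: contraNneq (psw q qps) => g0; have := gE q 1; rewrite g0 horner0 => ->.
  by apply/eqP/meval_eq => i; rewrite mul1r addrC subrK.
rewrite hornerM horner_prod mulf_eq0 negb_or prodf_seq_neq0 => /andP[pt /allP pst].
exists (fun i => v i + t * (w i - v i)); first exact: Cl.
by move=> q; rewrite inE => /predU1P[->|/pst]; rewrite -gE.
Qed.

Lemma zariski_closedU n (E : seq {mpoly F[n]}) (A B : points E -> Prop) :
  zariski_closed A -> zariski_closed B -> zariski_closed (fun x => A x \/ B x).
Proof.
move=> [S HA] [T HB].
exists (fun p => exists q r, [/\ S q, T r & p = q * r]) => x; split.
  move=> [/HA|/HB] H p [q [r [Sq Tr ->]]]; rewrite mevalM.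
    by rewrite (H q Sq) mul0r.
  by rewrite (H r Tr) mulr0.
move=> H; have [Ax|nA] := classic (A x); [by left | right; apply/HB => r Tr].
apply/eqP; apply: contraT => r0; case: nA; apply/HA => q Sq.
have := H _ (ex_intro _ q (ex_intro _ r (And3 Sq Tr erefl))).
by move/eqP; rewrite mevalM mulf_eq0 (negPf r0) orbF => /eqP.
Qed.

Lemma zariski_closed_bigU n (E : seq {mpoly F[n]}) (I : eqType) (s : seq I)
    (A : I -> points E -> Prop) :
  (forall i, zariski_closed (A i)) ->
  zariski_closed (fun x => exists2 i, i \in s & A i x).
Proof.
move=> cA; elim: s => [|i s [S HS]].
  exists (fun p => p = 1) => x; split=> [[]//|/(_ _ erefl)/eqP].
  by rewrite meval1 oner_eq0.
have [T HT] := zariski_closedU (cA i) (ex_intro _ S HS); exists T => x.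
rewrite -HT; split=> [[j]|[Ax|[j js Ax]]].
- by rewrite inE => /predU1P[->|js Ax]; [left | right; exists j].
- by exists i; rewrite ?mem_head.
- by exists j; rewrite // inE js orbT.
Qed.

(** The elements mapping C i into C j form a closed set; for fixed i these
    finitely many sets are disjoint and cover the group, so by connectedness
    only the one containing the neutral element is not empty. *)
Lemma invariant_components (G : algebraic_group F) n (E : seq {mpoly F[n]})
    (act : group_points G -> points E -> points E)
    (I : finType) (C : I -> points E -> Prop) :
  zariski_connected (ag_eqs G) -> algebraic_action act ->
  (forall i, zariski_closed (C i)) ->
  (forall i j, (forall v, C i v -> C j v) -> i = j) ->
  (forall g i, exists j, forall v, C i v -> C j (act g v)) ->
  forall g i v, C i v -> C i (act g v).
Proof.
move=> cG aA cC anti cov g i.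
pose A j (g : points (ag_eqs G)) := forall v, C i v -> C j (act g v).
have cA j : zariski_closed (A j).
  have [S HS] := cC j; have [h hE] := act_regular aA.
  exists (fun p => exists v q, [/\ C i v, S q &
    p = msubst (fix_right (val v)) (msubst h q)]) => x; split.
    move=> Ax _ [v [q [Cv Sq ->]]]; rewrite meval_fix_right meval_msubst.
    apply: etrans ((HS _).1 (Ax v Cv) _ Sq).
    by apply: meval_eq => k; rewrite hE.
  move=> H v Cv; apply/HS => q Sq.
  apply: etrans (H _ (ex_intro _ v (ex_intro _ q (And3 Cv Sq erefl)))).
  by rewrite meval_fix_right meval_msubst; apply: meval_eq => k; rewrite hE.
have disj x j j' : A j x -> A j' x -> j = j'.
  move=> Aj Aj'; have [i' Hi'] := cov (ag_inv x) j.
  have ii' : i = i'.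
    by apply: anti => v Cv; rewrite -(action_cancel aA x v); apply/Hi'/Aj.
  apply: anti => v Cv; rewrite -(action_cancelV aA x v).
  by apply: Aj'; rewrite ii'; apply: Hi'.
have A1 : A i (ag_one G) by move=> v; rewrite (act_one aA).
have cB := zariski_closed_bigU [seq j <- enum I | j != i] cA.
have [x|x||H] := cG _ _ (cA i) cB.
- have [j Aj] := cov x i; have [ij|ji] := eqVneq j i; first by left; rewrite -ij.
  by right; exists j => //; rewrite mem_filter ji mem_enum.
- move=> [Ai [j]]; rewrite mem_filter => /andP[/eqP ji _] Aj.
  by apply: ji; apply: disj Aj Ai.
- by apply.
- have [j] := H (ag_one G); rewrite mem_filter => /andP[/eqP ji _] Aj.
  by case: ji; apply: disj Aj A1.
Qed.

End Components.

(** ** Coordinate subspaces *)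

Section CoordinateSubspaces.
Variables (F : closedFieldType) (n : nat) (f : {mpoly F[n]}).
Hypothesis char0 : [pchar F] =i pred0.

Definition zeros (v : 'I_n -> F) : {set 'I_n} := [set e | v e == 0].

(** The minimal patterns give the maximal subspaces, which are irreducible and
    without inclusions: a connected group preserving their union permutes them. *)
Lemma invariant_coordinate_subspaces (G : algebraic_group F)
    (act : group_points G -> points [:: f] -> points [:: f]) (T : pred {set 'I_n}) :
  zariski_connected (ag_eqs G) -> algebraic_action act ->
  (forall S S' : {set 'I_n}, S \subset S' -> T S -> T S') ->
  (forall v : 'I_n -> F, T (zeros v) -> f.@[v] = 0) ->
  (forall g (v : points [:: f]), T (zeros (val v ord0)) -> T (zeros (val (act g v) ord0))) ->
  forall S, minset T S -> forall g (v : points [:: f]), S \subset zeros (val v ord0) ->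
    S \subset zeros (val (act g v) ord0).
Proof.
move=> cG aA Tup Tf Tact S0 mS0.
pose C (I : {S | minset T S}) (v : points [:: f]) :=
  is_true (val I \subset zeros (val v ord0)).
have TC (I : {S | minset T S}) (v : 'I_n -> F) : val I \subset zeros v -> f.@[v] = 0.
  by move=> /Tup TI; apply/Tf/TI/minsetp/(valP I).
move=> g v; apply: (@invariant_components F G n [:: f] act _ C cG aA _ _ _ g (exist _ S0 mS0) v).
- move=> I; exists (fun r => exists2 e, e \in val I & r = 'X_e) => w; split.
    move=> /subsetP Iv _ [e eI ->]; rewrite mevalXU.
    by have := Iv e eI; rewrite inE => /eqP.
  move=> H; apply/subsetP => e eI; rewrite inE.
  by have := H _ (ex_intro2 _ _ e eI erefl); rewrite mevalXU => ->.
- move=> I J IJ; apply/val_inj.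
  pose v0 e : F := (e \notin val I)%:R.
  have zv0 : zeros v0 = val I.
    by apply/setP => e; rewrite inE /v0; case: (e \in val I); rewrite ?eqxx ?oner_eq0.
  have fv0 : f.@[v0] = 0 by apply: (TC I); rewrite zv0.
  have zE : zeros (val (mk_pt fv0) ord0) = val I.
    by rewrite -zv0; apply/setP => e; rewrite !inE mk_ptE.
  have JI : val J \subset val I by rewrite -zE; apply: IJ; rewrite /C zE.
  have [_ mI] := minsetP (valP I).
  by apply/esym; apply: mI JI; apply: minsetp (valP J).
move=> {v}g' I; apply: NNPP => nJ; have [h hE] := act_regular aA.
pose H e := msubst (fix_left (val g')) (h e).
have HE v e : val (act g' v) ord0 e = (H e).@[val v ord0].
  by rewrite hE meval_fix_left.
have /fin_all_exists[e eP] (J : {S | minset T S}) : exists e,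
    e \in val J /\ exists2 v : 'I_n -> F, val I \subset zeros v & (H e).@[v] != 0.
  apply: NNPP => ne; apply: nJ; exists J => v Iv; apply/subsetP => e eJ.
  rewrite inE HE; apply/negP => /negP Hv; apply: ne; exists e; split=> //.
  by exists (val v ord0).
have [|||v Iv Hv] := @linear_irreducible F char0 n
  (fun v => is_true (val I \subset zeros v)) [seq H (e J) | J <- enum {: {S | minset T S}}].
- move=> v w s /subsetP Iv /subsetP Iw; apply/subsetP => i iI; rewrite inE.
  have := Iv i iI; have := Iw i iI; rewrite !inE => /eqP -> /eqP ->.
  by rewrite subrr mulr0 addr0.
- by exists (fun=> 0); apply/subsetP => i _; rewrite inE eqxx.
- by move=> _ /mapP[J _ ->]; have [_ [v]] := eP J; exists v.
have fv := TC I v Iv; pose w := mk_pt fv.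
have vw : zeros (val w ord0) = zeros v by apply/setP => i; rewrite !inE mk_ptE.
have : T (zeros (val (act g' w) ord0)).
  by apply: Tact; rewrite vw; apply: Tup Iv _; apply: minsetp (valP I).
move=> /minset_exists[S mS /subsetP Sw].
have [eS _] := eP (exist _ S mS).
have := Sw _ eS; rewrite inE HE; apply/negP.
have -> : (H (e (exist _ S mS))).@[val w ord0] = (H (e (exist _ S mS))).@[v].
  by apply: meval_eq => i; rewrite mk_ptE.
by apply: Hv; apply: map_f; rewrite mem_enum.
Qed.

End CoordinateSubspaces.

(** * The trinomial hypersurface: equation and singular points *)

Section Derivatives.
Variables (F : closedFieldType) (n : nat).
Implicit Types (p u w : {mpoly F[n]}).

Lemma mderivXUn (e : 'I_n) d : ('X_e ^+ d : {mpoly F[n]})^`M(e) = ('X_e ^+ d.-1) *+ d.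
Proof.
elim: d => [|d IH]; first by rewrite expr0 -mpolyC1 mderivC mulr0n.
rewrite exprS mderivM IH mderivXU eqxx mul1r mulrnAr mulrS; congr (_ + _).
by case: d {IH} => [|d]; rewrite ?mulr0n // -exprS.
Qed.

Lemma mderivXUn_neq (e e' : 'I_n) d : e' != e ->
  ('X_e' ^+ d : {mpoly F[n]})^`M(e) = 0.
Proof.
move=> /negPf ee'; elim: d => [|d IH]; first by rewrite expr0 -mpolyC1 mderivC.
by rewrite exprS mderivM IH mderivXU ee' mul0r mulr0 addr0.
Qed.

Lemma mderivM0 (e : 'I_n) p u : p^`M(e) = 0 -> u^`M(e) = 0 -> (p * u)^`M(e) = 0.
Proof. by rewrite mderivM => -> ->; rewrite mul0r mulr0 addr0. Qed.

Lemma mderiv_prod0 (e : 'I_n) (I : finType) (P : pred I) (G : I -> {mpoly F[n]}) :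
  (forall i, P i -> (G i)^`M(e) = 0) -> (\prod_(i | P i) G i)^`M(e) = 0.
Proof.
move=> G0; apply: (big_ind (fun p => p^`M(e) = 0)) => //.
  by rewrite -mpolyC1 mderivC.
by move=> u w; apply: mderivM0.
Qed.

Lemma mderiv_power (e : 'I_n) d p u w : u^`M(e) = 0 -> w^`M(e) = 0 ->
  p = 'X_e ^+ d * u + w -> p^`M(e) = ('X_e ^+ d.-1 * u) *+ d.
Proof.
move=> u0 w0 ->; rewrite mderivD mderivM u0 w0 mulr0 !addr0 mderivXUn.
by rewrite mulrnAl.
Qed.

End Derivatives.

Section Indices.
Variables k m p q : nat.
Local Notation n := (k + m + p + q)%N.

Variant index_spec : 'I_n -> Type :=
| IndexX i : index_spec (ix m p q i)
| IndexY j : index_spec (iy k p q j)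
| IndexZ l : index_spec (iz k m q l)
| IndexS r : index_spec (is_ k m p r).

Lemma indexP e : index_spec e.
Proof.
rewrite -[e]splitK; case: (split e) => [e1|r]; last exact: IndexS.
rewrite -[e1]splitK; case: (split e1) => [e2|l]; last exact: IndexZ.
by rewrite -[e2]splitK; case: (split e2) => [i|j]; [apply: IndexX | apply: IndexY].
Qed.

Definition coords T (fx : 'I_k -> T) (fy : 'I_m -> T) (fz : 'I_p -> T)
    (fs : 'I_q -> T) (e : 'I_n) : T :=
  match split e with
  | inr r => fs r
  | inl e1 => match split e1 with
    | inr l => fz l
    | inl e2 => match split e2 with inl i => fx i | inr j => fy j end
    end
  end.

Section Coords.
Variables (T : Type) (fx : 'I_k -> T) (fy : 'I_m -> T) (fz : 'I_p -> T) (fs : 'I_q -> T).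
Let v := coords fx fy fz fs.

Lemma split_l n1 n2 (i : 'I_n1) : split (lshift n2 i) = inl i.
Proof. exact: (unsplitK (inl i)). Qed.
Lemma split_r n1 n2 (i : 'I_n2) : split (rshift n1 i) = inr i.
Proof. exact: (unsplitK (inr i)). Qed.

Lemma coordsX i : v (ix m p q i) = fx i.
Proof. by rewrite /v /coords /ix !split_l. Qed.
Lemma coordsY j : v (iy k p q j) = fy j.
Proof. by rewrite /v /coords /iy !split_l split_r. Qed.
Lemma coordsZ l : v (iz k m q l) = fz l.
Proof. by rewrite /v /coords /iz split_l split_r. Qed.
Lemma coordsS r : v (is_ k m p r) = fs r.
Proof. by rewrite /v /coords /is_ split_r. Qed.
End Coords.

Definition coordsE := (coordsX, coordsY, coordsZ, coordsS).

(** A single rule deciding equality between indices of the four blocks. *)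
Lemma eq_index :
  (((forall (i : 'I_k) (i' : 'I_k), (ix m p q i == ix m p q i') = (i == i')) *
    (forall (j : 'I_m) (j' : 'I_m), (iy k p q j == iy k p q j') = (j == j')) *
    (forall (l : 'I_p) (l' : 'I_p), (iz k m q l == iz k m q l') = (l == l')) *
    (forall (r : 'I_q) (r' : 'I_q), (is_ k m p r == is_ k m p r') = (r == r'))) *
   ((forall (i : 'I_k) (j : 'I_m), (ix m p q i == iy k p q j) = false) *
    (forall (i : 'I_k) (j : 'I_m), (iy k p q j == ix m p q i) = false) *
    (forall (i : 'I_k) (l : 'I_p), (ix m p q i == iz k m q l) = false) *
    (forall (i : 'I_k) (l : 'I_p), (iz k m q l == ix m p q i) = false) *
    (forall (i : 'I_k) (r : 'I_q), (ix m p q i == is_ k m p r) = false) *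
    (forall (i : 'I_k) (r : 'I_q), (is_ k m p r == ix m p q i) = false)) *
   ((forall (j : 'I_m) (l : 'I_p), (iy k p q j == iz k m q l) = false) *
    (forall (j : 'I_m) (l : 'I_p), (iz k m q l == iy k p q j) = false) *
    (forall (j : 'I_m) (r : 'I_q), (iy k p q j == is_ k m p r) = false) *
    (forall (j : 'I_m) (r : 'I_q), (is_ k m p r == iy k p q j) = false) *
    (forall (l : 'I_p) (r : 'I_q), (iz k m q l == is_ k m p r) = false) *
    (forall (l : 'I_p) (r : 'I_q), (is_ k m p r == iz k m q l) = false)))%type.
Proof.
pose num := coords (fun i => (0, val i)%N) (fun i => (1, val i)%N)
  (fun i => (2, val i)%N) (fun i => (3, val i)%N).
have D e e' : num e <> num e' -> (e == e') = false.
  by move=> H; apply/eqP => E; apply: H; rewrite E.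
do !split; move=> x y; try by apply: D; rewrite /num !coordsE.
all: apply/eqP/eqP => [E|-> //]; have := congr1 num E.
all: by rewrite /num !coordsE => -[] /ord_inj.
Qed.

Lemma sum_index (R : nmodType) (f : 'I_n -> R) :
  \sum_e f e = \sum_i f (ix m p q i) + \sum_j f (iy k p q j) +
    \sum_l f (iz k m q l) + \sum_r f (is_ k m p r).
Proof. by rewrite !big_split_ord. Qed.

Lemma prod_index (R : comNzRingType) (f : 'I_n -> R) :
  \prod_e f e = (\prod_i f (ix m p q i)) * (\prod_j f (iy k p q j)) *
    (\prod_l f (iz k m q l)) * (\prod_r f (is_ k m p r)).
Proof. by rewrite !big_split_ord. Qed.

End Indices.

Section Trinomial.
Variables (F : closedFieldType) (k m p q : nat).
Variables (a : 'I_m -> nat) (b : 'I_p -> nat) (c : 'I_q -> nat).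
Local Notation n := (k + m + p + q)%N.
Local Notation f := (trinomial F k a b c).
Local Notation X := (X F k a b c).

(** The z_l and the s_r play the same role for the flows and for the derivatives;
    together they are the tail variables. *)
Definition tail (t : 'I_p + 'I_q) : 'I_n :=
  match t with inl l => iz k m q l | inr r => is_ k m p r end.
Definition tail_exp (t : 'I_p + 'I_q) : nat :=
  match t with inl l => b l | inr r => c r end.

Definition head_rest (i : 'I_k) : {mpoly F[n]} :=
  (\prod_(i' | i' != i) 'X_(ix m p q i')) * \prod_j 'X_(iy k p q j) ^+ a j.
Definition tail_rest (t : 'I_p + 'I_q) : {mpoly F[n]} :=
  match t with
  | inl l => \prod_(l' | l' != l) 'X_(iz k m q l') ^+ b l'
  | inr r => \prod_(r' | r' != r) 'X_(is_ k m p r') ^+ c r'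
  end.
Definition tail_other (t : 'I_p + 'I_q) : {mpoly F[n]} :=
  match t with
  | inl l => \prod_r 'X_(is_ k m p r) ^+ c r
  | inr r => \prod_l 'X_(iz k m q l) ^+ b l
  end.
Definition y_rest (j : 'I_m) : {mpoly F[n]} :=
  (\prod_i 'X_(ix m p q i)) * \prod_(j' | j' != j) 'X_(iy k p q j') ^+ a j'.
Definition tail_sum : {mpoly F[n]} :=
  \prod_l 'X_(iz k m q l) ^+ b l + \prod_r 'X_(is_ k m p r) ^+ c r.

Lemma trinomial_x i : f = 'X_(ix m p q i) * head_rest i + tail_sum.
Proof.
rewrite /trinomial /head_rest /tail_sum (bigD1 i) //= -!addrA; congr (_ + _).
by rewrite mulrA.
Qed.

Lemma trinomial_y j : f = 'X_(iy k p q j) ^+ a j * y_rest j + tail_sum.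
Proof.
rewrite /trinomial /y_rest /tail_sum [in LHS](bigD1 (P := xpredT) (op := *%R) j) //=.
by rewrite -!addrA; congr (_ + _); rewrite mulrCA.
Qed.

Lemma trinomial_tail i t : f = 'X_(ix m p q i) * head_rest i +
  'X_(tail t) ^+ tail_exp t * tail_rest t + tail_other t.
Proof.
rewrite (trinomial_x i) -addrA; congr (_ + _); rewrite /tail_sum.
case: t => [l|r] /=; first by rewrite [in LHS](bigD1 l).
by rewrite addrC [in LHS](bigD1 r).
Qed.

(* Proves that a product of powers of variables other than X_e has derivative 0. *)
Local Ltac deriv0 :=
  lazymatch goal with
  | |- mderiv _ (mpolyX _ _) = _ => by rewrite mderivXU eq_index
  | |- mderiv _ (mpolyX _ _ ^+ _) = _ => by rewrite mderivXUn_neq // eq_index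
  | |- mderiv _ (_ + _) = _ => rewrite mderivD [X in X + _](_ : _ = 0) ?add0r; deriv0
  | |- mderiv _ (_ * _) = _ => apply: mderivM0; deriv0
  | |- _ => apply: mderiv_prod0 => ? ?; deriv0
  end.

Lemma mderiv_x i : f^`M(ix m p q i) = head_rest i.
Proof.
rewrite (mderiv_power (e := ix m p q i) (d := 1) (u := head_rest i) (w := tail_sum)).
- by rewrite mul1r mulr1n.
- apply: mderivM0; last by deriv0.
  by apply: mderiv_prod0 => i' /negPf ii'; rewrite mderivXU eq_index ii'.
- by rewrite /tail_sum; deriv0.
- by rewrite expr1 -trinomial_x.
Qed.

Lemma mderiv_y j :
  f^`M(iy k p q j) = ('X_(iy k p q j) ^+ (a j).-1 * y_rest j) *+ a j.
Proof.
apply: (mderiv_power (w := tail_sum)); last exact: trinomial_y.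
- by rewrite /y_rest; deriv0.
- by rewrite /tail_sum; deriv0.
Qed.

Lemma mderiv_tail (i : 'I_k) t :
  f^`M(tail t) = ('X_(tail t) ^+ (tail_exp t).-1 * tail_rest t) *+ tail_exp t.
Proof.
apply: (mderiv_power (w := 'X_(ix m p q i) * head_rest i + tail_other t)).
- by case: t => [l|r] /=; deriv0.
- by case: t => [l|r] /=; rewrite /head_rest; deriv0.
- by rewrite addrCA addrA -trinomial_tail.
Qed.

End Trinomial.

Lemma bezout_big r (b : 'I_r -> nat) : exists x : 'I_r -> int,
  \sum_i (b i)%:Z * x i = (\big[gcdn/0%N]_i b i)%:Z.
Proof.
elim: r b => [|r IH] b; first by exists (fun=> 0); rewrite !big_ord0.
have [y yE] := IH (fun i => b (lift ord0 i)).
have [u [w uw]] := Bezoutz (b ord0)%:Z (\big[gcdn/0%N]_i b (lift ord0 i))%:Z.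
exists (fun i => if unlift ord0 i is Some j then w * y j else u).
rewrite !big_ord_recl /= unlift_none -[RHS]uw mulrC; congr (_ + _).
by rewrite -yE mulr_sumr; apply: eq_bigr => i _; rewrite liftK mulrCA.
Qed.

Lemma closed_root (F : closedFieldType) d (z : F) : (0 < d)%N -> exists t, t ^+ d = z.
Proof.
move=> d0; have [|t] := @closed_rootP F ('X^d - z%:P) _.
  by rewrite size_XnsubC // eqSS -lt0n.
by rewrite rootE !hornerE subr_eq0 => /eqP; exists t.
Qed.

Section TrinomialHypersurface.
Variables (F : closedFieldType) (k m p q : nat).
Hypothesis char0 : [pchar F] =i pred0.
Variables (a : 'I_m -> nat) (b : 'I_p -> nat) (c : 'I_q -> nat).
Hypothesis k_gt1 : (1 < k)%N.
Hypothesis p_ge1 : (1 <= p)%N.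
Hypothesis a_gt1 : forall j, (1 < a j)%N.
Hypothesis b_gt1 : forall l, (1 < b l)%N.
Hypothesis c_gt1 : forall r, (1 < c r)%N.
Local Notation n := (k + m + p + q)%N.
Local Notation f := (trinomial F k a b c).
Local Notation X := (X F k a b c).
Local Notation vx v i := (v (ix m p q i)).
Local Notation vy v j := (v (iy k p q j)).
Local Notation vz v l := (v (iz k m q l)).
Local Notation vs v r := (v (is_ k m p r)).
Local Notation d := (gcd_bc b c).
Local Notation u := (head_rest F p q a).
Local Notation tl := (@tail k m p q).

Let i0 : 'I_k := Ordinal (ltnW k_gt1).
Let l0 : 'I_p := Ordinal p_ge1.

Lemma trinomialE (v : 'I_n -> F) : f.@[v] = (\prod_i vx v i) * (\prod_j vy v j ^+ a j) +
  \prod_l vz v l ^+ b l + \prod_r vs v r ^+ c r.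
Proof.
rewrite /trinomial !mevalD mevalM !rmorph_prod /=.
by congr (_ * _ + _ + _); apply: eq_bigr => i _; rewrite ?rmorphXn /= mevalXU.
Qed.

Lemma head_restE (v : 'I_n -> F) i : (head_rest F p q a i).@[v] =
  (\prod_(i' | i' != i) vx v i') * \prod_j vy v j ^+ a j.
Proof.
rewrite /head_rest mevalM !rmorph_prod /=.
by congr (_ * _); apply: eq_bigr => j _; rewrite ?rmorphXn /= mevalXU.
Qed.

Lemma tail_rest_zE (v : 'I_n -> F) l :
  (tail_rest F k m b c (inl l)).@[v] = \prod_(l' | l' != l) vz v l' ^+ b l'.
Proof. by rewrite rmorph_prod; apply: eq_bigr => j _; rewrite rmorphXn /= mevalXU. Qed.

Lemma tail_rest_sE (v : 'I_n -> F) r :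
  (tail_rest F k m b c (inr r)).@[v] = \prod_(r' | r' != r) vs v r' ^+ c r'.
Proof. by rewrite rmorph_prod; apply: eq_bigr => j _; rewrite rmorphXn /= mevalXU. Qed.

Lemma tail_other_zE (v : 'I_n -> F) l :
  (tail_other F k m b c (inl l)).@[v] = \prod_r vs v r ^+ c r.
Proof. by rewrite rmorph_prod; apply: eq_bigr => j _; rewrite rmorphXn /= mevalXU. Qed.

Lemma tail_other_sE (v : 'I_n -> F) r :
  (tail_other F k m b c (inr r)).@[v] = \prod_l vz v l ^+ b l.
Proof. by rewrite rmorph_prod; apply: eq_bigr => j _; rewrite rmorphXn /= mevalXU. Qed.

Lemma prod_exp_eq0 (I : finType) (P : pred I) (x : I -> F) (d : I -> nat) :
  (forall i, (1 < d i)%N) ->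
  (\prod_(i | P i) x i ^+ d i == 0) = [exists (i | P i), x i == 0].
Proof.
move=> d1; apply/prodf_eq0/exists_inP => -[i Pi xi]; exists i => //.
  by move: xi; rewrite expf_eq0 => /andP[].
by rewrite expf_eq0 xi (ltnW (d1 i)).
Qed.

(** Where all derivatives of the first monomial vanish: those in y vanish with
    those in x, as all a_j are at least 2. *)
Definition head_singular (v : 'I_n -> F) : bool :=
  [exists j, vy v j == 0] ||
  [exists i, exists i', [&& i != i', vx v i == 0 & vx v i' == 0]].

Definition singular (v : 'I_n -> F) : bool :=
  [&& head_singular v, [exists l, vz v l == 0] & [exists r, vs v r == 0]].

Lemma head_restP (v : 'I_n -> F) i : reflect
  ((forall i', i' != i -> vx v i' != 0) /\ (forall j, vy v j != 0))
  ((head_rest F p q a i).@[v] != 0).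
Proof.
rewrite head_restE mulf_eq0 negb_or prod_exp_eq0 //.
apply: (iffP andP) => -[H1 H2]; split.
- exact/prodf_neq0.
- by move=> j; apply: contraNneq H2 => yj; apply/exists_inP; exists j => //; apply/eqP.
- exact/prodf_neq0.
- by rewrite negb_exists_in; apply/forall_inP.
Qed.

Lemma head_singular_rest (v : 'I_n -> F) : head_singular v ->
  forall i, (head_rest F p q a i).@[v] = 0.
Proof.
move=> H i; apply/eqP; apply: contraT => /head_restP[Hx Hy]; case/orP: H.
  by move=> /existsP[j yj]; have := Hy j; rewrite yj.
move=> /existsP[i1 /existsP[i2 /and3P[i12 x1 x2]]].
have [E|i1i] := eqVneq i1 i; last by have := Hx _ i1i; rewrite x1.
by have := Hx i2; rewrite x2 eq_sym -E i12 => /(_ isT).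
Qed.

Lemma head_nonsingular_rest (v : 'I_n -> F) : ~~ head_singular v ->
  exists i, (head_rest F p q a i).@[v] != 0.
Proof.
rewrite negb_or !negb_exists => /andP[/forallP Hy /forallP Hx].
have [/existsP[i xi]|] := boolP [exists i, vx v i == 0].
  exists i; apply/head_restP; split=> // i' i'i.
  have := Hx i; rewrite negb_exists => /forallP /(_ i').
  by rewrite eq_sym i'i xi.
rewrite negb_exists => /forallP H; exists (Ordinal (ltnW k_gt1)).
by apply/head_restP; split=> // i' _.
Qed.

Lemma head_singular_prod (v : 'I_n -> F) : head_singular v ->
  (\prod_i vx v i) * (\prod_j vy v j ^+ a j) = 0.
Proof.
move=> /head_singular_rest /(_ (Ordinal (ltnW k_gt1))); rewrite head_restE => H.
by rewrite (bigD1 (Ordinal (ltnW k_gt1))) //= -mulrA H mulr0.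
Qed.

Lemma tail_rest_eq0 (v : 'I_n -> F) t : (v (tail k m t) ^+ (tail_exp b c t).-1 *
    (tail_rest F k m b c t).@[v] == 0) =
  match t with
  | inl _ => [exists l, vz v l == 0] | inr _ => [exists r, vs v r == 0] end.
Proof.
have pred d x : (1 < d)%N -> (x ^+ d.-1 == 0 :> F) = (x == 0).
  by case: d => // d d1; rewrite expf_eq0 -ltnS d1.
case: t => t; rewrite ?tail_rest_zE ?tail_rest_sE mulf_eq0 /= pred //
   prod_exp_eq0 //.
  apply/orP/existsP => [[z0|/exists_inP[l _ z0]]|[l z0]]; try by eexists; eauto.
  by have [<-|lt] := eqVneq l t; [left | right; apply/exists_inP; exists l].
apply/orP/existsP => [[z0|/exists_inP[l _ z0]]|[l z0]]; try by eexists; eauto.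
by have [<-|lt] := eqVneq l t; [left | right; apply/exists_inP; exists l].
Qed.

Lemma gradient_singular (v : 'I_n -> F) : singular v -> forall e, (f^`M(e)).@[v] = 0.
Proof.
move=> /and3P[hv zv sv] e; case: (indexP e) => [i|j|l|r].
- by rewrite mderiv_x head_singular_rest.
- rewrite mderiv_y mevalMn mevalM rmorphXn /= mevalXU.
  suff -> : vy v j ^+ (a j).-1 * (y_rest F k p q a j).@[v] = 0 by rewrite mul0rn.
  rewrite mevalM mulrCA !rmorph_prod /=.
  under eq_bigr do rewrite mevalXU.
  under [X in _ * (_ * X)]eq_bigr do rewrite rmorphXn /= mevalXU.
  case/orP: hv => [/existsP[j' y0]|/existsP[i /existsP[_ /and3P[_ /eqP x0 _]]]].
    apply/eqP; rewrite !mulf_eq0 prod_exp_eq0 // expf_eq0.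
    have [E|jj'] := eqVneq j' j.
      by rewrite -{2}E y0 -ltnS prednK ?(ltnW (a_gt1 _)) // a_gt1 orbT.
    by apply/or3P/Or33/exists_inP; exists j'.
  by rewrite (bigD1 i) //= x0 !mul0r.
- rewrite (mderiv_tail F a b c (Ordinal (ltnW k_gt1)) (inl l)) mevalMn mevalM rmorphXn /= mevalXU.
  by apply/eqP; rewrite -mulr_natr mulf_eq0 (tail_rest_eq0 v (inl l)) zv.
- rewrite (mderiv_tail F a b c (Ordinal (ltnW k_gt1)) (inr r)) mevalMn mevalM rmorphXn /= mevalXU.
  by apply/eqP; rewrite -mulr_natr mulf_eq0 (tail_rest_eq0 v (inr r)) sv.
Qed.

(** Where the first monomial vanishes, the other two are opposite, hence
    vanish together. *)
Lemma head_singular_tail (v : 'I_n -> F) : f.@[v] = 0 -> head_singular v ->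
  [exists l, vz v l == 0] = [exists r, vs v r == 0].
Proof.
move=> fv /head_singular_prod hv; move: fv; rewrite trinomialE hv add0r => /eqP.
rewrite addr_eq0 => /eqP E.
have -> : [exists l, vz v l == 0] = (\prod_l vz v l ^+ b l == 0).
  by rewrite prod_exp_eq0.
by rewrite E oppr_eq0 prod_exp_eq0.
Qed.

(** Where the derivatives in x do not suffice, the one in any z_l does: if a z_l
    were zero, some s_r would be zero as well. *)
Lemma regular_pointE (v : X) : regular_point v <-> ~~ singular (val v ord0).
Proof.
split=> [[e]|]; first by apply: contraNN => /gradient_singular ->.
rewrite negb_and; have [hv /= tv|/head_nonsingular_rest[i hi] _] := boolP (head_singular _).
  pose l := Ordinal p_ge1; exists (iz k m q l).
  rewrite (mderiv_tail F a b c (Ordinal (ltnW k_gt1)) (inl l)) mevalMn mevalM rmorphXn /= mevalXU.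
  rewrite -mulr_natr mulf_eq0 (tail_rest_eq0 _ (inl l)).
  rewrite (negPf (natF_neq0 char0 _)) ?(ltnW (b_gt1 l)) // orbF.
  by move: tv; rewrite -head_singular_tail ?andbb //; apply: pt_eq.
by exists (ix m p q i); rewrite mderiv_x.
Qed.

(** * Moving points along the flows *)

Implicit Types (v w : X).

Lemma unit_point_eq0 :
  f.@[@coords k m p q F (fun i => if i == i0 then - 2%:R else 1)
    (fun=> 1) (fun=> 1) (fun=> 1)] = 0.
Proof.
rewrite trinomialE (bigD1 i0) //= coordsX eqxx !big1 ?mulr1; first by ring.
- by move=> r _; rewrite coordsS expr1n.
- by move=> r _; rewrite coordsZ expr1n.
- by move=> r _; rewrite coordsY expr1n.
- by move=> r /negPf ri; rewrite coordsX ri.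
Qed.

(** This point makes the flows and the torus act faithfully.  All its coordinates
    are 1 but one x_i, which is -2: the other two monomials are 1, also the empty
    one in the absence of s. *)
Lemma nonzero_point : exists v, forall e, val v ord0 e != 0.
Proof.
exists (mk_pt unit_point_eq0) => e; rewrite mk_ptE.
case: (indexP e) => j; rewrite !coordsE ?oner_neq0 //.
by case: ifP; rewrite ?oner_neq0 // oppr_eq0 (natF_neq0 char0).
Qed.

Lemma tail_neq_x i t : ix m p q i != tl t.
Proof. by case: t => j /=; rewrite eq_index. Qed.

Lemma tail_neq_y j t : (iy k p q j == tl t) = false.
Proof. by case: t => l /=; rewrite eq_index. Qed.

Lemma tail_inj : injective tl.
Proof.
by move=> [l|r] [l'|r'] /eqP /=; rewrite eq_index // => /eqP ->.
Qed.

Lemma flow_eq i t (v : 'I_n -> F) : f.@[v] = vx v i * (u i).@[v] +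
  v (tl t) ^+ tail_exp b c t * (tail_rest F k m b c t).@[v] +
  (tail_other F k m b c t).@[v].
Proof.
by rewrite {1}(trinomial_tail F a b c i t) !mevalD !mevalM rmorphXn /= !mevalXU.
Qed.

Lemma flow_indep i t g :
  g \in [:: u i; tail_rest F k m b c t; tail_other F k m b c t] ->
  forall v v' : 'I_n -> F,
    (forall j, j != ix m p q i -> j != tl t -> v j = v' j) -> g.@[v] = g.@[v'].
Proof.
rewrite !inE => /or3P[] /eqP -> v v' E.
- rewrite !head_restE; congr (_ * _); apply: eq_bigr => j ji.
    by rewrite E ?eq_index ?tail_neq_x.
  by rewrite E ?eq_index ?tail_neq_y.
- case: t E => t E; rewrite ?tail_rest_zE ?tail_rest_sE; apply: eq_bigr => j jt;
  by rewrite E ?eq_index.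
- case: t E => t E; rewrite ?tail_other_zE ?tail_other_sE; apply: eq_bigr => j jt;
  by rewrite E ?eq_index.
Qed.

Definition xflow i t := @flow F n f (u i) (tail_rest F k m b c t)
  (tail_other F k m b c t) (ix m p q i) (tl t) (tail_exp b c t)
  (tail_neq_x i t) (flow_eq i t) (@flow_indep i t).

Lemma xflow_Aut_alg i t s : Aut_alg (xflow i t s).
Proof.
have [v v0] := nonzero_point; apply: (@flow_Aut_alg F n char0 f _ _ _ _ _ _ _ _ _ v).
by apply/head_restP => //; split=> j.
Qed.

(** The curves from v to w serve two purposes.  Their points are in one orbit; and
    they consist of regular points of one fibre of y if v is regular, which
    remains true after applying an automorphism. *)
Definition elementary v w := exists Phi : F -> X -> X,
  [/\ forall s, Aut_alg (Phi s), Phi 0 v = v, Phi 1 v = w,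
      exists g : 'I_n -> {poly F}, forall s e, val (Phi s v) ord0 e = (g e).[s]
    & forall s j, yc (Phi s v) j = yc v j].

Inductive linked : X -> X -> Prop :=
| linked_refl v : linked v v
| linked_step v w z : elementary v w -> linked w z -> linked v z.

Lemma linked_trans v w z : linked v w -> linked w z -> linked v z.
Proof.
by elim=> // v1 v2 v3 e _ IH /IH; apply: linked_step.
Qed.

Lemma linked1 v w : elementary v w -> linked v w.
Proof. by move=> e; apply: linked_step e (linked_refl _). Qed.

Lemma linked_Aut_alg v w : linked v w -> exists2 phi : X -> X, Aut_alg phi & phi v = w.
Proof.
elim=> [z|z1 z2 z3 [Phi [A _ E _ _]] _ [phi Aphi phiE]].
  by exists (fun x => x) => //; apply: Aut_alg_one.
exists (fun x => phi (Phi 1 x)); first exact: Aut_alg_mul.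
by rewrite E.
Qed.

Lemma linked_y v w : linked v w -> yc w =1 yc v.
Proof. by elim=> // z1 z2 z3 [Phi [_ _ <- _ E]] _ IH j; rewrite IH E. Qed.

Lemma xflow_elementary i t s v : elementary v (xflow i t s v).
Proof.
exists (fun s' => xflow i t (s' * s)); split.
- by move=> s'; apply: xflow_Aut_alg.
- by rewrite mul0r /xflow flow0.
- by rewrite mul1r.
- exists (fun e => arc (fun l => match split l with
                           | inl _ => s *: 'X | inr e => (val v ord0 e)%:P end)
    (flow_poly (u i) (tail_rest F k m b c t) (ix m p q i) (tl t) (tail_exp b c t) e)).
  move=> s' e; rewrite /xflow flowE horner_arc.
  have -> : s' * s = (const_mx (s' * s) : 'rV_1) ord0 ord0 by rewrite mxE.
  rewrite -flow_polyE; apply: meval_eq => l; rewrite mxE.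
  by case: (split l) => l'; rewrite ?mxE ?hornerZ ?hornerX ?hornerC // mulrC.
- move=> s' j; rewrite /yc /xflow flowE /flow_coord tail_neq_y.
  by rewrite eq_index.
Qed.

(** Where u vanishes, the flow changes x_i only, with constant speed equal to the
    derivative of f in the tail variable up to sign. *)
Lemma move_x i t v s : (u i).@[val v ord0] = 0 ->
  val v ord0 (tl t) ^+ (tail_exp b c t).-1 *
    (tail_rest F k m b c t).@[val v ord0] != 0 ->
  exists2 w, elementary v w &
    forall e, val w ord0 e = if e == ix m p q i then s else val v ord0 e.
Proof.
move=> u0 R0; set R := _ * _ in R0.
have e0 : (tail_exp b c t)%:R != 0 :> F.
  apply: (natF_neq0 char0); case: (t) => j; [exact: ltnW (b_gt1 j)|].
  exact: ltnW (c_gt1 j).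
pose s' := (val v ord0 (ix m p q i) - s) / (R * (tail_exp b c t)%:R).
exists (xflow i t s' v); first exact: xflow_elementary.
move=> e; rewrite /xflow flowE /flow_coord u0 !mulr0 addr0.
have [->|et] := eqVneq e (tl t).
  by rewrite eq_sym (negPf (tail_neq_x i t)).
case: ifP => // _; rewrite flow_difference_quotient0 -mulr_natr.
rewrite [_.@[_] * _](_ : _ = R * (tail_exp b c t)%:R); last by rewrite /R; ring.
by rewrite /s' (divfK (mulf_neq0 R0 e0)); ring.
Qed.

(** The tail variable moves with the constant speed u. *)
Lemma move_tail i t v s : (u i).@[val v ord0] != 0 ->
  exists2 w, elementary v w &
    val w ord0 (tl t) = s /\
    forall e, e != ix m p q i -> e != tl t -> val w ord0 e = val v ord0 e.
Proof.
move=> u0; pose s' := (s - val v ord0 (tl t)) / (u i).@[val v ord0].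
exists (xflow i t s' v); first exact: xflow_elementary.
rewrite /xflow !flowE /flow_coord eqxx; split.
  by rewrite divfK // addrC subrK.
by move=> e /negPf ei /negPf et; rewrite flowE /flow_coord ei et.
Qed.

(** The zero y_j, or the zero x_i outside the list, keeps u = 0 during all the
    moves of the x_i in the list. *)
Lemma move_xs (xi : 'I_k -> F) (J : seq 'I_k) v :
  (forall l, zc v l != 0) ->
  (exists j, yc v j = 0) \/ (exists2 i, i \notin J & xc v i = 0) ->
  exists2 w, linked v w & forall e, val w ord0 e =
    if [pick i in J | e == ix m p q i] is Some i then xi i else val v ord0 e.
Proof.
move=> z0 H; elim: J H => [|i J IH] H.
  exists v; first exact: linked_refl.
  by move=> e; case: pickP => // i; rewrite inE.
have [|w vw wE] := IH.
  by case: H => [|[i' i'J x0]]; [left | right; exists i' => //;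
    move: i'J; rewrite inE negb_or => /andP[]].
have wout e : (forall i, e == ix m p q i -> i \notin J) -> val w ord0 e = val v ord0 e.
  move=> eJ; rewrite wE; case: pickP => // i' /andP[i'J /eJ].
  by rewrite i'J.
have wz l : zc w l = zc v l by apply: wout => i'; rewrite eq_index.
have wy j : yc w j = yc v j by apply: wout => i'; rewrite eq_index.
have [||z wz' zE] := @move_x i (inl l0) w (xi i).
- apply/eqP; apply: contraT => /head_restP[Hx Hy].
  case: H => [[j yj]|[i' i'J xi']].
    by have := Hy j; rewrite -[val w _ _]/(yc w j) wy yj eqxx.
  move: i'J; rewrite inE negb_or => /andP[/Hx + i'J].
  have -> : val w ord0 (ix m p q i') = 0; last by rewrite eqxx.
  by rewrite wout // => i1; rewrite eq_index => /eqP <-.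
- rewrite (tail_rest_eq0 _ (inl l0)) negb_exists.
  by apply/forallP => l; change (zc w l != 0); rewrite wz.
exists z; first by apply: linked_trans vw (linked1 wz').
move=> e; rewrite zE; have [->|ei] := eqVneq e (ix m p q i).
  case: pickP => [i'|/(_ i)]; last by rewrite inE !eqxx.
  by rewrite eq_index => /andP[_ /eqP ->].
rewrite wE; case: pickP => [i1 /andP[i1J /eqP ->]|N1]; case: pickP => [i2|N2] //.
- by rewrite eq_index => /andP[_ /eqP ->].
- by have := N2 i1; rewrite inE i1J orbT eqxx.
- by rewrite inE => /andP[/predU1P[->|i2J]] E; [rewrite E in ei | have := N1 i2; rewrite i2J E].
Qed.

(** * The torus of the trinomial hypersurface *)

Lemma gcd_dvd_b l : (d %| b l)%N.
Proof. by apply: dvdn_trans (dvdn_gcdl _ _) _; apply: biggcdn_inf (dvdnn _). Qed.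

Lemma gcd_dvd_c r : (d %| c r)%N.
Proof. by apply: dvdn_trans (dvdn_gcdr _ _) _; apply: biggcdn_inf (dvdnn _). Qed.

Lemma gcd_bc_gt0 : (0 < d)%N.
Proof. by apply: dvdn_gt0 (gcd_dvd_b l0); apply: ltnW. Qed.

Lemma b_div_gt0 l : (0 < b l %/ d)%N.
Proof. by rewrite divn_gt0 ?gcd_bc_gt0 // dvdn_leq ?gcd_dvd_b // ltnW. Qed.

Lemma c_div_gt0 r : (0 < c r %/ d)%N.
Proof. by rewrite divn_gt0 ?gcd_bc_gt0 // dvdn_leq ?gcd_dvd_c // ltnW. Qed.

Lemma prod_div_b (z : 'I_p -> F) :
  \prod_l z l ^+ b l = (\prod_l z l ^+ (b l %/ d)) ^+ d.
Proof. by rewrite -prodrXl; apply: eq_bigr => l _; rewrite -exprM divnK ?gcd_dvd_b. Qed.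

Lemma prod_div_c (s : 'I_q -> F) :
  \prod_r s r ^+ c r = (\prod_r s r ^+ (c r %/ d)) ^+ d.
Proof. by rewrite -prodrXl; apply: eq_bigr => l _; rewrite -exprM divnK ?gcd_dvd_c. Qed.

(** The characters x y^a / z^b and z^(b/d) / s^(c/d).  If d > 1, the kernel would not be
    connected with b and c in place of b/d and c/d. *)
Definition chars (i : 'I_2) : 'I_n -> int :=
  if i == ord0 then coords (fun=> 1) (fun j => (a j)%:Z) (fun l => - (b l)%:Z) (fun=> 0)
  else coords (fun=> 0) (fun=> 0) (fun l => (b l %/ d)%N%:Z) (fun r => - (c r %/ d)%N%:Z).

(** The Bezout coefficients of the b_l / d and - c_r / d make up the second dual
    vector; x_i0 has exponent 1 in the first character and does not occur in the
    second, so that it is the first dual vector and corrects the second one. *)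
Lemma chars_dual : exists nu : 'I_2 -> 'I_n -> int,
  forall i j, \sum_e chars i e * nu j e = (i == j)%:R.
Proof.
have [x xE] : exists x : 'I_p + 'I_q -> int,
    \sum_l (b l %/ d)%N%:Z * x (inl l) + \sum_r - (c r %/ d)%N%:Z * x (inr r) = 1.
  have [x xE] := bezout_big b; have [y yE] := bezout_big c.
  have [u [w uw]] := Bezoutz (\big[gcdn/0%N]_l b l)%:Z (\big[gcdn/0%N]_r c r)%:Z.
  exists (fun t => match t with inl l => u * x l | inr r => - (w * y r) end).
  have d0 : d%:Z != 0 by rewrite eqz_nat -lt0n gcd_bc_gt0.
  apply: (mulfI d0); rewrite mulr1 -[RHS]uw -xE -yE mulrDr !mulr_sumr.
  congr (_ + _); apply: eq_bigr => l _.
    by rewrite -{2}(divnK (gcd_dvd_b l)) PoszM; ring.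
  by rewrite -{2}(divnK (gcd_dvd_c l)) PoszM; ring.
pose N := \sum_l (b l)%:Z * x (inl l).
exists (fun j => if j == ord0
  then coords (fun i => (i == i0)%:R) (fun=> 0) (fun=> 0) (fun=> 0)
  else coords (fun i => N * (i == i0)%:R) (fun=> 0) (fun l => x (inl l)) (fun r => x (inr r))).
have sumE (g h : 'I_n -> int) : \sum_e g e * h e = \sum_i vx g i * vx h i +
    \sum_j vy g j * vy h j + \sum_l vz g l * vz h l + \sum_r vs g r * vs h r.
  exact: sum_index.
have delta (z : int) : \sum_(i < k) z * (i == i0)%:R = z.
  rewrite (bigD1 i0) // eqxx mulr1 big1 => [|i /negPf ->]; last by rewrite mulr0.
  by rewrite /= addr0.
have zero r (g : 'I_r -> int) : (forall i, g i = 0) -> \sum_i g i = 0.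
  by move=> g0; rewrite big1.
have two (i : 'I_2) : i = ord0 \/ i = ord_max.
  by case: i => [[|[|]]] //= H; [left | right]; apply: val_inj.
move=> i j; rewrite sumE /chars.
case: (two i) (two j) => -> [] -> /=.
- under eq_bigr do rewrite !coordsX; rewrite delta.
  by rewrite !zero ?addr0 // => l; rewrite !coordsE ?mulr0 ?mul0r.
- under eq_bigr do rewrite !coordsX mul1r; rewrite delta.
  rewrite [X in _ + X + _ + _]zero ?addr0 => [|l]; last by rewrite !coordsE mulr0.
  rewrite [X in _ + X]zero ?addr0 => [|l]; last by rewrite !coordsE mul0r.
  rewrite /N -big_split /= zero // => l.
  by rewrite !coordsZ mulNr subrr.
- by rewrite !zero ?addr0 // => l; rewrite !coordsE ?mulr0 ?mul0r.
- rewrite [X in X + _ + _ + _]zero ?add0r => [|l]; last by rewrite !coordsE mul0r.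
  rewrite [X in X + _ + _]zero ?add0r => [|l]; last by rewrite !coordsE mul0r.
  rewrite -[RHS]xE; congr (_ + _); apply: eq_bigr => l _; by rewrite !coordsE.
Qed.

Definition same_orbit v w := exists2 phi : X -> X, Aut_alg phi & phi v = w.

Lemma same_orbit_trans v w z : same_orbit v w -> same_orbit w z -> same_orbit v z.
Proof.
move=> [phi A <-] [psi B <-]; exists (fun x => psi (phi x)) => //.
exact: Aut_alg_mul.
Qed.

Lemma same_orbit_sym v w : same_orbit v w -> same_orbit w v.
Proof.
move=> [phi A <-]; have [_ [psi [_ K1 K2]]] := Aut_alg_automorphism A.
by exists psi; [apply: Aut_alg_inv A K1 K2 | rewrite K1].
Qed.

Lemma torus_move (x : 'I_n -> F) v : (forall e, x e != 0) ->
  (\prod_i vx x i) * (\prod_j vy x j ^+ a j) = \prod_l vz x l ^+ b l ->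
  \prod_l vz x l ^+ (b l %/ d) = \prod_r vs x r ^+ (c r %/ d) ->
  exists2 w, same_orbit v w & forall e, val w ord0 e = x e * val v ord0 e.
Proof.
move=> x0 E1 E2; have [nu dual] := chars_dual.
have [v0 v00] := nonzero_point.
have prodE (y : 'I_n -> F) i : (forall e, y e != 0) -> \prod_e y e ^ chars i e = 1 <->
    if i == ord0 then (\prod_i vx y i) * (\prod_j vy y j ^+ a j) = \prod_l vz y l ^+ b l
    else \prod_l vz y l ^+ (b l %/ d) = \prod_r vs y r ^+ (c r %/ d).
  move=> y0; rewrite prod_index /chars; case: ifP => _.
    under eq_bigr do rewrite coordsX expr1z.
    under [X in _ * X * _ * _]eq_bigr do rewrite coordsY -exprnP.
    under [X in _ * _ * X * _]eq_bigr do rewrite coordsZ -invr_expz -exprnP.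
    rewrite [X in _ * X]big1 => [|r _]; last by rewrite coordsS.
    rewrite prodfV mulr1; split=> [|->].
      move/(canRL (mulfK _)) => ->; first by rewrite mul1r invrK.
      by rewrite invr_eq0; apply/prodf_neq0 => l _; rewrite expf_neq0.
    by rewrite mulfV //; apply/prodf_neq0 => l _; rewrite expf_neq0.
  under [X in _ * _ * X * _]eq_bigr do rewrite coordsZ -exprnP.
  under [X in _ * X]eq_bigr do rewrite coordsS -invr_expz -exprnP.
  rewrite [X in X * _ * _ * _]big1 => [|i' _]; last by rewrite coordsX.
  rewrite [X in _ * X * _ * _]big1 => [|j _]; last by rewrite coordsY.
  rewrite prodfV !mul1r; split=> [|->].
    move/(canRL (mulfK _)) => ->; first by rewrite mul1r invrK.
    by rewrite invr_eq0; apply/prodf_neq0 => l _; rewrite expf_neq0.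
  by rewrite mulfV //; apply/prodf_neq0 => l _; rewrite expf_neq0.
have xT : in_torus chars x.
  by split=> // i; apply/prodE => //; case: ifP.
have [|phi A phiE] := torus_Aut_alg char0 dual v00 _ xT.
  move=> y [y0 yc] z.
  have /= F1 := (prodE y ord0 y0).1 (yc ord0).
  have /= F2 := (prodE y ord_max y0).1 (yc ord_max).
  rewrite !trinomialE.
  have P (I : finType) (g h : I -> F) (e : I -> nat) :
      \prod_i (g i * h i) ^+ e i = (\prod_i g i ^+ e i) * \prod_i h i ^+ e i.
    by rewrite -big_split; apply: eq_bigr => j _; rewrite exprMn.
  have F3 : \prod_r vs y r ^+ c r = \prod_l vz y l ^+ b l.
    by rewrite [RHS]prod_div_b F2 [LHS]prod_div_c.
  rewrite !P big_split /= F3 -F1 => z0.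
  by rewrite -[RHS](mulr0 (\prod_l vz y l ^+ b l)) -z0 -F1; ring.
by exists (phi v); first by exists phi.
Qed.

(** * Transitivity *)

Lemma move_all_x (xi : 'I_k -> F) v : (forall l, zc v l != 0) ->
  (exists j, yc v j = 0) ->
  exists2 w, linked v w & forall e, val w ord0 e =
    coords xi (yc v) (zc v) (sc v) e.
Proof.
move=> z0 y0.
have [|w vw wE] := move_xs xi (J := enum 'I_k) z0.
  by left.
exists w => // e; rewrite wE; case: pickP => [i /andP[_ /eqP ->]|N].
  by rewrite coordsX.
case: (indexP e) N => l N; rewrite !coordsE //.
by have := N l; rewrite mem_enum eqxx.
Qed.

Lemma move_tails (xi : 'I_p + 'I_q -> F) i (J : seq ('I_p + 'I_q)) v :
  (u i).@[val v ord0] != 0 ->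
  exists2 w, linked v w & forall e, e != ix m p q i -> val w ord0 e =
    if [pick t in J | e == tl t] is Some t then xi t else val v ord0 e.
Proof.
move=> ui; elim: J => [|t J [w vw wE]].
  exists v; first exact: linked_refl.
  by move=> e _; case: pickP => // t; rewrite inE.
have uw : (u i).@[val w ord0] != 0.
  move: ui => /head_restP[Hx Hy]; apply/head_restP; split=> [i' i'i|j].
    rewrite wE ?eq_index //; case: pickP => [t' /andP[_]|_]; last exact: Hx.
    by rewrite (negPf (tail_neq_x _ _)).
  rewrite wE ?eq_index //; case: pickP => [t' /andP[_]|_]; last exact: Hy.
  by rewrite tail_neq_y.
have [z wz [zt zE]] := move_tail t (xi t) uw.
exists z; first by apply: linked_trans vw (linked1 wz).
move=> e ei; have [->|et] := eqVneq e (tl t).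
  case: pickP => [t'|/(_ t)]; last by rewrite inE !eqxx.
  by move=> /andP[_ /eqP /tail_inj <-].
rewrite zE // wE //; case: pickP => [t1 /andP[t1J E1]|N1]; case: pickP => [t2|N2] //.
- by move=> /andP[_ E2]; congr xi; apply: tail_inj; rewrite -(eqP E1) (eqP E2).
- by have := N2 t1; rewrite inE t1J orbT E1.
- rewrite inE => /andP[/predU1P[->|t2J]] E; first by rewrite E in et.
  by have := N1 t2; rewrite t2J E.
Qed.

(** After moving all x but one, if need be, the derivative in some x_i is nonzero
    and lets the tail variables take values with z^b = -1 and s^c = 1.  Then the
    equation makes x_i zero, which frees the other x. *)
Lemma linked_base : exists zeta : 'I_p -> F, forall v,
  regular_point v -> (forall j, yc v j != 0) ->
  exists2 w, linked v w & forall e, val w ord0 e =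
    coords (fun=> 0) (yc v) zeta (fun=> 1) e.
Proof.
have [z zE] := @closed_root F (b l0) (-1) (ltnW (b_gt1 l0)).
pose zeta l := if l == l0 then z else 1.
have zetaE : \prod_l zeta l ^+ b l = -1.
  rewrite (bigD1 l0) //= big1 => [|l /negPf ll0]; last by rewrite /zeta ll0 expr1n.
  by rewrite /zeta eqxx zE mulr1.
have zeta0 l : zeta l != 0.
  have : \prod_l zeta l ^+ b l != 0 by rewrite zetaE oppr_eq0 oner_neq0.
  move/prodf_neq0 => /(_ l isT); apply: contraNneq => ->.
  by rewrite expr0n -leqn0 leqNgt (ltnW (b_gt1 l)).
exists zeta => v rv yv.
have [w1 vw1 [y1 [i ui]]] : exists2 w, linked v w & yc w =1 yc v /\
    exists i, (u i).@[val w ord0] != 0.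
  have [hv|hv] := boolP (head_singular (val v ord0)); last first.
    exists v; first exact: linked_refl.
    by split=> //; apply: head_nonsingular_rest.
  have zv l : zc v l != 0.
    move/regular_pointE: rv.
    rewrite /singular hv -(head_singular_tail (pt_eq v) hv) andbb.
    by rewrite /= negb_exists => /forallP /(_ l).
  have [i xi0] : exists i, xc v i = 0.
    case/orP: hv => [/existsP[j yj]|/existsP[i /existsP[i' /and3P[_ /eqP x0 _]]]].
      by have := yv j; rewrite /yc yj.
    by exists i.
  have [|w vw wE] := move_xs (fun=> 1)
      (J := [seq i' <- enum 'I_k | i' != i]) zv.
    by right; exists i; rewrite // mem_filter eqxx.
  exists w => //; split; first exact: linked_y.
  exists i; apply/head_restP; split=> [i' i'i|j]; rewrite wE.
    case: pickP => [i1 _|/(_ i')]; first exact: oner_neq0.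
    by rewrite mem_filter i'i mem_enum eqxx.
  by case: pickP => [i1|_]; [rewrite eq_index andbF | apply: yv].
have [w2 w12 w2E] := move_tails
  (fun t => match t with inl l => zeta l | inr r => 1 end) (enum {: 'I_p + 'I_q}) ui.
have tailE t : val w2 ord0 (tl t) = match t with inl l => zeta l | inr r => 1 end.
  rewrite w2E ?[_ == ix _ _ _ _]eq_sym ?tail_neq_x //.
  case: pickP => [t' /andP[_ /eqP /tail_inj <-] //|/(_ t)].
  by rewrite mem_enum eqxx.
have y2 : yc w2 =1 yc v by move=> j; rewrite (linked_y w12) y1.
have z2 l : zc w2 l = zeta l := tailE (inl l).
have s2 r : sc w2 r = 1 := tailE (inr r).
have u2 : (u i).@[val w2 ord0] != 0.
  move: ui => /head_restP[Hx Hy]; apply/head_restP; split=> [i' i'i|j].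
    rewrite w2E ?eq_index //; case: pickP => [t' /andP[_]|_]; last exact: Hx.
    by rewrite (negPf (tail_neq_x _ _)).
  by rewrite -[_ != _]/(yc w2 j != 0) y2.
have x2 : xc w2 i = 0.
  have := pt_eq w2; rewrite trinomialE.
  have -> : \prod_l vz (val w2 ord0) l ^+ b l = -1.
    by rewrite -zetaE; apply: eq_bigr => l _; rewrite -z2.
  rewrite [X in _ + X]big1 => [|r _].
    rewrite addrNK (bigD1 i) //= -mulrA -head_restE => /eqP.
    by rewrite mulf_eq0 (negPf u2) orbF => /eqP.
  by have := s2 r; rewrite /sc => ->; rewrite expr1n.
have [||w3 w23 w3E] := move_xs (fun=> 0)
      (J := [seq i' <- enum 'I_k | i' != i]) (v := w2).
- by move=> l; rewrite z2.
- by right; exists i; rewrite // mem_filter eqxx.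
exists w3; first exact: linked_trans vw1 (linked_trans w12 w23).
move=> e; rewrite w3E; case: pickP => [i1 /andP[_ /eqP ->]|N].
  by rewrite coordsX.
case: (indexP e) N => l N; rewrite !coordsE.
- have [->//|li] := eqVneq l i.
  by have := N l; rewrite mem_filter li mem_enum eqxx.
- exact: y2.
- exact: z2.
- exact: s2.
Qed.

(** The exponent of x_i0 is 1, which lets it compensate for any change of y. *)
Lemma scale_y (y : 'I_m -> F) v : (forall j, y j != 0) ->
  exists2 w, same_orbit v w & forall e, val w ord0 e =
    coords (fun i => if i == i0 then (\prod_j y j ^+ a j)^-1 else 1)
      y (fun=> 1) (fun=> 1) e * val v ord0 e.
Proof.
move=> y0; apply: torus_move => [e||].
- case: (indexP e) => j; rewrite !coordsE ?oner_neq0 //; case: ifP => _.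
    by rewrite invr_eq0; apply/prodf_neq0 => l _; rewrite expf_neq0.
  exact: oner_neq0.
- rewrite (bigD1 i0) //= coordsX eqxx [X in _ * X * _]big1 => [|i /negPf ii0]; last first.
    by rewrite coordsX ii0.
  rewrite mulr1; under [X in _ * X = _]eq_bigr do rewrite coordsY.
  rewrite mulVf; last by apply/prodf_neq0 => l _; rewrite expf_neq0.
  by rewrite big1 // => l _; rewrite coordsZ expr1n.
- rewrite [LHS]big1 => [|l _]; last by rewrite coordsZ expr1n.
  by rewrite [RHS]big1 // => r _; rewrite coordsS expr1n.
Qed.

Lemma generic_same_orbit v w : O_generic v -> O_generic w -> same_orbit v w.
Proof.
have [zeta base] := linked_base.
move=> [rv yv] [rw yw]; have [v1 /linked_Aut_alg v1v v1E] := base v rv yv.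
have [w1 /linked_Aut_alg w1w w1E] := base w rw yw.
have [|v2 v2v v2E] := @scale_y (fun j => yc w j / yc v j) v1.
  by move=> j; rewrite mulf_neq0 ?invr_eq0.
apply: same_orbit_trans v1v (same_orbit_trans v2v _).
suff -> : v2 = w1 by apply: same_orbit_sym.
apply: pt_inj => e; rewrite v2E v1E w1E.
case: (indexP e) => j; rewrite !coordsE ?mulr0 ?mul1r //.
by rewrite divfK.
Qed.

(** Both points having the same e, the quotients of their z and s coordinates are
    in the kernel of the second character; x_i0 takes care of the first.  After
    this element of the torus only the x may differ. *)
Lemma Oy_same_orbit (M : {set 'I_m}) e v w : M != set0 -> e != 0 ->
  O_y M e v -> O_y M e w -> same_orbit v w.
Proof.
case/set0Pn => j0 j0M e0 [yv zv sv] [yw zw sw].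
have nz_z (x : X) : \prod_l zc x l ^+ (b l %/ d) = e * \prod_r sc x r ^+ (c r %/ d) ->
    e * \prod_r sc x r ^+ (c r %/ d) != 0 ->
    (forall l, zc x l != 0) /\ (forall r, sc x r != 0).
  move=> E H0; split=> [l|r].
    move: H0; rewrite -E => /prodf_neq0 /(_ l isT).
    by rewrite expf_eq0 b_div_gt0.
  move: H0; rewrite mulf_eq0 negb_or => /andP[_ /prodf_neq0 /(_ r isT)].
  by rewrite expf_eq0 c_div_gt0.
have [zv0 sv0] := nz_z v zv sv; have [zw0 sw0] := nz_z w zw sw.
pose y j := if j \in M then 1 else yc w j / yc v j.
pose x := coords (fun i => if i == i0 then
    (\prod_l (zc w l / zc v l) ^+ b l) / (\prod_j y j ^+ a j) else 1)
  y (fun l => zc w l / zc v l) (fun r => sc w r / sc v r).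
have y0 j : y j != 0.
  rewrite /y; case: ifP => jM; first exact: oner_neq0.
  by rewrite mulf_neq0 ?invr_eq0 ?yv ?yw ?jM.
have [|||v1 v1v v1E] := torus_move (x := x) v.
- move=> e'; rewrite /x; case: (indexP e') => j; rewrite !coordsE //.
  + case: ifP => _; last exact: oner_neq0.
    by rewrite mulf_neq0 ?invr_eq0 //; apply/prodf_neq0 => l _;
      rewrite expf_neq0 // mulf_neq0 ?invr_eq0.
  + by rewrite mulf_neq0 ?invr_eq0.
  + by rewrite mulf_neq0 ?invr_eq0.
- rewrite (bigD1 i0) //= {1}/x coordsX eqxx [X in _ * X * _]big1 => [|i /negPf ii0].
    rewrite mulr1; under [X in _ * X = _]eq_bigr do rewrite /x coordsY.
    under [RHS]eq_bigr do rewrite /x coordsZ.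
    by rewrite divfK //; apply/prodf_neq0 => l _; rewrite expf_neq0.
  by rewrite /x coordsX ii0.
- under eq_bigr do rewrite /x coordsZ expr_div_n.
  under [RHS]eq_bigr do rewrite /x coordsS expr_div_n.
  rewrite !big_split /= !prodfV zw zv -mulf_div divff ?mul1r //.
have [||w1 v1w1 w1E] := move_all_x (xc w) (v := v1).
- move=> l; rewrite /zc v1E /x coordsZ divfK ?zw0 //; exact: zw0.
- exists j0; apply/eqP; rewrite /yc v1E mulf_eq0; apply/orP; right.
  by have := yv j0; rewrite j0M.
apply: same_orbit_trans v1v _.
suff -> : w = w1 by apply: linked_Aut_alg.
apply: pt_inj => e'; rewrite w1E; case: (indexP e') => j; rewrite !coordsE //.
- rewrite /yc v1E /x coordsY /y; case: ifP => jM.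
    by have := yw j; have := yv j; rewrite jM => /eqP; rewrite /yc => -> /eqP ->; rewrite mulr0.
  by rewrite divfK // yv jM.
- by rewrite /zc v1E /x coordsZ divfK.
- by rewrite /sc v1E /x coordsS divfK.
Qed.

Lemma adjust_prod (I : finType) (i1 : I) (e : I -> nat) (g : I -> F) (s : F) :
  (0 < e i1)%N -> (forall i, g i != 0) -> s != 0 ->
  exists z : I -> F, [/\ forall i, z i != 0, \prod_i z i ^+ e i = s &
    forall i, i != i1 -> z i = g i].
Proof.
move=> e1 g0 s0; pose r := \prod_(i | i != i1) g i ^+ e i.
have r0 : r != 0 by apply/prodf_neq0 => i _; rewrite expf_neq0.
have [t tE] := closed_root (s / r) e1.
exists (fun i => if i == i1 then t else g i); split.
- move=> i; case: ifP => // _; apply: contraTneq isT => t0.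
  move/eqP: tE; rewrite t0 expr0n -leqn0 leqNgt e1 eq_sym mulf_eq0 invr_eq0.
  by rewrite (negPf s0) (negPf r0).
- rewrite (bigD1 i1) //= eqxx tE (eq_bigr (fun i => g i ^+ e i)).
    by rewrite -/r divfK.
  by move=> i /negPf ->.
- by move=> i /negPf ->.
Qed.

(** The scaling of a coordinate that vanishes at both points is arbitrary: one z_l
    with l in P adjusts the second character, then one x_i with i in K or y_j
    with j in M the first. *)
Lemma Osing_same_orbit (K : {set 'I_k}) (M : {set 'I_m}) (P : {set 'I_p})
    (Q : {set 'I_q}) v w :
  (2 <= 2 * #|M| + #|K|)%N -> P != set0 ->
  O_sing K M P Q v -> O_sing K M P Q w -> same_orbit v w.
Proof.
move=> KM /set0Pn[l1 l1P] [xv yv zv sv] [xw yw zw sw].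
pose g e := if val v ord0 e == 0 then 1 else val w ord0 e / val v ord0 e.
have same e : (val v ord0 e == 0) = (val w ord0 e == 0).
  case: (indexP e) => j.
  - by have := xv j; have := xw j; rewrite /xc => -> ->.
  - by have := yv j; have := yw j; rewrite /yc => -> ->.
  - by have := zv j; have := zw j; rewrite /zc => -> ->.
  - by have := sv j; have := sw j; rewrite /sc => -> ->.
have g0 e : g e != 0.
  rewrite /g; case: ifP => [_|ve]; first exact: oner_neq0.
  by rewrite mulf_neq0 ?invr_eq0 -?same ?ve.
have gv e : g e * val v ord0 e = val w ord0 e.
  rewrite /g; have := same e; case: eqP => [-> /esym/eqP ->|/eqP ve _].
    by rewrite mulr0.
  by rewrite divfK.
have s0 : \prod_r vs g r ^+ (c r %/ d) != 0.
  by apply/prodf_neq0 => r _; rewrite expf_neq0.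
have [z [z0 zE zg]] := adjust_prod (e := fun l => (b l %/ d)%N) (b_div_gt0 l1)
  (fun l => g0 (iz k m q l)) s0.
have zb0 : \prod_l z l ^+ b l != 0 by apply/prodf_neq0 => r _; rewrite expf_neq0.
have [x [y [x0 y0 xyE xg yg]]] : exists (x : 'I_k -> F) (y : 'I_m -> F),
    [/\ forall i, x i != 0, forall j, y j != 0,
        (\prod_i x i) * (\prod_j y j ^+ a j) = \prod_l z l ^+ b l,
        forall i, i \notin K -> x i = vx g i & forall j, j \notin M -> y j = vy g j].
  have gx0 : \prod_i vx g i != 0 by apply/prodf_neq0.
  have gy0 : \prod_j vy g j ^+ a j != 0.
    by apply/prodf_neq0 => j _; rewrite expf_neq0.
  have [K0|/set0Pn[i1 i1K]] := eqVneq K set0; last first.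
    have zy0 : (\prod_l z l ^+ b l) / (\prod_j vy g j ^+ a j) != 0.
      by rewrite mulf_neq0 ?invr_eq0.
    have [x [x0 xE xg]] := adjust_prod (i1 := i1) (e := fun=> 1%N) isT
      (fun i => g0 (ix m p q i)) zy0.
    exists x, (fun j => vy g j); split=> // [|i iK].
      by rewrite -[X in X * _](eq_bigr _ (fun i _ => expr1 (x i))) xE divfK.
    by apply: xg; apply: contraNneq iK => ->.
  have [j1 j1M] : exists j, j \in M.
    by apply/set0Pn; apply: contraTneq KM => ->; rewrite K0 !cards0.
  have zx0 : (\prod_l z l ^+ b l) / (\prod_i vx g i) != 0.
    by rewrite mulf_neq0 ?invr_eq0.
  have [y [y0 yE yg]] := adjust_prod (e := a) (ltnW (a_gt1 j1)) (fun j => g0 (iy k p q j)) zx0.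
  exists (fun i => vx g i), y; split=> // [|j jM].
    by rewrite yE mulrC divfK.
  by apply: yg; apply: contraNneq jM => ->.
pose t := coords x y z (fun r => vs g r).
have [|||w1 vw1 w1E] := torus_move (x := t) v.
- by move=> e; rewrite /t; case: (indexP e) => j; rewrite coordsE.
- rewrite /t; under eq_bigr do rewrite coordsX.
  under [X in _ * X]eq_bigr do rewrite coordsY.
  by under [RHS]eq_bigr do rewrite coordsZ.
- rewrite /t; under eq_bigr do rewrite coordsZ.
  by under [RHS]eq_bigr do rewrite coordsS.
suff -> : w = w1 by [].
apply: pt_inj => e; rewrite w1E -gv.
have [->|ve] := eqVneq (val v ord0 e) 0; first by rewrite !mulr0.
congr (_ * _); case: (indexP e) ve => j ve; rewrite /t coordsE //.
- by rewrite xg // -xv.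
- by rewrite yg // -yv.
- by rewrite zg //; apply: contraNneq ve => ->; have := zv l1; rewrite l1P.
Qed.

(** ** The sets are not empty *)

Lemma generic_nonempty : exists v, O_generic v.
Proof.
have [v v0] := nonzero_point; exists v; split=> [|j]; last exact: v0.
exists (ix m p q i0); rewrite mderiv_x; apply/head_restP.
by split=> *; apply: v0.
Qed.

Lemma Oy_nonempty (M : {set 'I_m}) e : M != set0 -> e ^+ d = -1 ->
  exists v, O_y M e v.
Proof.
move=> /set0Pn[j0 j0M] ed.
have e0 : e != 0.
  apply: contra_eq_neq ed => ->; rewrite expr0n gtn_eqF ?gcd_bc_gt0 //.
  by rewrite eq_sym oppr_eq0 oner_neq0.
have [z [z0 zE _]] := adjust_prod (e := fun l => (b l %/ d)%N)
  (b_div_gt0 l0) (fun=> oner_neq0 F) e0.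
pose v := @coords k m p q F (fun=> 0) (fun j => (j \notin M)%:R) z (fun=> 1).
have fv : f.@[v] = 0.
  rewrite trinomialE /v (bigD1 i0) //= coordsX !mul0r add0r.
  under eq_bigr do rewrite coordsZ.
  rewrite [X in _ + X]big1 => [|r _]; last by rewrite coordsS expr1n.
  by rewrite prod_div_b zE ed addNr.
exists (mk_pt fv).
have sE : \prod_r sc (mk_pt fv) r ^+ (c r %/ d) = 1.
  by rewrite big1 // => r _; rewrite /sc mk_ptE /v coordsS expr1n.
split=> [j||]; rewrite ?sE ?mulr1 //.
  by rewrite /yc mk_ptE /v coordsY; case: (j \in M); rewrite /= ?eqxx ?oner_eq0.
by rewrite -zE; apply: eq_bigr => l _; rewrite /zc mk_ptE /v coordsZ.
Qed.

Lemma Osing_nonempty (K : {set 'I_k}) (M : {set 'I_m}) (P : {set 'I_p}) (Q : {set 'I_q}) :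
  (2 <= 2 * #|M| + #|K|)%N -> P != set0 -> Q != set0 ->
  exists v, O_sing K M P Q v.
Proof.
move=> KM /set0Pn[l1 l1P] /set0Pn[r1 r1Q].
pose v := @coords k m p q F (fun i => (i \notin K)%:R) (fun j => (j \notin M)%:R)
  (fun l => (l \notin P)%:R) (fun r => (r \notin Q)%:R).
have fv : f.@[v] = 0.
  rewrite trinomialE.
  have -> : \prod_l vz v l ^+ b l = 0.
    by rewrite (bigD1 l1) //= /v coordsZ l1P expr0n (gtn_eqF (ltnW (b_gt1 l1))) mul0r.
  have -> : \prod_r vs v r ^+ c r = 0.
    by rewrite (bigD1 r1) //= /v coordsS r1Q expr0n (gtn_eqF (ltnW (c_gt1 r1))) mul0r.
  rewrite !addr0; have [K0|/set0Pn[i1 i1K]] := eqVneq K set0; last first.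
    by rewrite (bigD1 i1) //= /v coordsX i1K !mul0r.
  have [j1 j1M] : exists j, j \in M.
    by apply/set0Pn; apply: contraTneq KM => ->; rewrite K0 !cards0.
  rewrite [X in _ * X](bigD1 j1) //= /v coordsY j1M expr0n (gtn_eqF (ltnW (a_gt1 j1))).
  by rewrite mul0r mulr0.
have B (x : bool) : ((~~ x)%:R == 0 :> F) = x by case: x; rewrite ?eqxx ?oner_eq0.
exists (mk_pt fv); split=> j.
- by rewrite /xc mk_ptE /v coordsX B.
- by rewrite /yc mk_ptE /v coordsY B.
- by rewrite /zc mk_ptE /v coordsZ B.
- by rewrite /sc mk_ptE /v coordsS B.
Qed.

(** * Automorphisms and the functions y *)

(** The monomial u in the coefficient of x_i0 is a product of variables, and f
    does not vanish identically where one of them does, so f is prime to u. *)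
Lemma vanish_trinomial g : (forall v : 'I_n -> F, f.@[v] = 0 -> g.@[v] = 0) ->
  exists h, g = f * h.
Proof.
have X0 e : 'X_e != 0 :> {mpoly F[n]}.
  apply: contraNneq (oner_neq0 F) => X0.
  by rewrite -[1](mevalXU (fun=> 1) e) X0 meval0.
have var e : (exists i, e = ix m p q i) \/ (exists j, e = iy k p q j) -> prime_to f 'X_e.
  move=> He; pose v := @coords k m p q F (fun=> 0) (fun=> 0) (fun=> 1) (fun=> 1).
  apply: (@prime_to_var F n char0 f e v); first by rewrite /v; case: He => -[j ->]; rewrite coordsE.
  rewrite trinomialE (bigD1 i0) //= /v coordsX !mul0r add0r.
  rewrite !big1 => [|r _|l _]; rewrite ?coordsE ?expr1n //.
  by rewrite (natF_neq0 char0 (d := 2)).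
apply: (vanish_dvd char0 (u := head_rest F p q a i0) (w := tail_sum F k m b c)
  (i := ix m p q i0)) => [|v v' E|v v' E||].
- exact: trinomial_x.
- by rewrite !head_restE; congr (_ * _); apply: eq_bigr => j ji; rewrite E // eq_index.
- rewrite /tail_sum !mevalD !rmorph_prod /=; congr (_ + _); apply: eq_bigr => j _;
  by rewrite !rmorphXn /= !mevalXU E // eq_index.
- rewrite /head_rest mulf_neq0 //; apply/prodf_neq0 => j _; rewrite ?expf_neq0 //;
  exact: X0.
- apply: prime_toM; apply: prime_to_prod => j _; first by apply: var; left; exists j.
  by apply: prime_toX; apply: var; right; exists j.
Qed.

Lemma arc_const (v : 'I_n -> F) (g : {mpoly F[n]}) :
  arc (fun e => (v e)%:P) g = (g.@[v])%:P.
Proof.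
elim/mpoly_ring_ind: g => [x|i|g h IHg IHh|g h IHg IHh].
- by rewrite arcC mevalC.
- by rewrite arcX mevalXU.
- by rewrite arcD mevalD IHg IHh polyCD.
- by rewrite arcM mevalM IHg IHh polyCM.
Qed.

Section OneAutomorphism.
Variables (phi psi : X -> X) (h h' : 'I_n -> {mpoly F[n]}).
Hypothesis hE : forall v e, val (phi v) ord0 e = (h e).@[val v ord0].
Hypothesis h'E : forall v e, val (psi v) ord0 e = (h' e).@[val v ord0].
Hypothesis phiK : cancel phi psi.

Lemma aut_poly_eq0 (v : 'I_n -> F) : f.@[v] = 0 -> f.@[fun e => (h e).@[v]] = 0.
Proof.
move=> fv; apply: etrans (pt_eq (phi (mk_pt fv))); apply: meval_eq => e.
by rewrite hE; apply: meval_eq => e'; rewrite mk_ptE.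
Qed.

Lemma aut_polyK (v : 'I_n -> F) : f.@[v] = 0 ->
  forall i, (h' i).@[fun e => (h e).@[v]] = v i.
Proof.
move=> fv i; have := h'E (phi (mk_pt fv)) i; rewrite phiK mk_ptE => ->.
by apply: meval_eq => e; rewrite hE; apply: meval_eq => e'; rewrite mk_ptE.
Qed.

Lemma aut_gradient (g : 'I_n -> {poly F}) N :
  arc g f = 0 -> (forall e, 'X^N %| arc g f^`M(e)) ->
  forall e, 'X^N %| arc (fun e => arc g (h e)) f^`M(e).
Proof.
exact: (gradient_arc vanish_trinomial aut_poly_eq0 aut_polyK).
Qed.

Lemma aut_arc_eq0 (g : 'I_n -> {poly F}) :
  arc g f = 0 -> arc (fun e => arc g (h e)) f = 0.
Proof.
move=> gf; apply: (poly_eq0_dense char0) => t; rewrite horner_arc.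
have gt : f.@[fun e => (g e).[t]] = 0 by rewrite -horner_arc gf horner0.
by rewrite -[RHS](aut_poly_eq0 gt); apply: meval_eq => e; rewrite horner_arc.
Qed.

(** The case of a constant arc and N = 1. *)
Lemma aut_singular v : singular (val v ord0) -> singular (val (phi v) ord0).
Proof.
move=> sv; apply: contraT => /regular_pointE[e].
pose g e : {poly F} := (val v ord0 e)%:P.
have gf : arc g f = 0 by rewrite arc_const pt_eq.
have gN e' : 'X^1 %| arc g f^`M(e').
  by rewrite arc_const (gradient_singular sv) dvdp0.
have /dvdpP[x E] := aut_gradient gf gN e; case/eqP.
have -> : (f^`M(e)).@[val (phi v) ord0] =
    (arc (fun e => arc g (h e)) f^`M(e)).[0].
  rewrite horner_arc; apply: meval_eq => e'; rewrite hE arc_const hornerC //.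
by rewrite E hornerM hornerXn mulr0.
Qed.

End OneAutomorphism.

Lemma automorphism_singular phi : automorphism phi ->
  forall v, singular (val (phi v) ord0) = singular (val v ord0).
Proof.
move=> [[h hE] [psi [[h' h'E] K1 K2]]] v; apply/idP/idP => s.
  by rewrite -(K1 v); apply: (aut_singular h'E hE K2).
exact: (aut_singular hE h'E K1).
Qed.

Lemma automorphism_regular phi : automorphism phi ->
  forall v, regular_point v -> regular_point (phi v).
Proof.
move=> A v /regular_pointE rv.
apply/regular_pointE.
by rewrite automorphism_singular.
Qed.

Hypothesis y_invariant : invariant_subring (@y_subring F k m p q a b c).

(** Composition with phi is an automorphism of the coordinate ring. *)
Lemma automorphism_y phi : automorphism phi ->
  exists H : 'I_m -> {mpoly F[m]}, forall v j, yc (phi v) j = (H j).@[yc v].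
Proof.
move=> [[h hE] [psi [[h' h'E] K1 K2]]].
have comp (xi : X -> X) g u : (forall v e, val (xi v) ord0 e = (g e).@[val v ord0]) ->
    regular_function u -> regular_function (fun v => u (xi v)).
  move=> gE [g' g'E]; exists (msubst g g') => v; rewrite g'E meval_msubst.
  by apply: meval_eq => e; rewrite gE.
have cra : @coordinate_ring_aut F n [:: f] (fun u v => u (phi v)).
  split=> //.
  - by move=> u; apply: comp hE.
  - by move=> u1 u2 _ _ E v; rewrite -(K2 v) E.
  - move=> u ru; exists (fun v => u (psi v)); first exact: comp h'E ru.
    by move=> v; rewrite /= K1.
have Y j : y_subring (fun v : X => yc v j) by exists 'X_j => v; rewrite mevalXU.
have /fin_all_exists[H HE] j := y_invariant cra (Y j).
by exists H => v j; apply: HE.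
Qed.

(** The quotient of X^d' - 1 by X - 1 has a root, and in characteristic zero 1 is
    not one. *)
Lemma other_root d' : (1 < d')%N -> exists2 w : F, w != 1 & w ^+ d' = 1.
Proof.
move=> d1; pose P : {poly F} := \sum_(i < d') 'X^i.
have P1 : ('X - 1) * P = 'X^d' - 1 by rewrite -subrX1.
have X1 : ('X - 1 : {poly F}) != 0 by rewrite -size_poly_eq0 size_XsubC.
have sP : size P != 1%N.
  have : size (('X - 1) * P) = d'.+1 by rewrite P1 size_XnsubC // ltnW.
  apply: contra_eq_neq => sP; have P0 : P != 0 by rewrite -size_poly_eq0 sP.
  by rewrite size_mul // size_XsubC sP /= ltn_eqF.
have [w rw] := closed_rootP P sP; exists w.
  apply: contraTneq rw => ->; rewrite rootE horner_sum.
  rewrite (eq_bigr (fun=> 1)) => [|i _]; last by rewrite hornerXn expr1n.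
  by rewrite sumr_const card_ord (natF_neq0 char0) // ltnW.
have := congr1 (horner^~ w) P1; rewrite hornerM (rootP rw) mulr0 !hornerE => /eqP.
by rewrite eq_sym subr_eq0 => /eqP.
Qed.

(** These points show that all values of y occur, and that z is not constant on
    the regular points of any fibre of y. *)
Lemma fibre_point (y : 'I_m -> F) (z : 'I_p -> F) : \prod_l z l ^+ b l = -1 ->
  exists2 v : X, regular_point v & yc v =1 y /\ zc v =1 z.
Proof.
move=> zE; pose v := @coords k m p q F (fun=> 0) y z (fun=> 1).
have fv : f.@[v] = 0.
  rewrite trinomialE /v (bigD1 i0) //= coordsX !mul0r add0r.
  under eq_bigr do rewrite coordsZ.
  rewrite [X in _ + X]big1 => [|r _]; last by rewrite coordsS expr1n.
  by rewrite zE addNr.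
exists (mk_pt fv); last first.
  by split=> j; rewrite ?/yc ?/zc mk_ptE /v coordsE.
apply/regular_pointE.
rewrite !negb_and; apply/orP; right; apply/orP; right; rewrite negb_exists.
by apply/forallP => r; rewrite mk_ptE /v coordsS oner_neq0.
Qed.

Lemma regular_z v j : regular_point v -> yc v j = 0 -> forall l, zc v l != 0.
Proof.
move=> /regular_pointE + yj l.
have hv : head_singular (val v ord0).
  by apply/orP; left; apply/existsP; exists j; apply/eqP.
rewrite /singular hv -(head_singular_tail (pt_eq v) hv) andbb.
by rewrite /= negb_exists => /forallP /(_ l).
Qed.

Lemma rootless_const (g : {poly F}) : (forall t, g.[t] != 0) -> forall s t, g.[s] = g.[t].
Proof.
move=> g0 s t; have [/eqP/size_poly1P[x _ ->]|/closed_rootP[r]] := eqVneq (size g) 1%N.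
  by rewrite !hornerC.
by move/rootP/eqP; rewrite (negPf (g0 r)).
Qed.

(** A polynomial curve of regular points over a point with some y_j zero has
    constant z, as the z_l have no zero along it. *)
Lemma linked_z phi v w j : automorphism phi -> linked v w -> regular_point v ->
  yc (phi v) j = 0 -> zc (phi w) =1 zc (phi v).
Proof.
move=> A vw; have [H HE] := automorphism_y A; have [[h hE] _] := A.
elim: vw => // {v w} v w z [Phi [PA P0 P1 [g gE] Py]] _ IH rv yj.
have rP s : regular_point (Phi s v).
  exact: automorphism_regular (Aut_alg_automorphism (PA s)) _ rv.
have yP s : yc (phi (Phi s v)) j = 0.
  by rewrite HE -yj HE; apply: meval_eq => j'; rewrite Py.
move=> l; rewrite IH; [|by rewrite -P1|by rewrite -P1].
have zE s : zc (phi (Phi s v)) l = (arc g (h (iz k m q l))).[s].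
  by rewrite /zc hE horner_arc; apply: meval_eq => e; rewrite gE.
rewrite -{1}P1 -{2}P0 !zE; apply: rootless_const => s; rewrite -zE.
exact: regular_z (automorphism_regular A (rP s)) (yP s) l.
Qed.

(** Otherwise phi would map a fibre without zero y_j, whose regular points are all
    joined to one base point, onto one with a zero y_j, where z is constant along
    the images of the joining curves; but z takes several values there. *)
Lemma automorphism_y_neq0 phi v : automorphism phi ->
  (forall j, yc v j != 0) -> forall j, yc (phi v) j != 0.
Proof.
move=> A yv j; apply/eqP => yj.
have [h [psi [rpsi K1 K2]]] := A.
have A' : automorphism psi by split=> //; exists phi.
have [H HE] := automorphism_y A; have [H' H'E] := automorphism_y A'.
have [zeta base] := linked_base.
(* psi maps these points into the fibre of v, where they are joined to the base *)
have const w1 w2 : regular_point w1 -> regular_point w2 ->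
    yc w1 =1 yc (phi v) -> yc w2 =1 yc (phi v) -> zc w1 =1 zc w2.
  have key w : regular_point w -> yc w =1 yc (phi v) -> exists v1,
     (forall e, val v1 ord0 e = coords (fun=> 0) (yc v) zeta (fun=> 1) e) /\
     zc w =1 zc (phi v1).
    move=> rw yw; have yw' : yc (psi w) =1 yc v.
      move=> j'; rewrite H'E -[in RHS](K1 v) H'E.
      by apply: meval_eq => i; rewrite yw.
    have [|v1 wv1 v1E] := base _ (automorphism_regular A' rw).
      by move=> j'; rewrite yw'.
    exists v1; split=> [e|l].
      rewrite v1E; case: (indexP e) => i; rewrite !coordsE //.
    rewrite (linked_z A wv1 (automorphism_regular A' rw) (j := j)) K2 //.
    by rewrite yw.
  move=> rw1 rw2 /(key _ rw1)[v1 [v1E z1]] /(key _ rw2)[v2 [v2E z2]] l.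
  by rewrite z1 z2; do 2 f_equal; apply: pt_inj => e; rewrite v1E v2E.
have [t tE] := @closed_root F (b l0) (-1) (ltnW (b_gt1 l0)).
have [w w1 wE] := other_root (b_gt1 l0).
pose z x l : F := if l == l0 then x else 1.
have zE x : \prod_l z x l ^+ b l = x ^+ b l0.
  rewrite (bigD1 l0) //= big1 => [|l /negPf ll0]; last by rewrite /z ll0 expr1n.
  by rewrite /z eqxx mulr1.
have [|v1 r1 [y1 z1]] := @fibre_point (yc (phi v)) (z t); first by rewrite zE.
have [|v2 r2 [y2 z2]] := @fibre_point (yc (phi v)) (z (t * w)).
  by rewrite zE exprMn tE wE mulr1.
have := const _ _ r1 r2 y1 y2 l0; rewrite z1 z2 /z eqxx => /eqP.
have t0 : t != 0.
  apply: contraTneq isT => t0; move/eqP: tE.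
  rewrite t0 expr0n (gtn_eqF (ltnW (b_gt1 l0))) eq_sym oppr_eq0.
  by rewrite (negPf (oner_neq0 F)).
rewrite -{1}[t]mulr1 (inj_eq (mulfI t0)) eq_sym.
by rewrite (negPf w1).
Qed.

(** ** The coordinate hyperplanes y_j = 0 *)

Lemma zeta_exists : exists z : 'I_p -> F, \prod_l z l ^+ b l = -1.
Proof.
have [t tE] := @closed_root F (b l0) (-1) (ltnW (b_gt1 l0)).
exists (fun l => if l == l0 then t else 1).
rewrite (bigD1 l0) //= big1 => [|l /negPf ll0]; last by rewrite ll0 expr1n.
by rewrite ?eqxx tE mulr1.
Qed.

Lemma fibre_point_y (y : 'I_m -> F) : exists v : X, yc v =1 y.
Proof.
have [z zE] := zeta_exists.
have [v _ [yv _]] := fibre_point y zE.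
by exists v.
Qed.

Section Group.
Variables (G : algebraic_group F) (act : group_points G -> X -> X).
Hypothesis cG : zariski_connected (ag_eqs G).
Hypothesis aA : algebraic_action act.

Let autg g : automorphism (act g) := action_automorphism aA g.

(** The group permutes the hyperplanes y_j = 0, because it preserves their
    union and acts on the affine space of the y. *)
Lemma action_y0 g v j : yc v j = 0 -> yc (act g v) j = 0.
Proof.
pose C j (v : X) := yc v j = 0.
apply: (@invariant_components F G n [:: f] act _ C cG aA _ _ _ g j v) => {g v j}.
- move=> j; exists (fun r => r = 'X_(iy k p q j)) => v; split.
    by move=> vj _ ->; rewrite mevalXU.
  by move=> /(_ _ erefl); rewrite mevalXU.
- move=> j j' jj'; have [v vE] := fibre_point_y (fun i => (i != j)%:R).
  have := jj' v; rewrite /C !vE /= eqxx => /(_ erefl) /eqP.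
  by case: (eqVneq j' j) => [->|_]; rewrite //= oner_eq0.
move=> g j; have [H HE] := automorphism_y (autg g).
apply: NNPP => nj.
have ne j' : exists2 y : 'I_m -> F, y j = 0 & (H j').@[y] != 0.
  apply: NNPP => ny; apply: nj; exists j' => v vj; rewrite /C HE.
  by apply/eqP; apply: contraT => Hv; case: ny; exists (yc v).
have [|||y yj Hy] := @linear_irreducible F char0 m (fun y => y j = 0)
    [seq H j' | j' <- enum 'I_m].
- by move=> v w s -> ->; rewrite subrr mulr0 addr0.
- by exists (fun=> 0).
- by move=> _ /mapP[j' _ ->].
have [v vE] := fibre_point_y y.
have A' : automorphism (act (ag_inv g)) := autg _.
have yv := automorphism_y_neq0 A'
  (v := act g v).
have nz i : yc (act g v) i != 0.
  rewrite HE (meval_eq _ vE); apply: Hy.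
  by apply: map_f; rewrite mem_enum.
by have := yv nz j; rewrite (action_cancel aA) vE yj eqxx.
Qed.

Lemma action_y g v j : (yc (act g v) j == 0) = (yc v j == 0).
Proof.
apply/eqP/eqP; last exact: action_y0.
by move=> /(action_y0 (ag_inv g)); rewrite (action_cancel aA).
Qed.

(** As a polynomial in y, the function y_j o g vanishes on the hyperplane y_j = 0,
    hence is divisible by y_j. *)
Lemma action_y_multiple g : exists r : 'I_m -> {mpoly F[m]},
  forall v j, yc (act g v) j = yc v j * (r j).@[yc v].
Proof.
have [H HE] := automorphism_y (autg g).
have /fin_all_exists[r rE] j : exists r, H j = 'X_j * r.
  apply: (dvd_X char0) => y yj; have [v vE] := fibre_point_y y.
  by rewrite -(meval_eq _ vE) -HE action_y0 // vE.
by exists r => v j; rewrite HE rE mevalM mevalXU.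
Qed.

(** ** Arcs along which the gradient vanishes to the order of y^a *)

(** At a singular point with some y_j = 0 such an arc exists if and only if some
    x_i vanishes, which separates the points with a single zero x_i from those
    with none.  Indeed y_j times the derivative in y_j is a_j x y^a; its order is
    at least N + 1, larger than that of y^a, so that x is zero at the point.
    Conversely, if x_i = 0, then moving the zero y_j alone leaves only the
    derivatives in x, which are multiples of y^a. *)
Definition special v := exists (g : 'I_n -> {poly F}) N,
  [/\ arc g f = 0, forall e, (g e).[0] = val v ord0 e,
      forall e, 'X^N %| arc g f^`M(e) &
      ~~ ('X^(N.+1) %| \prod_j g (iy k p q j) ^+ a j)].

(** The order of the gradient is preserved by the chain rule; that of y^a does not
    increase, because y_j is y_j o g^-1 composed with g, a multiple of y_j o g. *)
Lemma action_special g v : special v -> special (act g v).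
Proof.
move=> [ga [N [ga0 gav gaN gaY]]].
have [[h hE] _] := autg g; have [[h' h'E] _] := autg (ag_inv g).
exists (fun e => arc ga (h e)), N; split.
- exact: (aut_arc_eq0 hE ga0).
- by move=> e; rewrite horner_arc hE; apply: meval_eq.
- exact: (aut_gradient hE h'E (action_cancel aA g) ga0 gaN).
have [r rE] := action_y_multiple (ag_inv g).
pose R j := arc (fun j => arc ga (h (iy k p q j))) (r j).
have gaE j : ga (iy k p q j) = arc ga (h (iy k p q j)) * R j.
  apply: (poly_eq_dense char0) => t.
  have ft : f.@[fun e => (ga e).[t]] = 0 by rewrite -horner_arc ga0 horner0.
  have yt j' : yc (act g (mk_pt ft)) j' = (arc ga (h (iy k p q j'))).[t].
    by rewrite /yc hE horner_arc; apply: meval_eq => e; rewrite mk_ptE.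
  rewrite hornerM /R [X in _ * X]horner_arc -yt.
  rewrite -(meval_eq _ yt).
  by rewrite -rE (action_cancel aA) /yc mk_ptE.
apply: contra gaY => H; under eq_bigr do rewrite gaE exprMn.
by rewrite big_split /=; apply: dvdp_mulr.
Qed.

End Group.

Lemma special_x0 v j : yc v j = 0 -> special v -> exists i, xc v i = 0.
Proof.
move=> yj [g [N [g0 gv gN gY]]].
have [/existsP[i /eqP xi]|] := boolP [exists i, xc v i == 0]; first by exists i.
rewrite negb_exists => /forallP x0; case/negP: gY.
have Xy : 'X %| g (iy k p q j).
  by rewrite -[X in X %| _]subr0 -polyC0 dvdp_XsubCl rootE gv; apply/eqP.
have aE : arc g f^`M(iy k p q j) * g (iy k p q j) =
    ((a j)%:R%:P * \prod_i g (ix m p q i)) * \prod_j g (iy k p q j) ^+ a j.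
  rewrite mderiv_y raddfMn /= arcM rmorphXn /= arcX arcM !rmorph_prod /=.
  under eq_bigr do rewrite arcX.
  under [X in _ * (_ * X)]eq_bigr do rewrite rmorphXn /= arcX.
  have E : g (iy k p q j) ^+ a j = g (iy k p q j) ^+ (a j).-1 * g (iy k p q j).
    by rewrite -exprSr prednK // ltnW.
  by rewrite [X in _ = _ * X](bigD1 j) //= E polyC_natr mulr_natl !mulrnAl;
    congr (_ *+ _); ring.
apply: (@dvdXn_unit F _ ((a j)%:R%:P * \prod_i g (ix m p q i))).
  rewrite hornerM hornerC mulf_neq0 //.
    by rewrite (natF_neq0 char0) // ltnW.
  rewrite horner_prod; apply/prodf_neq0 => i _; rewrite gv; exact: x0.
rewrite -aE exprSr; exact: dvdp_mul.
Qed.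

Lemma x0_special v i : singular (val v ord0) -> xc v i = 0 -> special v.
Proof.
move=> sv xi; have /and3P[hv zv sv'] := sv.
pose M : pred 'I_m := fun j => yc v j == 0.
pose g := coords (fun i => (xc v i)%:P) (fun j => (yc v j)%:P + (M j)%:R *: 'X)
  (fun l => (zc v l)%:P) (fun r => (sc v r)%:P) : 'I_n -> {poly F}.
pose N := (\sum_(j | M j) a j)%N.
pose C := \prod_(j | ~~ M j) yc v j ^+ a j.
have YE : \prod_j g (iy k p q j) ^+ a j = C%:P * 'X^N.
  rewrite (bigID M) /= mulrC; congr (_ * _).
    rewrite /C rmorph_prod; apply: eq_bigr => j /negPf Mj /=.
    by rewrite /g coordsY Mj scale0r addr0 rmorphXn.
  rewrite /N -prodrXr; apply: eq_bigr => j Mj /=.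
  by rewrite /g coordsY Mj (eqP Mj) scale1r polyC0 add0r.
have C0 : C != 0 by apply/prodf_neq0 => j Mj; rewrite expf_neq0.
have gz l t : (g (iz k m q l)).[t] = zc v l by rewrite /g coordsZ hornerC.
have gs r t : (g (is_ k m p r)).[t] = sc v r by rewrite /g coordsS hornerC.
have gx i' t : (g (ix m p q i')).[t] = xc v i' by rewrite /g coordsX hornerC.
have tail0 t T : ((fun e => (g e).[t]) (tail k m T) ^+ (tail_exp b c T).-1 *
    (tail_rest F k m b c T).@[fun e => (g e).[t]]) = 0.
  apply/eqP; rewrite (tail_rest_eq0 (fun e => (g e).[t])).
  case: T => _; [case/existsP: zv | case/existsP: sv'] => l l0'; apply/existsP; exists l.
    by rewrite gz.
  by rewrite gs.
exists g, N; split.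
- apply: (poly_eq0_dense char0) => t; rewrite horner_arc trinomialE.
  rewrite (bigD1 i) //= gx xi !mul0r add0r.
  case/existsP: zv => l /eqP zl; case/existsP: sv' => r /eqP sr.
  rewrite (bigD1 l) //= gz [zc v l]zl expr0n gtn_eqF ?(ltnW (b_gt1 l)) // mul0r add0r.
  by rewrite (bigD1 r) //= gs [sc v r]sr expr0n gtn_eqF ?(ltnW (c_gt1 r)) // mul0r.
- move=> e; rewrite /g; case: (indexP e) => l; rewrite !coordsE ?hornerC //.
  by rewrite hornerD hornerC hornerZ hornerX mulr0 addr0.
- have zero e : (forall t, (f^`M(e)).@[fun e => (g e).[t]] = 0) -> 'X^N %| arc g f^`M(e).
    move=> H; rewrite (_ : arc _ _ = 0) ?dvdp0 //.
    by apply: (poly_eq0_dense char0) => t; rewrite horner_arc.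
  move=> e; case: (indexP e) => [i'|j|l|r].
  + rewrite mderiv_x /head_rest arcM !rmorph_prod /=; apply: dvdp_mull.
    under eq_bigr do rewrite rmorphXn /= arcX.
    by rewrite YE dvdp_mull.
  + apply: zero => t; rewrite mderiv_y mevalMn mevalM /y_rest mevalM rmorph_prod /=.
    by rewrite (bigD1 i) //= mevalXU gx xi !(mul0r, mulr0, mul0rn).
  + apply: zero => t; rewrite (mderiv_tail F a b c i (inl l)) mevalMn mevalM rmorphXn.
    by rewrite /= mevalXU (tail0 t (inl l)) mul0rn.
  + apply: zero => t; rewrite (mderiv_tail F a b c i (inr r)) mevalMn mevalM rmorphXn.
    by rewrite /= mevalXU (tail0 t (inr r)) mul0rn.
rewrite YE; apply/negP => /dvdp_leq; rewrite mulf_neq0 ?polyC_eq0 ?expf_neq0 ?polyX_eq0 //.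
by move=> /(_ isT); rewrite mul_polyC size_scale // !size_polyXn ltnn.
Qed.

(** ** The strata of the singular locus *)

Implicit Types S : {set 'I_n}.
Local Notation "'X[' i ']'" := (ix m p q i).
Local Notation "'Y[' j ']'" := (iy k p q j).
Local Notation "'Z[' l ']'" := (iz k m q l).
Local Notation "'S[' r ']'" := (is_ k m p r).

(** The minimal sets of the first family give the components of the singular
    locus; those of the second give the components of the part where some x_i and
    some y_j vanish, which arcs single out. *)
Definition singular_pattern S : bool :=
  [&& [exists j, Y[j] \in S] ||
      [exists i, exists i', [&& i != i', X[i] \in S & X[i'] \in S]],
      [exists l, Z[l] \in S] & [exists r, S[r] \in S]].

Definition xy_pattern S : bool :=
  [&& singular_pattern S, [exists i, X[i] \in S] & [exists j, Y[j] \in S]].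

Lemma singular_patternE (v : 'I_n -> F) : singular_pattern (zeros v) = singular v.
Proof.
rewrite /singular_pattern /singular /head_singular.
congr [&& _ || _, _ & _]; apply: eq_existsb => j; rewrite ?inE //.
by apply: eq_existsb => j'; rewrite !inE.
Qed.

Lemma singular_pattern_up S S' : S \subset S' -> singular_pattern S -> singular_pattern S'.
Proof.
move=> /subsetP SS' /and3P[hS /existsP[l lS] /existsP[r rS]]; apply/and3P; split.
- case/orP: hS => [/existsP[j jS]|/existsP[i /existsP[i' /and3P[ii' iS i'S]]]].
    by apply/orP; left; apply/existsP; exists j; apply: SS'.
  apply/orP; right; apply/existsP; exists i; apply/existsP; exists i'.
  by rewrite ii' !SS'.
- by apply/existsP; exists l; apply: SS'.
- by apply/existsP; exists r; apply: SS'.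
Qed.

Lemma xy_pattern_up S S' : S \subset S' -> xy_pattern S -> xy_pattern S'.
Proof.
move=> SS' /and3P[sS /existsP[i iS] /existsP[j jS]]; move/subsetP: (SS') => SS.
rewrite /xy_pattern (singular_pattern_up SS' sS) /=; apply/andP; split; apply/existsP.
  by exists i; apply: SS.
by exists j; apply: SS.
Qed.

Lemma singular_eq0 (v : 'I_n -> F) : singular v -> f.@[v] = 0.
Proof.
move=> /and3P[hv /existsP[l /eqP zl] /existsP[r /eqP sr]].
rewrite trinomialE (head_singular_prod hv) add0r.
rewrite (bigD1 l) //= zl expr0n gtn_eqF ?(ltnW (b_gt1 l)) // mul0r add0r.
by rewrite (bigD1 r) //= sr expr0n gtn_eqF ?(ltnW (c_gt1 r)) // mul0r.
Qed.

Lemma minset_yzs j l r : minset singular_pattern [set Y[j]; Z[l]; S[r]].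
Proof.
apply/minsetP; split.
  apply/and3P; split; [apply/orP; left | |]; apply/existsP;
    [exists j | exists l | exists r]; by rewrite !inE eqxx ?orbT.
move=> B /and3P[hB /existsP[l' lB] /existsP[r' rB]] /subsetP BS.
apply/eqP; rewrite eqEsubset; apply/andP; split; first exact/subsetP.
have := BS _ lB; rewrite !inE !eq_index orbF /= => /eqP ll'.
have := BS _ rB; rewrite !inE !eq_index /= => /eqP rr'.
apply/subsetP => e; rewrite !inE => /orP[/orP[]|] /eqP -> //; rewrite -?ll' -?rr' //.
case/orP: hB => [/existsP[j' jB]|/existsP[i /existsP[i' /and3P[_ iB _]]]].
  by have := BS _ jB; rewrite !inE !eq_index !orbF => /eqP <-.
by have := BS _ iB; rewrite !inE !eq_index.
Qed.

Lemma minset_xxzs i i' l r : i != i' ->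
  minset singular_pattern [set X[i]; X[i']; Z[l]; S[r]].
Proof.
move=> ii'; apply/minsetP; split.
  apply/and3P; split; [apply/orP; right | |]; last 2 first.
  - by apply/existsP; exists l; rewrite !inE eqxx ?orbT.
  - by apply/existsP; exists r; rewrite !inE eqxx ?orbT.
  - apply/existsP; exists i; apply/existsP; exists i'.
    by rewrite ii' !inE !eqxx ?orbT.
move=> B /and3P[hB /existsP[l' lB] /existsP[r' rB]] /subsetP BS.
apply/eqP; rewrite eqEsubset; apply/andP; split; first exact/subsetP.
have := BS _ lB; rewrite !inE !eq_index orbF /= => /eqP ll'.
have := BS _ rB; rewrite !inE !eq_index /= => /eqP rr'.
have [xi xi'] : X[i] \in B /\ X[i'] \in B.
  case/orP: hB => [/existsP[j jB]|/existsP[i1 /existsP[i2 /and3P[i12 iB i'B]]]].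
    by have := BS _ jB; rewrite !inE !eq_index.
  have := BS _ iB; have := BS _ i'B; rewrite !inE !eq_index !orbF.
  move=> /orP[] /eqP E2 /orP[] /eqP E1; subst; rewrite ?eqxx // in i12 *.
apply/subsetP => e; rewrite !inE => /orP[/orP[/orP[]|]|] /eqP -> //;
by rewrite -?ll' -?rr'.
Qed.

Lemma minset_xyzs i j l r : minset xy_pattern [set X[i]; Y[j]; Z[l]; S[r]].
Proof.
apply/minsetP; split.
  apply/and3P; split; [apply/and3P; split; [apply/orP; left| |]| |]; apply/existsP;
    [exists j | exists l | exists r | exists i | exists j]; by rewrite !inE eqxx ?orbT.
move=> B /and3P[/and3P[_ /existsP[l' lB] /existsP[r' rB]] /existsP[i' iB] /existsP[j' jB]].
move=> /subsetP BS; apply/eqP; rewrite eqEsubset; apply/andP; split; first exact/subsetP.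
have := BS _ lB; rewrite !inE !eq_index orbF /= => /eqP ll'.
have := BS _ rB; rewrite !inE !eq_index /= => /eqP rr'.
have := BS _ iB; rewrite !inE !eq_index !orbF /= => /eqP ii'.
have := BS _ jB; rewrite !inE !eq_index !orbF /= => /eqP jj'.
apply/subsetP => e; rewrite !inE => /orP[/orP[/orP[]|]|] /eqP -> //;
by rewrite -?ll' -?rr' -?ii' -?jj'.
Qed.

Section Group.
Variables (G : algebraic_group F) (act : group_points G -> X -> X).
Hypothesis cG : zariski_connected (ag_eqs G).
Hypothesis aA : algebraic_action act.

Lemma action_singular g v :
  singular (val (act g v) ord0) = singular (val v ord0).
Proof.
exact: (automorphism_singular (action_automorphism aA g)).
Qed.

Lemma singular_pattern_act S : minset singular_pattern S -> forall g v,
  S \subset zeros (val v ord0) -> S \subset zeros (val (act g v) ord0).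
Proof.
apply: (invariant_coordinate_subspaces char0 cG aA).
- exact: singular_pattern_up.
- by move=> v; rewrite singular_patternE; apply: singular_eq0.
- by move=> g v; rewrite !singular_patternE action_singular.
Qed.

Lemma xy_pattern_act S : minset xy_pattern S -> forall g v,
  S \subset zeros (val v ord0) -> S \subset zeros (val (act g v) ord0).
Proof.
apply: (invariant_coordinate_subspaces char0 cG aA).
- exact: xy_pattern_up.
- move=> v /and3P[+ _ _]; rewrite singular_patternE; exact: singular_eq0.
move=> g v /and3P[+ /existsP[i xi] /existsP[j yj]].
rewrite /xy_pattern !singular_patternE action_singular => sv; rewrite sv /=.
rewrite !inE in xi yj; apply/andP; split; apply/existsP.
  have yj' : yc (act g v) j = 0.
    by apply: (action_y0 cG aA);
      apply/eqP.
  have [|i' xi'] := special_x0 yj'.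
    apply: (action_special cG aA).
    by apply: (x0_special sv (i := i)); apply/eqP.
  by exists i'; rewrite inE; apply/eqP.
exists j; rewrite inE; apply/eqP.
by apply: (action_y0 cG aA); apply/eqP.
Qed.

(** Each vanishing coordinate of a singular point belongs to a maximal
    coordinate subspace through the point in one of the two families. *)
Lemma zeros_act_sub g v : singular (val v ord0) ->
  zeros (val v ord0) \subset zeros (val (act g v) ord0).
Proof.
move=> sv; have /and3P[hv /existsP[l1 zl1] /existsP[r1 sr1]] := sv.
pose Z := zeros (val v ord0).
have use1 S e : minset singular_pattern S -> e \in S -> S \subset Z ->
    e \in zeros (val (act g v) ord0).
  by move=> mS eS /(singular_pattern_act mS g) /subsetP; apply.
have use2 S e : minset xy_pattern S -> e \in S -> S \subset Z ->
    e \in zeros (val (act g v) ord0).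
  by move=> mS eS /(xy_pattern_act mS g) /subsetP; apply.
have sub3 e1 e2 e3 : e1 \in Z -> e2 \in Z -> e3 \in Z -> [set e1; e2; e3] \subset Z.
  by move=> h1 h2 h3; apply/subsetP => e /setUP[/set2P[]|/set1P] ->.
have sub4 e1 e2 e3 e4 : e1 \in Z -> e2 \in Z -> e3 \in Z -> e4 \in Z ->
    [set e1; e2; e3; e4] \subset Z.
  move=> h1 h2 h3 h4; rewrite subUset sub3 // sub1set //.
have zl1' : Z[l1] \in Z by rewrite inE.
have sr1' : S[r1] \in Z by rewrite inE.
have zs l r : Z[l] \in Z -> S[r] \in Z ->
    Z[l] \in zeros (val (act g v) ord0) /\ S[r] \in zeros (val (act g v) ord0).
  move=> zl sr.
  case/orP: hv => [/existsP[j yj]|/existsP[i /existsP[i' /and3P[ii' xi xi']]]].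
    have yj' : Y[j] \in Z by rewrite inE.
    by split; apply: (use1 _ _ (minset_yzs j l r)); rewrite ?sub3 // !inE eqxx ?orbT.
  have xi1 : X[i] \in Z by rewrite inE.
  have xi2 : X[i'] \in Z by rewrite inE.
  by split; apply: (use1 _ _ (minset_xxzs l r ii')); rewrite ?sub4 // !inE eqxx ?orbT.
apply/subsetP => e eZ; case: (indexP e) eZ => [i|j|l|r] eZ.
- case/orP: hv => [/existsP[j yj]|/existsP[i1 /existsP[i2 /and3P[i12 xi1 xi2]]]].
    have yj' : Y[j] \in Z by rewrite inE.
    by apply: (use2 _ _ (minset_xyzs i j l1 r1)); rewrite ?sub4 // !inE eqxx ?orbT.
  have [i' ii' xi'] : exists2 i', i != i' & X[i'] \in Z.
    have [E|ii1] := eqVneq i i1; last by exists i1; rewrite // inE.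
    by exists i2; rewrite ?E // inE.
  by apply: (use1 _ _ (minset_xxzs l1 r1 ii')); rewrite ?sub4 // !inE eqxx ?orbT.
- by apply: (use1 _ _ (minset_yzs j l1 r1)); rewrite ?sub3 // !inE eqxx ?orbT.
- by have [] := zs l r1 eZ sr1'.
- by have [] := zs l1 r zl1' eZ.
Qed.

Lemma zeros_act g v : singular (val v ord0) ->
  zeros (val (act g v) ord0) = zeros (val v ord0).
Proof.
move=> sv; apply/eqP; rewrite eqEsubset zeros_act_sub // andbT.
have sgv : singular (val (act g v) ord0) by rewrite action_singular.
by have := zeros_act_sub (ag_inv g) sgv; rewrite (action_cancel aA).
Qed.

End Group.

(** ** The components of the regular points over a stratum of the y *)

Local Notation zprod v := (\prod_l zc v l ^+ (b l %/ d)).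
Local Notation sprod v := (\prod_r sc v r ^+ (c r %/ d)).

Lemma regular_ratio v j : regular_point v -> yc v j = 0 ->
  sprod v != 0 /\ (zprod v / sprod v) ^+ d = -1.
Proof.
move=> rv yj; have z0 := regular_z rv yj.
have hv : head_singular (val v ord0).
  by apply/orP; left; apply/existsP; exists j; apply/eqP.
have zb0 : zprod v ^+ d != 0.
  by rewrite -prod_div_b; apply/prodf_neq0 => l _; rewrite expf_neq0.
have E : sprod v ^+ d = - zprod v ^+ d.
  have := pt_eq v; rewrite trinomialE (head_singular_prod hv) add0r.
  rewrite prod_div_b prod_div_c addrC => /eqP.
  by rewrite addr_eq0 => /eqP.
have s0 : sprod v != 0.
  move: zb0; rewrite -[X in X != 0]opprK -E oppr_eq0 expf_eq0 negb_and.
  by rewrite gcd_bc_gt0 //.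
split=> //; rewrite expr_div_n E invrN mulrN divff //.
Qed.

Lemma Oy_regular (M : {set 'I_m}) e v : M != set0 -> O_y M e v -> regular_point v.
Proof.
move=> M0 [_ zE zs0]; apply/regular_pointE.
rewrite !negb_and; apply/orP; right; apply/orP; left.
rewrite negb_exists; apply/forallP => l; move: zs0; rewrite -zE.
move=> /prodf_neq0 /(_ l isT); rewrite expf_eq0 negb_and.
by rewrite b_div_gt0.
Qed.

Section Group.
Variables (G : algebraic_group F) (act : group_points G -> X -> X).
Hypothesis cG : zariski_connected (ag_eqs G).
Hypothesis aA : algebraic_action act.

Lemma closed_action_eq0 v (g : {mpoly F[n]}) :
  @zariski_closed F _ (ag_eqs G) (fun x => g.@[val (act x v) ord0] = 0).
Proof.
have [h hE] := act_regular aA.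
have E x : g.@[val (act x v) ord0] = (msubst (fix_right (val v)) (msubst h g)).@[val x ord0].
  by rewrite meval_fix_right meval_msubst; apply: meval_eq => e; rewrite hE.
exists (fun r => r = msubst (fix_right (val v)) (msubst h g)) => x; rewrite E.
by split=> [H _ ->|/(_ _ erefl)].
Qed.

(** The quotient of the d-th roots of the last two monomials takes finitely many
    values on the regular points with some y_j = 0; a connected group fixes it. *)
Lemma Oy_action (M : {set 'I_m}) e g v : M != set0 -> e ^+ d = -1 ->
  O_y M e v -> O_y M e (act g v).
Proof.
move=> M0 ed Ov; have rv := Oy_regular M0 Ov; have [yv zE zs0] := Ov.
have /set0Pn[j jM] := M0.
have rg x : regular_point (act x v).
  exact: (automorphism_regular (action_automorphism aA x)).
have yE x j' : (yc (act x v) j' == 0) = (j' \in M).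
  by rewrite (action_y cG aA).
have yj x : yc (act x v) j = 0 by apply/eqP; rewrite yE.
pose Q t : {mpoly F[n]} := (\prod_l 'X_(iz k m q l) ^+ (b l %/ d)) -
  t%:MP * \prod_r 'X_(is_ k m p r) ^+ (c r %/ d).
have QE t (x : X) : (Q t).@[val x ord0] = zprod x - t * sprod x.
  rewrite mevalB mevalM mevalC !rmorph_prod /=.
  by congr (_ - _ * _); apply: eq_bigr => i _; rewrite rmorphXn /= mevalXU.
pose A t (x : points (ag_eqs G)) := (Q t).@[val (act x v) ord0] = 0.
have AE t x : A t x <-> zprod (act x v) / sprod (act x v) = t.
  have [s0 _] := regular_ratio (rg x) (yj x).
  rewrite /A QE; split=> [/eqP|<-]; last by rewrite divfK // subrr.
  by rewrite subr_eq0 => /eqP ->; rewrite mulfK.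
have [rs rsE] := closed_field_poly_normal ('X^d - (-1)%:P : {poly F}).
have rsP t : t ^+ d = -1 -> t \in rs.
  move=> td; have : root ('X^d - (-1)%:P) t by rewrite rootE !hornerE td subrr.
  by rewrite rsE lead_coefXnsubC ?gcd_bc_gt0 // scale1r root_prod_XsubC.
have cl := closed_action_eq0 v.
have [x|x [/AE Ax [t]]||H] := cG (cl (Q e))
    (zariski_closed_bigU [seq t <- rs | t != e] (fun t => cl (Q t))).
- have [_ /rsP rt] := regular_ratio (rg x) (yj x).
  set t := _ / _ in rt; have [te|te] := eqVneq t e.
    by left; apply/AE.
  by right; exists t; [rewrite mem_filter te | apply/AE].
- by rewrite mem_filter => /andP[/eqP te _] /AE At; apply: te; rewrite -At.
- move=> /(_ g) /AE Ag; have [s0 E] := regular_ratio (rg g) (yj g).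
  have zgE : zprod (act g v) = e * sprod (act g v) by rewrite -Ag divfK.
  split=> //; rewrite -zgE; apply: contra_eq_neq E => ->.
  by rewrite mul0r expr0n gtn_eqF ?gcd_bc_gt0 // eq_sym oppr_eq0 oner_neq0.
have [t] := H (ag_one G); rewrite mem_filter => /andP[/eqP te _] /AE.
rewrite (act_one aA) zE mulfK => [/esym|]; first by move/te.
by move: zs0; rewrite mulf_eq0 negb_or => /andP[].
Qed.

Lemma generic_action g v : O_generic v -> O_generic (act g v).
Proof.
move=> [rv yv]; split.
  exact: (automorphism_regular (action_automorphism aA g)).
by move=> j; rewrite (action_y cG aA).
Qed.

Lemma Osing_singular (K : {set 'I_k}) (M : {set 'I_m}) (P : {set 'I_p})
    (Q : {set 'I_q}) v :
  (2 <= 2 * #|M| + #|K|)%N -> P != set0 -> Q != set0 ->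
  O_sing K M P Q v -> singular (val v ord0).
Proof.
move=> KM /set0Pn[l lP] /set0Pn[r rQ] [xv yv zv sv]; apply/and3P; split.
- have [M0|/set0Pn[j jM]] := eqVneq M set0; last first.
    by apply/orP; left; apply/existsP; exists j; have := yv j; rewrite jM.
  move: KM; rewrite M0 cards0 muln0 add0n => /card_gt1P[i [i' [iK i'K ii']]].
  apply/orP; right; apply/existsP; exists i; apply/existsP; exists i'; rewrite ii'.
  by have := xv i; have := xv i'; rewrite iK i'K /xc => -> ->.
- by apply/existsP; exists l; have := zv l; rewrite lP.
- by apply/existsP; exists r; have := sv r; rewrite rQ.
Qed.

Lemma Osing_action (K : {set 'I_k}) (M : {set 'I_m}) (P : {set 'I_p})
    (Q : {set 'I_q}) g v :
  (2 <= 2 * #|M| + #|K|)%N -> P != set0 -> Q != set0 ->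
  O_sing K M P Q v -> O_sing K M P Q (act g v).
Proof.
move=> KM P0 Q0 Ov; have sv := Osing_singular KM P0 Q0 Ov; have [xv yv zv sv'] := Ov.
have Z e : (val (act g v) ord0 e == 0) = (val v ord0 e == 0).
  have := zeros_act cG aA g sv.
  by move=> /setP /(_ e); rewrite !inE.
by split=> j; rewrite /xc /yc /zc /sc Z; [apply: xv | apply: yv | apply: zv | apply: sv'].
Qed.

End Group.

Definition stable (A : X -> Prop) := forall phi : X -> X, Aut_alg phi ->
  forall v, A v <-> A (phi v).

(** The generators suffice, since the inverse of one is again a generator. *)
Lemma stable_actions (A : X -> Prop) :
  (forall (G : algebraic_group F) (act : group_points G -> X -> X),
    zariski_connected (ag_eqs G) -> algebraic_action act ->
    forall g v, A v -> A (act g v)) -> stable A.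
Proof.
move=> H phi; elim=> {phi} [D phi [G [cG [act aA DE]]] /DE[_ [g E]] v|//|
  f1 f2 _ IH1 _ IH2 v|f1 f2 _ IH K1 K2 v].
- rewrite E; split; first exact: H.
  by move=> /(H G act cG aA (ag_inv g)); rewrite (action_cancel aA).
- by rewrite -IH1 -IH2.
- by rewrite (IH (f2 v)) K2.
Qed.

Lemma stable_generic : stable (@O_generic F k m p q a b c).
Proof. by apply: stable_actions => G act cG aA g v; apply: generic_action. Qed.

Lemma stable_Oy (M : {set 'I_m}) e : M != set0 -> e ^+ d = -1 ->
  stable (@O_y F k m p q a b c M e).
Proof. by move=> M0 ed; apply: stable_actions => G act cG aA g v; apply: Oy_action. Qed.

Lemma stable_Osing (K : {set 'I_k}) (M : {set 'I_m}) (P : {set 'I_p}) (Q : {set 'I_q}) :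
  (2 <= 2 * #|M| + #|K|)%N -> P != set0 -> Q != set0 ->
  stable (@O_sing F k m p q a b c K M P Q).
Proof.
by move=> KM P0 Q0; apply: stable_actions => G act cG aA g v; apply: Osing_action.
Qed.

Lemma stable_orbit (A : X -> Prop) x : A x -> stable A ->
  (forall v w, A v -> A w -> same_orbit v w) ->
  forall v, A v <-> exists2 phi : X -> X, Aut_alg phi & phi x = v.
Proof.
move=> Ax sA tA v; split; first exact: tA.
by move=> [phi Aphi <-]; apply/(sA phi Aphi x).
Qed.

End TrinomialHypersurface.

Theorem theorem6p4 (F : closedFieldType) (char0 : [pchar F] =i pred0)
  (k m p q : nat) (a : 'I_m -> nat) (b : 'I_p -> nat) (c : 'I_q -> nat)
  (k_gt1 : (1 < k)%N) (m_ge1 : (1 <= m)%N) (p_ge1 : (1 <= p)%N)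
  (a_gt1 : forall j, (1 < a j)%N)
  (b_gt1 : forall l, (1 < b l)%N)
  (c_gt1 : forall r, (1 < c r)%N)
  (not_flexible : ~ flexible (trinomial F k a b c))
  (y_invariant : invariant_subring (@y_subring F k m p q a b c)) :
  [/\ Aut_alg_orbit (@O_generic F k m p q a b c),
      forall (M : {set 'I_m}) (e : F), M != set0 -> e ^+ gcd_bc b c = -1 ->
        Aut_alg_orbit (@O_y F k m p q a b c M e),
      forall (K : {set 'I_k}) (M : {set 'I_m}) (P : {set 'I_p}) (Q : {set 'I_q}),
        (2 <= 2 * #|M| + #|K|)%N -> P != set0 -> Q != set0 ->
        Aut_alg_orbit (@O_sing F k m p q a b c K M P Q)
    & forall A : X F k a b c -> Prop, Aut_alg_orbit A ->
        [\/ forall v, A v <-> O_generic v,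
            exists (M : {set 'I_m}) (e : F),
              [/\ M != set0, e ^+ gcd_bc b c = -1 & forall v, A v <-> O_y M e v]
          | exists (K : {set 'I_k}) (M : {set 'I_m}) (P : {set 'I_p}) (Q : {set 'I_q}),
              [/\ (2 <= 2 * #|M| + #|K|)%N, P != set0, Q != set0
                & forall v, A v <-> O_sing K M P Q v]]].

Proof.
pose X := X F k a b c.
have d0 := gcd_bc_gt0 c p_ge1 b_gt1.
have e_neq0 (e : F) : e ^+ gcd_bc b c = -1 -> e != 0.
  apply: contra_eq_neq => ->; rewrite expr0n (gtn_eqF d0).
  by rewrite eq_sym oppr_eq0 oner_neq0.
have orb1 := @stable_orbit F k m p q a b c _ _ _
  (stable_generic char0 k_gt1 p_ge1 a_gt1 b_gt1 c_gt1 y_invariant)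
  (@generic_same_orbit F k m p q char0 a b c k_gt1 p_ge1 a_gt1 b_gt1 c_gt1).
have orb2 (M : {set 'I_m}) (e : F) x (M0 : M != set0) (ed : e ^+ gcd_bc b c = -1) Ox :=
  @stable_orbit F k m p q a b c _ x Ox
  (stable_Oy char0 k_gt1 p_ge1 a_gt1 b_gt1 c_gt1 y_invariant M0 ed)
  (fun v w => Oy_same_orbit char0 k_gt1 p_ge1 a_gt1 b_gt1 c_gt1 M0 (e_neq0 e ed)).
have orb3 (K : {set 'I_k}) (M : {set 'I_m}) (P : {set 'I_p}) (Q : {set 'I_q}) x
    (KM : (2 <= 2 * #|M| + #|K|)%N) (P0 : P != set0) (Q0 : Q != set0) Ox :=
  @stable_orbit F k m p q a b c _ x Ox
  (stable_Osing char0 k_gt1 p_ge1 a_gt1 b_gt1 c_gt1 y_invariant KM P0 Q0)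
  (fun v w => Osing_same_orbit char0 k_gt1 p_ge1 a_gt1 b_gt1 KM P0).
split.
- by have [x Ox] := generic_nonempty char0 b c k_gt1 a_gt1; exists x; apply: orb1.
- move=> M e M0 ed.
  have [x Ox] := Oy_nonempty a k_gt1 p_ge1 b_gt1 M0 ed.
  by exists x; apply: orb2.
- move=> K M P Q KM P0 Q0.
  have [x Ox] := Osing_nonempty F a_gt1 b_gt1 c_gt1 KM P0 Q0.
  by exists x; apply: orb3.
move=> A [x AE].
have [sx|nsx] := boolP (singular (val x ord0)).
  pose K := [set i | xc x i == 0]; pose M := [set j | yc x j == 0].
  pose P := [set l | zc x l == 0]; pose Q := [set r | sc x r == 0].
  have Ox : O_sing K M P Q x by split=> i; rewrite inE.
  have /and3P[hx /existsP[l zl] /existsP[r sr]] := sx.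
  have KM : (2 <= 2 * #|M| + #|K|)%N.
    case/orP: hx => [/existsP[j yj]|/existsP[i /existsP[i' /and3P[ii' xi xi']]]].
      have : (0 < #|M|)%N by apply/card_gt0P; exists j; rewrite inE.
      by case: #|M| => // u _; rewrite mulnS -addnA.
    have : (1 < #|K|)%N by apply/card_gt1P; exists i, i'; split; rewrite ?inE.
    by move=> K1; apply: leq_trans K1 (leq_addl _ _).
  have P0 : P != set0 by apply/set0Pn; exists l; rewrite inE.
  have Q0 : Q != set0 by apply/set0Pn; exists r; rewrite inE.
  apply: Or33; exists K, M, P, Q; split=> // v.
  exact: iff_trans (AE v) (iff_sym (orb3 _ _ _ _ _ KM P0 Q0 Ox v)).
have rx : regular_point x by apply/(regular_pointE char0 k_gt1 p_ge1 a_gt1 b_gt1 c_gt1).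
have [/existsP[j /eqP yj]|] := boolP [exists j, yc x j == 0].
  have [s0 ed] := regular_ratio char0 k_gt1 p_ge1 a_gt1 b_gt1 c_gt1 rx yj.
  pose M := [set j | yc x j == 0].
  have M0 : M != set0 by apply/set0Pn; exists j; rewrite inE yj.
  set e := _ / _ in ed.
  have Ox : O_y M e x.
    split=> [j'||]; first by rewrite inE.
      by rewrite /e divfK.
    by rewrite mulf_neq0 // e_neq0.
  apply: Or32; exists M, e; split=> // v.
  exact: iff_trans (AE v) (iff_sym (orb2 _ _ _ M0 ed Ox v)).
rewrite negb_exists => /forallP yx; apply: Or31 => v.
exact: iff_trans (AE v) (iff_sym (orb1 x (conj rx yx) v)).
Qed.
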